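(* Let $n>1$ and let $\mathcal{B}=\mathbb{C}[x]/(x^2+1)$ be the bicomplex numbers with the involution $(a+xb)^*=\bar a+x\bar b$ ($a,b\in\mathbb{C}$). The space $$M=\{(q,z)\in M_n(\mathcal{B})\times \mathbb{R}[x]/(x^2+1): q^2=q,\ \mathrm{Tr}(q)=1,\ z^2\,\mathrm{Tr}(q^\dagger q)=1\}$$ is naturally a complex hyperkähler manifold, with the structure $(g;i,I,x)$ described in the context.
   Context: For $q\in M_n(\mathcal{B})$, $q^\dagger$ is the transpose with $*$ applied entrywise. The projection $(q,z)\mapsto q$ identifies the tangent space of $M$ at $(q,z)$ with $\{a\in M_n(\mathcal{B}): qa+aq=a\}$, a $\mathcal{B}$-module. On it define $$I_{(q,z)}(a)=z[a^\dagger,q]+\frac{z^3}{2}\mathrm{Tr}(a^\dagger q)[q,q^\dagger],\qquad h_{(q,z)}(a,b)=z\,\mathrm{Tr}(ab^\dagger)-\frac{z^3}{2}\mathrm{Tr}(q^\dagger a)\mathrm{Tr}(qb^\dagger)\in\mathcal{B},$$ let $i$ and $x$ denote multiplication by the elements $i\in\mathbb{C}\subset\mathcal{B}$ and $x\in\mathcal{B}$, and let $g$ be the real symmetric form obtained by taking the real part of $h$, where the real part of $\alpha+x\beta\in\mathcal{B}$ ($\alpha,\beta\in\mathbb{C}$) is $\mathrm{Re}(\alpha)$. A complex hyperkähler manifold is the analogue of a hyperkähler manifold with the quaternions replaced by the biquaternions $\mathbb{H}\otimes_{\mathbb{R}}\mathbb{C}$: a manifold with a pseudo-Riemannian metric $g$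 and a fibrewise action of $\mathbb{H}\otimes_{\mathbb{R}}\mathbb{C}$ on the tangent bundle by endomorphisms parallel for the Levi-Civita connection of $g$, such that complex scalars act $g$-self-adjointly, and for every $(u,v,w)\in\mathbb{C}^3$ with $u^2+v^2+w^2=1$ the endomorphism determined by $u\mathbf{i}+v\mathbf{j}+w\mathbf{k}$ is an integrable almost complex structure compatible with (i.e. isometric for) $g$. Here the scalar field $\mathbb{C}$ is $\mathbb{R}[x]/(x^2+1)$ acting by multiplication, and $\mathbf{i},\mathbf{j},\mathbf{k}$ act by $i$, $I$ and $iI$. *)

(* Defs.v *)
From HB Require Import structures.
From mathcomp Require Import all_boot all_order all_algebra.
From mathcomp Require Import all_classical all_reals all_analysis.
From mathcomp Require Import complex.
Set Implicit Arguments.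
Unset Strict Implicit.
Unset Printing Implicit Defensive.
Import Order.TTheory GRing.Theory Num.Theory numFieldNormedType.Exports.
Local Open Scope classical_set_scope.
Local Open Scope ring_scope.
Local Open Scope complex_scope.

(* C^oo on U, for open U: every iterated directional derivative exists and is
   Frechet differentiable at every point of U. *)
Definition smooth_on (R : realType) (m : nat) (W : normedModType R)
    (U : set 'rV[R]_m) (f : 'rV[R]_m -> W) : Prop :=
  forall (s : seq 'rV[R]_m) (u : 'rV[R]_m), U u ->
    differentiable (foldr (fun v h => 'D_v h) f s) u.

(* Vector fields on U are given by their components X : R^m -> R^m. *)
Definition lie_bracket (R : realType) (m : nat) (X Y : 'rV[R]_m -> 'rV[R]_m)
    (u : 'rV[R]_m) : 'rV[R]_m :=
  'D_(X u) Y u - 'D_(Y u) X u.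

Section Submanifold.
Variables (R : realType) (E : vectType R).

(* E is identified with R^N through a fixed basis; the topology and the notion
   of smoothness obtained this way do not depend on the basis. *)
Definition coords : E -> 'rV[R]_(\dim {:E}) := passmx.rVof (vbasis {:E}).
Definition of_coords : 'rV[R]_(\dim {:E}) -> E := passmx.vecof (vbasis {:E}).

(* The coordinate frame (d phi / d u_j)_j of a parametrization phi. *)
Definition frame (m : nat) (phi : 'rV[R]_m -> E) (u : 'rV[R]_m) : m.-tuple E :=
  [tuple of_coords ('D_(delta_mx 0 j) (coords \o phi) u) | j < m].

(* By [lp_homeo] with V = U, phi @` U is a relatively open subset of M; for the
   other V it says that the inverse of phi is continuous. *)
Record local_param (M : set E) (m : nat) (U : set 'rV[R]_m)
    (phi : 'rV[R]_m -> E) : Prop := LocalParam {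
  lp_open : open U;
  lp_smooth : smooth_on U (coords \o phi);
  lp_immersion : forall u, U u -> free (frame phi u);
  lp_inj : set_inj U phi;
  lp_homeo : forall V : set 'rV[R]_m, open V -> V `<=` U ->
    exists W : set 'rV[R]_(\dim {:E}),
      open W /\ phi @` V = M `&` coords @^-1` W }.

Definition submanifold (m : nat) (M : set E) : Prop :=
  forall p, M p -> exists (U : set 'rV[R]_m) (phi : 'rV[R]_m -> E),
    local_param M U phi /\ (phi @` U) p.

Definition tangent (M : set E) (p : E) : set E :=
  [set a | exists (m : nat) (U : set 'rV[R]_m) (phi : 'rV[R]_m -> E)
      (u : 'rV[R]_m),
    [/\ local_param M U phi, U u, phi u = p & a \in <<frame phi u>>%VS]].

Definition gram (g : E -> E -> E -> R) (m : nat) (phi : 'rV[R]_m -> E)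
    (u : 'rV[R]_m) : 'M[R]_m :=
  \matrix_(i, j) g (phi u) (tnth (frame phi u) i) (tnth (frame phi u) j).

Record pseudo_riemannian (m : nat) (M : set E) (g : E -> E -> E -> R) : Prop :=
  PseudoRiemannian {
  pr_linear : forall p, M p -> forall (r : R) (a b c : E),
    tangent M p a -> tangent M p b -> tangent M p c ->
    g p (r *: a + b) c = r * g p a c + g p b c;
  pr_sym : forall p, M p -> forall a b : E,
    tangent M p a -> tangent M p b -> g p a b = g p b a;
  pr_nondegenerate : forall p, M p -> forall a : E, tangent M p a ->
    (forall b, tangent M p b -> g p a b = 0) -> a = 0;
  pr_smooth : forall (U : set 'rV[R]_m) (phi : 'rV[R]_m -> E),
    local_param M U phi -> smooth_on U (gram g phi) }.

(* Gamma_ij^k of the pulled back metric. *)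
Definition christoffel (g : E -> E -> E -> R) (m : nat)
    (phi : 'rV[R]_m -> E) (u : 'rV[R]_m) (i j k : 'I_m) : R :=
  let dG (l : 'I_m) := 'D_(delta_mx 0 l) (gram g phi) u in
  2^-1 * \sum_(l < m)
    (dG i j l + dG j i l - dG l i j) * invmx (gram g phi u) l k.

Definition levi_civita (g : E -> E -> E -> R) (m : nat)
    (phi : 'rV[R]_m -> E) (X Y : 'rV[R]_m -> 'rV[R]_m)
    (u : 'rV[R]_m) : 'rV[R]_m :=
  'D_(X u) Y u +
  \row_k \sum_(i < m) \sum_(j < m)
    X u 0 i * Y u 0 j * christoffel g phi u i j k.

(* Row j contains the components of J (d phi / d u_j), so that J acts on
   component rows by right multiplication. *)
Definition endo_mx (J : E -> E -> E) (m : nat) (phi : 'rV[R]_m -> E)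
    (u : 'rV[R]_m) : 'M[R]_m :=
  \matrix_(j, k) coord (frame phi u) k (J (phi u) (tnth (frame phi u) j)).

Definition endo_app (J : E -> E -> E) (m : nat) (phi : 'rV[R]_m -> E)
    (X : 'rV[R]_m -> 'rV[R]_m) (u : 'rV[R]_m) : 'rV[R]_m :=
  X u *m endo_mx J phi u.

Record bundle_endo (m : nat) (M : set E) (J : E -> E -> E) : Prop :=
  BundleEndo {
  be_tangent : forall p, M p -> forall a : E,
    tangent M p a -> tangent M p (J p a);
  be_linear : forall p, M p -> forall (r : R) (a b : E),
    tangent M p a -> tangent M p b ->
    J p (r *: a + b) = r *: J p a + J p b;
  be_smooth : forall (U : set 'rV[R]_m) (phi : 'rV[R]_m -> E),
    local_param M U phi -> smooth_on U (endo_mx J phi) }.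

Definition parallel (m : nat) (M : set E) (g : E -> E -> E -> R)
    (J : E -> E -> E) : Prop :=
  forall (U : set 'rV[R]_m) (phi : 'rV[R]_m -> E), local_param M U phi ->
  forall X Y : 'rV[R]_m -> 'rV[R]_m, smooth_on U X -> smooth_on U Y ->
  forall u, U u ->
    levi_civita g phi X (endo_app J phi Y) u =
    endo_app J phi (levi_civita g phi X Y) u.

Definition self_adjoint (M : set E) (g : E -> E -> E -> R)
    (J : E -> E -> E) : Prop :=
  forall p, M p -> forall a b : E, tangent M p a -> tangent M p b ->
    g p (J p a) b = g p a (J p b).

Definition compatible (M : set E) (g : E -> E -> E -> R)
    (J : E -> E -> E) : Prop :=
  forall p, M p -> forall a b : E, tangent M p a -> tangent M p b ->
    g p (J p a) (J p b) = g p a b.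

Definition almost_complex (M : set E) (J : E -> E -> E) : Prop :=
  forall p, M p -> forall a : E, tangent M p a -> J p (J p a) = - a.

(* Vanishing of the Nijenhuis torsion, i.e. [T^{0,1}, T^{0,1}] is contained in
   T^{0,1}. *)
Definition integrable (m : nat) (M : set E) (J : E -> E -> E) : Prop :=
  forall (U : set 'rV[R]_m) (phi : 'rV[R]_m -> E), local_param M U phi ->
  forall X Y : 'rV[R]_m -> 'rV[R]_m, smooth_on U X -> smooth_on U Y ->
  forall u, U u ->
    let JX := endo_app J phi X in
    let JY := endo_app J phi Y in
    lie_bracket JX JY u
      - endo_app J phi (lie_bracket JX Y) u
      - endo_app J phi (lie_bracket X JY) u
      - lie_bracket X Y u = 0.

End Submanifold.

(* (s, u, v, w) stands for s + u i + v j + w k in the quaternion algebra over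
   C; the componentwise product of the underlying product type is not used. *)
Definition biquaternion (R : realType) : Type :=
  (R[i] * R[i] * R[i] * R[i])%type.

Definition bq_one (R : realType) : biquaternion R := (1, 0, 0, 0).

Definition bq_add (R : realType) (s t : biquaternion R) : biquaternion R :=
  let: (s0, s1, s2, s3) := s in let: (t0, t1, t2, t3) := t in
  (s0 + t0, s1 + t1, s2 + t2, s3 + t3).

Definition bq_scale (R : realType) (c : R[i]) (s : biquaternion R) :
    biquaternion R :=
  let: (s0, s1, s2, s3) := s in (c * s0, c * s1, c * s2, c * s3).

Definition bq_mul (R : realType) (s t : biquaternion R) : biquaternion R :=
  let: (s0, s1, s2, s3) := s in let: (t0, t1, t2, t3) := t in
  (s0 * t0 - s1 * t1 - s2 * t2 - s3 * t3,
   s0 * t1 + s1 * t0 + s2 * t3 - s3 * t2,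
   s0 * t2 - s1 * t3 + s2 * t0 + s3 * t1,
   s0 * t3 + s1 * t2 - s2 * t1 + s3 * t0).

Record complex_hyperkahler (R : realType) (E : vectType R) (m : nat)
    (M : set E) (g : E -> E -> E -> R)
    (rho : biquaternion R -> E -> E -> E) : Prop := ComplexHyperkahler {
  chk_manifold : submanifold m M;
  chk_metric : pseudo_riemannian m M g;
  chk_endo : forall s, bundle_endo m M (rho s);
  chk_linear : forall p, M p -> forall a, tangent M p a ->
    forall (r : R) (s t : biquaternion R),
      rho (bq_add (bq_scale r%:C s) t) p a = r *: rho s p a + rho t p a;
  chk_one : forall p, M p -> forall a, tangent M p a -> rho (bq_one R) p a = a;
  chk_mul : forall p, M p -> forall a, tangent M p a ->
    forall s t : biquaternion R, rho (bq_mul s t) p a = rho s p (rho t p a);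
  chk_parallel : forall s, parallel m M g (rho s);
  chk_scalars : forall c : R[i], self_adjoint M g (rho (c, 0, 0, 0));
  chk_unit : forall u v w : R[i], u ^+ 2 + v ^+ 2 + w ^+ 2 = 1 ->
    [/\ almost_complex M (rho (0, u, v, w)),
        integrable m M (rho (0, u, v, w)) &
        compatible M g (rho (0, u, v, w))] }.

(* C[x]/(x^2+1): the pair [alpha +i* beta] with alpha, beta in C = R[i] stands
   for alpha + x beta, so that the outer imaginary unit is x. *)
Definition bicomplex (R : realType) := complex R[i].
HB.instance Definition _ (R : realType) :=
  GRing.ComNzRing.copy (bicomplex R) (complex R[i]).

Section Bicomplex.
Variable R : realType.
Local Notation B := (bicomplex R).

Definition bc_i : B := @Complex R[i] 'i 0.

Definition bc_star (b : B) : B := @Complex R[i] (complex.Re b)^* (complex.Im b)^*.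

(* The real part of alpha + x beta is Re alpha. *)
Definition bc_re (b : B) : R := complex.Re (complex.Re b).

(* The inclusion of R[x]/(x^2+1). That ring is also represented by R[i], but
   its imaginary unit is sent to x, not to i. *)
Definition of_Rx (c : R[i]) : B :=
  @Complex R[i] (complex.Re c)%:C (complex.Im c)%:C.

Definition dagger (n : nat) (q : 'M[B]_n) : 'M[B]_n := map_mx bc_star q^T.

Definition commutator (n : nat) (a b : 'M[B]_n) : 'M[B]_n := a *m b - b *m a.

End Bicomplex.

Definition ambient (R : realType) (n : nat) : Type :=
  ('M[bicomplex R]_n * R[i])%type.
HB.instance Definition _ (R : realType) (n : nat) :=
  GRing.Zmodule.copy (ambient R n) ('M[bicomplex R]_n * R[i])%type.

Section AmbientVect.
Variables (R : realType) (n : nat).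

Definition ambient_scale (r : R) (p : ambient R n) : ambient R n :=
  (of_Rx r%:C *: p.1, r%:C * p.2).

Lemma of_RxD : {morph @of_Rx R : c d / c + d}.
Proof. by move=> [a b] [c d]; rewrite /of_Rx /= !rmorphD. Qed.

Lemma of_RxM : {morph @of_Rx R : c d / c * d}.
Proof.
by move=> [a b] [c d]; rewrite /of_Rx /= rmorphB rmorphD !rmorphM.
Qed.

Lemma of_Rx1 : of_Rx 1 = 1 :> bicomplex R.
Proof. by []. Qed.

Fact ambient_scaleA r s p :
  ambient_scale r (ambient_scale s p) = ambient_scale (r * s) p.
Proof.
by rewrite /ambient_scale /= scalerA -of_RxM mulrA -rmorphM.
Qed.

Fact ambient_scale1 : left_id 1 ambient_scale.
Proof. by move=> [q z]; rewrite /ambient_scale /= of_Rx1 scale1r mul1r. Qed.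

Fact ambient_scaleDr : right_distributive ambient_scale +%R.
Proof.
by move=> r [q z] [q' z']; rewrite /ambient_scale /= scalerDr mulrDr.
Qed.

Fact ambient_scaleDl p : {morph ambient_scale^~ p : r s / r + s}.
Proof.
by move=> r s; rewrite /ambient_scale rmorphD of_RxD scalerDl mulrDl.
Qed.

HB.instance Definition _ := GRing.Zmodule_isLmodule.Build R (ambient R n)
  ambient_scaleA ambient_scale1 ambient_scaleDr ambient_scaleDl.

Local Notation reals :=
  ('M[R]_n * 'M[R]_n * 'M[R]_n * 'M[R]_n * R^o * R^o)%type.

Definition ambient_reals (p : ambient R n) : reals :=
  (map_mx (fun b : bicomplex R => complex.Re (complex.Re b)) p.1,
   map_mx (fun b : bicomplex R => complex.Im (complex.Re b)) p.1,
   map_mx (fun b : bicomplex R => complex.Re (complex.Im b)) p.1,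
   map_mx (fun b : bicomplex R => complex.Im (complex.Im b)) p.1,
   complex.Re p.2, complex.Im p.2).

Definition reals_ambient (v : reals) : ambient R n :=
  let: (a, b, c, d, s, t) := v in
  (\matrix_(i, j) (@Complex R[i] (a i j +i* b i j) (c i j +i* d i j)),
   s +i* t).

Fact ambient_realsK : cancel ambient_reals reals_ambient.
Proof.
move=> [q [s t]]; congr (_, _); apply/matrixP => i j; rewrite !mxE.
by case: (q i j) => [[a b] [c d]].
Qed.

Fact reals_ambientK : cancel reals_ambient ambient_reals.
Proof.
by move=> [[[[[a b] c] d] s] t]; congr (_, _, _, _, _, _);
  apply/matrixP => i j; rewrite !mxE.
Qed.

Fact ambient_reals_linear : linear ambient_reals.
Proof.
move=> r [q [s t]] [q' [s' t']].
congr (_, _, _, _, _, _); rewrite /= ?mul0r ?subr0 ?addr0 //;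
  apply/matrixP => i j; rewrite !mxE;
  case: (q i j) => [[a b] [c d]]; case: (q' i j) => [[a' b'] [c' d']] /=;
  by rewrite !(mul0r, subr0, addr0, mulr0).
Qed.

Fact ambient_vect_axiom :
  Vector.axiom (\dim {: reals}) (ambient R n).
Proof.
exists (fun p => coords (ambient_reals p)).
  by move=> r p q; rewrite ambient_reals_linear; apply: passmx.rVof_linear.
have eP : basis_of {: reals} (vbasis {: reals}) by exact: vbasisP.
exists (fun v => reals_ambient (of_coords v)).
  by move=> p; rewrite /coords /of_coords passmx.rVofK // ambient_realsK.
by move=> v; rewrite reals_ambientK /coords /of_coords passmx.vecofK.
Qed.

HB.instance Definition _ :=
  Lmodule_hasFinDim.Build R (ambient R n) ambient_vect_axiom.

End AmbientVect.

Section Space.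
Variables (R : realType) (n : nat).
Local Notation B := (bicomplex R).
Local Notation E := (ambient R n).

Definition M_space : set E :=
  [set p | [/\ p.1 *m p.1 = p.1, \tr p.1 = 1 &
               of_Rx p.2 ^+ 2 * \tr (dagger p.1 *m p.1) = 1]].

Definition tangent_model (q : 'M[B]_n) : set 'M[B]_n :=
  [set a | q *m a + a *m q = a].

(* The inverse of the restriction of (q, z) |-> q to the tangent space at p. *)
Definition lift (p : E) (a : 'M[B]_n) : E :=
  xget 0 [set v : E | tangent M_space p v /\ v.1 = a].

Definition I_end (p : E) (a : 'M[B]_n) : 'M[B]_n :=
  let q := p.1 in let z := of_Rx p.2 in
  z *: commutator (dagger a) q
  + (z ^+ 3 * of_Rx 2^-1 * \tr (dagger a *m q)) *: commutator q (dagger q).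

Definition h_form (p : E) (a b : 'M[B]_n) : B :=
  let q := p.1 in let z := of_Rx p.2 in
  z * \tr (a *m dagger b)
  - z ^+ 3 * of_Rx 2^-1 * \tr (dagger q *m a) * \tr (q *m dagger b).

Definition M_metric (p v w : E) : R := bc_re (h_form p v.1 w.1).

(* Complex scalars act through R[x]/(x^2+1), and i, j, k act by i, I, i I. *)
Definition bq_act_model (s : biquaternion R) (p : E) (a : 'M[B]_n) :
    'M[B]_n :=
  let: (s0, s1, s2, s3) := s in
  of_Rx s0 *: a + of_Rx s1 *: (bc_i R *: a) + of_Rx s2 *: I_end p a
  + of_Rx s3 *: (bc_i R *: I_end p a).

Definition M_action (s : biquaternion R) (p v : E) : E :=
  lift p (bq_act_model s p v.1).

End Space.

Arguments M_space R n : clear implicits.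
Arguments M_metric R n : clear implicits.
Arguments M_action R n : clear implicits.

(* Main.v *)
From HB Require Import structures.
Require Import Defs.
From mathcomp Require Import all_boot all_order all_algebra.
From mathcomp Require Import all_classical all_reals all_analysis.
From mathcomp Require Import complex ring lra.

Set Implicit Arguments.
Unset Strict Implicit.
Unset Printing Implicit Defensive.
Import Order.TTheory GRing.Theory Num.Theory numFieldNormedType.Exports.
Local Open Scope classical_set_scope.
Local Open Scope ring_scope.
Local Open Scope complex_scope.

(** Everything rests on one algebraic fact. An idempotent q of trace one over B
    has rank one, in the sense that q m q = Tr(q m) q for every matrix m
    ([bc_rank_one]); this holds because B is a product of two copies of the
    complex numbers. The tangent condition q a + a q = a makes a off-diagonal
    with respect to q, and rank one turns every trace of a product of such
    matrices into a polynomial in traces of shorter ones. The computations that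
    follow from this are done over an arbitrary commutative ring with an
    involution, so that they are identities between a few scalars.

    Manifold structure. Near a point (q0, z0) every idempotent of trace one is
    (1 + a) q0 (1 + a) / (1 + Tr(q0 a a)) for a unique a tangent at q0, namely
    a = (q0 q + q q0) / Tr(q0 q) - 2 q0, and z is then z0 times a square root.
    Both directions are explicit, so no implicit function theorem is needed
    ([chart_local_param]). Idempotents of trace one are conjugate, hence all
    tangent spaces have the same dimension ([dim_tang_vs]); differentiating the
    three equations of M identifies them ([tangentP], [tangent_bij]).

    The metric. On tangent vectors h(c, I b) = Tr(q [b, c]) ([h_J]), which is
    alternating, free of z, and nondegenerate. Together with I^2 = -1
    ([J_sqr]) and the antilinearity of I this gives the biquaternion action,
    its compatibility with h and the nondegeneracy of g.

    The connection. Differentiating h along a tangent vector a produces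
    kappa(a, b, c) + kappa(a, c, b)^*, where kappa is B-linear and symmetric in
    its first two arguments ([hform_derivative], [kappaC]). So the Koszul
    formula says that e = nabla_X Y is the tangent vector with
    h(e, c) = h(dY, c) + kappa(X, Y, c) for all tangent c; the Koszul formula
    only yields the real part of this, but both sides are antilinear in c
    ([nabla_vec]). As kappa is B-linear in Y, multiplication by B is parallel.

    I is parallel ([levi_civita_J], [nabla_I]): by [second_derivative_idag], in
    Tr(q [c, .]) the vectors nabla_X Y and dY differ by a cubic form that is
    totally symmetric in X, Y, c. Differentiating h(c, I b) = Tr(q [b, c]) along
    X, the two cubic terms cancel by symmetry and Tr(X [b, c]) vanishes
    ([tr_tang3]), which leaves the equation that characterizes nabla_X (I Y).

    Finally nabla is torsion free, so a parallel J with J^2 = -1 has vanishing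
    Nijenhuis tensor ([nijenhuis_zero]). *)

(** * Rank-one idempotents and the Hermitian form over a commutative ring *)

(** Unlike [mxE] this stops at the entries of a and b, which lets [ring] treat
    the entries of matrix products as atoms. *)
Lemma add_mxE (V : nmodType) m n (a b : 'M[V]_(m, n)) i j :
  (a + b) i j = a i j + b i j.
Proof. exact: mxE. Qed.

Lemma opp_mxE (V : zmodType) m n (a : 'M[V]_(m, n)) i j : (- a) i j = - a i j.
Proof. exact: mxE. Qed.

Lemma scale_mxE (B : nzRingType) m n x (a : 'M[B]_(m, n)) i j :
  (x *: a) i j = x * a i j.
Proof. exact: mxE. Qed.

Ltac mxexpand := rewrite ?(mulmxDr, mulmxDl, mulmxBr, mulmxBl, mulmxN, mulNmx,
  =^~ scalemxAl, =^~ scalemxAr, scalerDr, scalerBr, mulmxA).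
Ltac mxring := apply/matrixP => ? ?;
  rewrite ?(add_mxE, opp_mxE, scale_mxE); ring.

Section Trace.
Variables (B : comNzRingType) (n : nat).
Implicit Types q p a b c m : 'M[B]_n.

Definition comm (a b : 'M[B]_n) := a *m b - b *m a.

Definition rank_one_idem q :=
  [/\ q *m q = q, \tr q = 1 & forall m, q *m m *m q = \tr (q *m m) *: q].

Definition tang q a := q *m a + a *m q = a.

Lemma tr_rot3 a b c : \tr (a *m b *m c) = \tr (b *m c *m a).
Proof. by rewrite -mulmxA mxtrace_mulC. Qed.

Lemma trB a b : \tr (a - b) = \tr a - \tr b.
Proof. exact: raddfB. Qed.

(** With respect to the splitting by q and 1 - q, a tangent vector is
    off-diagonal; this is its vanishing diagonal block. *)
Lemma tang_qaq q a : q *m q = q -> tang q a -> q *m a *m q = 0.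
Proof.
move=> qq ta; have := congr1 (fun x => q *m x) ta.
by rewrite mulmxDr !mulmxA qq -[RHS]addr0 => /addrI.
Qed.

Lemma tang_comm q m : q *m q = q -> tang q (comm m q).
Proof.
move=> qq; by rewrite /tang /comm; mxexpand; rewrite qq -(mulmxA m) qq; mxring.
Qed.

Lemma tang_comm_r q m : q *m q = q -> tang q (comm q m).
Proof.
move=> qq; rewrite /tang /comm; mxexpand; rewrite qq -(mulmxA m) qq; mxring.
Qed.

Lemma tangD q a b : tang q a -> tang q b -> tang q (a + b).
Proof. by rewrite /tang mulmxDr mulmxDl addrACA => -> ->. Qed.

Lemma tangZ q x a : tang q a -> tang q (x *: a).
Proof. by rewrite /tang -scalemxAr -scalemxAl -scalerDr => ->. Qed.

(** A product of two tangent vectors is block diagonal, and its block at q is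
    a multiple of q because q has rank one. *)
Lemma tang_mul q a b : rank_one_idem q -> tang q a -> tang q b ->
  a *m b = \tr (q *m a *m b) *: q + a *m q *m b.
Proof.
move=> [qq trq q1] ta tb; rewrite -{1}ta mulmxDl; congr (_ + _).
rewrite -[in LHS]tb mulmxDr !mulmxA (tang_qaq qq ta) mul0mx add0r -mulmxA -mulmxA.
by rewrite [a *m _]mulmxA mulmxA q1 mulmxA.
Qed.

End Trace.

Section Core.
Variables (B : comNzRingType) (n : nat) (half z : B) (q p : 'M[B]_n).
Hypotheses (half2 : half + half = 1) (q_idem : rank_one_idem q)
  (p_idem : rank_one_idem p) (zt : z ^+ 2 * \tr (p *m q) = 1).
Implicit Types a b c m w : 'M[B]_n.

(** The form h with p in the role of the adjoint of q and w in the role of the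
    adjoint of the second argument. Keeping q and p independent makes
    everything below polynomial. *)
Definition herm a w := z * \tr (a *m w) - z ^+ 3 * half * \tr (p *m a) * \tr (q *m w).

(** The derivative of h along a is the sum of this and of its mirror image, see
    [hform_derivative]. *)
Definition kap a b w :=
  - (z ^+ 3 * half * (\tr (p *m a) * \tr (b *m w) + \tr (p *m b) * \tr (a *m w)))
  + 3%:R * half ^+ 2 * z ^+ 5 * \tr (p *m a) * \tr (p *m b) * \tr (q *m w).

(** The adjoint of I(c), see [dag_J]. *)
Definition idag c := z *: comm p c + (z ^+ 3 * half * \tr (p *m c)) *: comm q p.

(** Its antisymmetrization Tr(q [a, b]) is the Kirillov-Kostant form of the
    conjugation orbit of q. By [trp_tang] the forms [up] and [dn] split
    Tr(p a) according to the two off-diagonal blocks of a. *)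
Definition pairing a b := \tr (q *m a *m b).
Definition up a := \tr (p *m q *m a).
Definition dn a := \tr (p *m a *m q).

Lemma trp_tang a : tang q a -> \tr (p *m a) = up a + dn a.
Proof. by move=> {1}<-; rewrite mulmxDr mxtraceD !mulmxA. Qed.

(** Rank one of p gives p a q p = Tr(p a q) p, and rank one of q gives
    q p q = Tr(p q) q with Tr(p q) inverse to z^2. *)
Lemma tr_paqb a b : \tr (p *m a *m q *m b) = z ^+ 2 * (dn a * up b).
Proof.
have [_ _ p1] := p_idem; have [_ _ q1] := q_idem.
have dp : dn a *: p = p *m a *m q *m p by rewrite -(mulmxA p a q) p1 mulmxA.
have qpq : q *m p *m q = \tr (p *m q) *: q by rewrite q1 mxtrace_mulC.
rewrite /up -mxtraceZ -[in RHS]mulmxA scalemxAl dp !mulmxA.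
rewrite -(mulmxA _ p q) -(mulmxA _ q (p *m q)) (mulmxA q p) qpq -scalemxAr -scalemxAl.
by rewrite mxtraceZ mulrA zt mul1r.
Qed.

Lemma tr_q_idag c : \tr (q *m idag c) = z * (dn c - up c).
Proof.
have [qq _ _] := q_idem.
rewrite /idag /comm mulmxDr -!scalemxAr mxtraceD !mxtraceZ !mulmxBr !trB !mulmxA.
have -> : \tr (q *m p *m q) = \tr (p *m q) by rewrite tr_rot3 -mulmxA qq.
rewrite qq [\tr (q *m p)]mxtrace_mulC subrr mulr0 addr0.
by rewrite [\tr (q *m p *m c)]tr_rot3 -[\tr (q *m c *m p)]tr_rot3.
Qed.

Lemma tr_a_idag a c : tang q a -> tang q c ->
  \tr (a *m idag c) = z * \tr (p *m q) * (pairing c a - pairing a c)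
    + z ^+ 3 * half * (dn c - up c) * \tr (p *m a).
Proof.
move=> ta tc; rewrite /idag /comm mulmxDr -!scalemxAr mxtraceD !mxtraceZ.
rewrite !mulmxBr !trB.
have -> : \tr (a *m (p *m c)) = pairing c a * \tr (p *m q) + z ^+ 2 * (dn c * up a).
  rewrite mxtrace_mulC -mulmxA (tang_mul q_idem tc ta) mulmxDr mxtraceD -scalemxAr mxtraceZ.
  by rewrite -tr_paqb !mulmxA.
have -> : \tr (a *m (c *m p)) = pairing a c * \tr (p *m q) + z ^+ 2 * (dn a * up c).
  rewrite mulmxA -tr_rot3 -mulmxA (tang_mul q_idem ta tc) mulmxDr mxtraceD.
  by rewrite -scalemxAr mxtraceZ -tr_paqb !mulmxA.
have -> : \tr (a *m (q *m p)) = dn a by rewrite mulmxA -tr_rot3.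
have -> : \tr (a *m (p *m q)) = up a by rewrite mxtrace_mulC.
rewrite -/(pairing c a) -/(pairing a c).
rewrite (trp_tang ta) (trp_tang tc).
set t := \tr (p *m q).
have E : forall x, (half + half - 1) * x = 0 by move=> x; rewrite half2 subrr mul0r.
apply/eqP; rewrite -subr_eq0; apply/eqP.
(* The difference of the two sides is this multiple of 2 half - 1 = 0. *)
rewrite -(E (z ^+ 3 * (dn a * up c - dn c * up a))); ring.
Qed.

(** The z-dependent terms of h and of I cancel against each other: h(c, I b)
    is the Kirillov-Kostant form. *)
Lemma herm_idag b c : tang q b -> tang q c ->
  herm c (idag b) = \tr (q *m comm b c).
Proof.
move=> tb tc; rewrite /herm tr_a_idag // tr_q_idag /comm mulmxBr trB !mulmxA.
rewrite -/(pairing b c) -/(pairing c b).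
have ztq := zt; set t := \tr (p *m q) in ztq *.
transitivity ((z ^+ 2 * t) * (pairing b c - pairing c b)); first by ring.
by rewrite ztq mul1r.
Qed.

(** The non-tangential part of the derivative along a of a tangent field with
    value b, that is, the second fundamental form of the orbit of q. *)
Definition sff a b := a *m q *m b + b *m q *m a - (pairing a b + pairing b a) *: q.

Lemma q_sff a b : tang q a -> tang q b ->
  q *m sff a b = - ((pairing a b + pairing b a) *: q).
Proof.
have [qq _ _] := q_idem => ta tb.
rewrite /sff mulmxBr mulmxDr !mulmxA !(tang_qaq qq) // !mul0mx addr0 add0r.
by rewrite -scalemxAr qq.
Qed.

Lemma sff_q a b : tang q a -> tang q b ->
  sff a b *m q = - ((pairing a b + pairing b a) *: q).
Proof.
have [qq _ _] := q_idem => ta tb.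
rewrite /sff mulmxBl mulmxDl -!mulmxA !(mulmxA q) !(tang_qaq qq) //.
by rewrite !mulmx0 addr0 add0r -scalemxAl qq.
Qed.

(** The hypothesis on b' is the derivative of q b + b q = b along a. *)
Lemma sffP a b b' : tang q a -> tang q b ->
  a *m b + q *m b' + b' *m q + b *m a = b' -> tang q (b' - sff a b).
Proof.
have [qq trq q1] := q_idem.
move=> ta tb eb; rewrite /tang mulmxBr mulmxBl q_sff // sff_q // -{3}eb.
rewrite (tang_mul q_idem ta tb) (tang_mul q_idem tb ta) /sff /pairing; mxring.
Qed.

Lemma tang_mulq a b : tang q a -> tang q b -> a *m b *m q = pairing a b *: q.
Proof.
have [qq _ _] := q_idem => ta tb.
rewrite (tang_mul q_idem ta tb) mulmxDl -scalemxAl qq -!mulmxA (mulmxA q b).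
by rewrite (tang_qaq qq tb) mulmx0 addr0 /pairing mulmxA.
Qed.

Lemma q_tang_mul a b : tang q a -> tang q b -> q *m a *m b = pairing a b *: q.
Proof.
have [qq _ _] := q_idem => ta tb.
rewrite -mulmxA (tang_mul q_idem ta tb) mulmxDr -scalemxAr qq !mulmxA.
by rewrite (tang_qaq qq ta) mul0mx addr0.
Qed.

Lemma tr_aqb_idag a b c : tang q a -> tang q b -> tang q c ->
  \tr (a *m q *m b *m idag c) = z * (pairing c a * up b - pairing b c * dn a).
Proof.
have [qq _ _] := q_idem => ta tb tc.
rewrite /idag /comm mulmxDr -!scalemxAr mxtraceD !mxtraceZ !mulmxBr !trB !mulmxA.
rewrite -(mulmxA (a *m q) b q) -(mulmxA a q (b *m q)) (mulmxA q b q) (tang_qaq qq tb).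
rewrite mulmx0 mul0mx mxtrace0.
have -> : \tr (a *m q *m b *m p *m q) = 0.
  by rewrite mxtrace_mulC !mulmxA (tang_qaq qq ta) !mul0mx mxtrace0.
have -> : \tr (a *m q *m b *m p *m c) = pairing c a * up b.
  rewrite -(mulmxA _ p c) mxtrace_mulC !mulmxA -(mulmxA p c) -(mulmxA p _ q).
  by rewrite tang_mulq // -scalemxAr -scalemxAl mxtraceZ.
have -> : \tr (a *m q *m b *m c *m p) = pairing b c * dn a.
  rewrite -(mulmxA a q b) -(mulmxA a _ c) q_tang_mul // -scalemxAr -scalemxAl.
  rewrite mxtraceZ.
  by rewrite -tr_rot3.
by rewrite subrr mulr0 addr0.
Qed.

Lemma sff_herm a b c : tang q a -> tang q b -> tang q c ->
  herm (sff a b) (idag c) =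
  z ^+ 2 * (pairing c a * up b - pairing b c * dn a + pairing c b * up a - pairing a c * dn b)
  - z ^+ 2 * (pairing a b + pairing b a) * (dn c - up c)
  - z ^+ 4 * half * (dn c - up c)
     * (z ^+ 2 * (dn a * up b + dn b * up a) - (pairing a b + pairing b a) * \tr (p *m q)).
Proof.
have [qq _ _] := q_idem => ta tb tc.
have := tr_aqb_idag ta tb tc; have := tr_aqb_idag tb ta tc; have := tr_q_idag c.
rewrite /herm /sff; move: (idag c) => w qw bw aw.
rewrite mulmxBl mulmxDl mulmxBr mulmxDr !trB !mxtraceD aw bw.
rewrite -scalemxAl -scalemxAr !mxtraceZ qw !(mulmxA p) !tr_paqb.
ring.
Qed.

(** Totally symmetric in a, b, c. *)
Definition cubic a b c :=
  z ^+ 2 * (half * ((pairing c a + pairing a c) * (up b - dn b)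
                + (pairing c b + pairing b c) * (up a - dn a)
                + (pairing a b + pairing b a) * (up c - dn c))
            - z ^+ 4 * half ^+ 2 * ((up a - dn a) * (up b - dn b) * (up c - dn c))).

Lemma cubicC a b c : cubic a b c = cubic a c b.
Proof. rewrite /cubic; ring. Qed.

(** The left side is h(nabla_a b, I c) by the Koszul formula. The two terms on
    the right come from the splitting of b' into a tangent vector, to which
    [herm_idag] applies, and the second fundamental form. *)
Lemma second_derivative_idag a b b' c : tang q a -> tang q b -> tang q c ->
  a *m b + q *m b' + b' *m q + b *m a = b' ->
  herm b' (idag c) + kap a b (idag c) = \tr (q *m comm c b') + cubic a b c.
Proof.
have [qq _ _] := q_idem => ta tb tc eb.
have te := sffP ta tb eb.
have hD x y w : herm (x + y) w = herm x w + herm y w.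
  by rewrite /herm mulmxDl mulmxDr !mxtraceD; ring.
set e := b' - sff a b in te; have -> : b' = e + sff a b by rewrite subrK.
have -> : \tr (q *m comm c (e + sff a b)) = \tr (q *m comm c e).
  have -> : comm c (e + sff a b) = comm c e + comm c (sff a b).
    by rewrite /comm mulmxDr mulmxDl; mxring.
  rewrite mulmxDr mxtraceD [X in _ + X](_ : _ = 0) ?addr0 // /comm mulmxBr trB.
  rewrite !mulmxA tr_rot3 -mulmxA sff_q // q_sff // mulmxN mulNmx -scalemxAr -scalemxAl.
  by rewrite !raddfN /= !mxtraceZ [\tr (c *m q)]mxtrace_mulC subrr.
rewrite hD herm_idag // sff_herm // /kap.
have := tr_a_idag ta tc; have := tr_a_idag tb tc; have := tr_q_idag c.
move: (idag c) => w -> -> ->; rewrite (trp_tang ta) (trp_tang tb).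
rewrite /cubic.
have ztq := zt; set t := \tr (p *m q) in ztq *.
move: (pairing a b) (pairing b a) (pairing a c) (pairing c a) (pairing b c) (pairing c b) (\tr (q *m _)).
move: (up a) (dn a) (up b) (dn b) (up c) (dn c).
move=> ua da ub db uc dc ab ba ac ca bc cb x.
apply/eqP; rewrite -subr_eq0; apply/eqP.
(* The difference of the two sides lies in the ideal of the relations
   z^2 t = 1 and 2 half = 1; the cofactors are explicit. *)
transitivity ((z ^+ 2 * t - 1) * (z ^+ 2 * half * ((dc - uc) * (ab + ba)
     - (ua + da) * (cb - bc) - (ub + db) * (ca - ac)))
  + (half + half - 1) * (- z ^+ 2 * (ca * ub - bc * da + cb * ua - ac * db - (ab + ba) * (dc - uc))
     + z ^+ 6 * half * (dc - uc) * (da * ub + db * ua))); first by ring.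
by rewrite ztq half2 !subrr !mul0r addr0.
Qed.

(** The identity I (I a) = - a, with I a entering through its adjoint. *)
Lemma idag_comm a : tang q a ->
  z *: comm (idag a) q + (z ^+ 3 * half * \tr (idag a *m q)) *: comm q p = - a.
Proof.
have [qq _ q1] := q_idem; have [_ _ p1] := p_idem => ta.
rewrite [\tr (idag a *m q)]mxtrace_mulC tr_q_idag.
have pqt : q *m p *m q = \tr (p *m q) *: q by rewrite q1 mxtrace_mulC.
have ztq := zt; set t := \tr (p *m q) in ztq pqt.
have E1 : p *m a *m q = (z ^+ 2 * dn a) *: (p *m q).
  rewrite -scalerA scalemxAl.
  have -> : dn a *: p = p *m a *m q *m p by rewrite -(mulmxA p a q) p1 mulmxA.
  rewrite -(mulmxA _ p q) -(mulmxA _ q (p *m q)) (mulmxA q p) pqt.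
  by rewrite -scalemxAr scalerA ztq scale1r.
have E2 : q *m a *m p = (z ^+ 2 * up a) *: (q *m p).
  rewrite -scalerA scalemxAr.
  have -> : up a *: p = p *m q *m a *m p by rewrite -(mulmxA p q a) p1 mulmxA.
  rewrite !mulmxA pqt -!scalemxAl scalerA ztq scale1r.
  by [].
have E3 : a *m p *m q = up a *: q + t *: (a *m q).
  rewrite -{1}ta !mulmxDl -(mulmxA q a p) q1 -2!(mulmxA a) pqt -scalemxAr.
  by rewrite /up mulmxA -tr_rot3.
have E4 : q *m p *m a = dn a *: q + t *: (q *m a).
  rewrite -{1}ta !mulmxDr !mulmxA pqt -scalemxAl addrC; congr (_ + _).
  by rewrite -(mulmxA q p a) q1 mulmxA tr_rot3.
have ea : - a = - (q *m a + a *m q) by rewrite ta.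
rewrite /idag (trp_tang ta) [RHS]ea.
have -> : comm (z *: comm p a + (z ^+ 3 * half * (up a + dn a)) *: comm q p) q =
   z *: (p *m a *m q - a *m p *m q - q *m p *m a + q *m a *m p)
   + (z ^+ 3 * half * (up a + dn a)) *: (q *m p *m q - p *m q - q *m p + q *m p *m q).
  by rewrite /comm; mxexpand; rewrite -(mulmxA p q q) qq; mxring.
rewrite E1 E2 E3 E4 pqt /comm; move: (up a) (dn a) => u d.
apply/matrixP => i j; rewrite ?(add_mxE, opp_mxE, scale_mxE).
move: ((p *m q) i j) ((q *m p) i j) ((a *m q) i j) ((q *m a) i j) (q i j).
move=> PQ QP Y X Q; apply/eqP; rewrite -subr_eq0 opprK; apply/eqP.
transitivity ((z ^+ 2 * t - 1) * (half * z ^+ 2 * (u + d) * Q *+ 2 - (X + Y))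
  + (half + half - 1) * (z ^+ 2 * (u + d) * Q - z ^+ 4 * d * PQ - z ^+ 4 * u * QP)).
  by ring.
by rewrite ztq half2 !subrr !mul0r addr0.
Qed.

(** Testing against the commutators [m, q] gives Tr(m a) = 0 for every m. *)
Lemma kks_nondegenerate a : tang q a ->
  (forall b, tang q b -> \tr (q *m comm b a) = 0) -> a = 0.
Proof.
have [qq _ _] := q_idem => ta h.
have am m : \tr (m *m a) = 0.
  have := h _ (tang_comm m qq); rewrite /comm; mxexpand; rewrite qq !trB.
  have -> : \tr (q *m m *m q *m a) = 0.
    rewrite -!mulmxA mxtrace_mulC -!mulmxA (mulmxA q a) (tang_qaq qq ta).
    by rewrite mulmx0 mxtrace0.
  have -> : \tr (q *m a *m q *m m) = 0 by rewrite (tang_qaq qq ta) mul0mx mxtrace0.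
  have -> : \tr (q *m a *m m *m q) = \tr (m *m (q *m a)).
    by rewrite mxtrace_mulC !mulmxA qq tr_rot3 tr_rot3.
  have -> : \tr (q *m m *m a) = \tr (m *m (a *m q)) by rewrite tr_rot3 mulmxA.
  rewrite sub0r subr0 -opprD addrC -mxtraceD -mulmxDr ta => /eqP.
  by rewrite oppr_eq0 => /eqP.
apply/matrixP => i j; rewrite mxE -(am (delta_mx j i)).
rewrite /mxtrace (bigD1 j) //= big1 => [|k kj].
  rewrite mxE (bigD1 i) //= mxE !eqxx mul1r big1 ?addr0 // => l li.
  by rewrite mxE eqxx (negPf li) mul0r.
by rewrite mxE big1 // => l _; rewrite mxE (negPf kj) mul0r.
Qed.

(** A product of three tangent vectors is off-diagonal. *)
Lemma tr_tang3 a b c : tang q a -> tang q b -> tang q c ->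
  \tr (a *m comm b c) = 0.
Proof.
have [qq _ _] := q_idem.
have T0 x : tang q x -> \tr (q *m x) = 0.
  by move=> tx; rewrite -{1}qq -mulmxA mxtrace_mulC (tang_qaq qq tx) mxtrace0.
have T x y w : tang q x -> tang q y -> tang q w -> \tr (x *m (y *m w)) = 0.
  move=> tx ty tw; rewrite (tang_mul q_idem ty tw) mulmxDr mxtraceD -scalemxAr.
  rewrite mxtraceZ [\tr (x *m q)]mxtrace_mulC !mulmxA tang_mulq //.
  by rewrite -scalemxAl mxtraceZ !T0 // !mulr0 addr0.
by move=> ta tb tc; rewrite /comm mulmxBr trB !T // subrr.
Qed.

End Core.

(** * Idempotents of trace one over a field *)

Section Factor.
Variable F : fieldType.

(** An idempotent is C D with D C the identity of size its rank. *)
Lemma idem_factor n (q : 'M[F]_n) : q *m q = q ->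
  exists r (C : 'M[F]_(n, r)) (D : 'M[F]_(r, n)), C *m D = q /\ D *m C = 1%:M.
Proof.
move=> qq; exists (\rank q), (col_base q), (row_base q).
split; first exact: mulmx_base.
have CD : (col_base q *m row_base q) *m (col_base q *m row_base q)
  = col_base q *m row_base q by rewrite mulmx_base.
have C1 := mulVpmx (col_base_full q); have D1 := mulmxVp (row_base_free q).
move: (col_base q) (row_base q) (pinvmx (col_base q)) (pinvmx (row_base q)) C1 D1 CD.
move=> C D C' D' C1 D1 /(congr1 (fun m => C' *m m *m D')).
by rewrite !mulmxA !C1 !mul1mx -!mulmxA !D1 mulmx1.
Qed.

End Factor.

Section FactorNum.
Variable F : numFieldType.

(** In characteristic 0 the rank of an idempotent is its trace, so the inner
    matrix D m C of q m q is a scalar. *)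
Lemma idem_tr1_rank_one n (q : 'M[F]_n) : q *m q = q -> \tr q = 1 ->
  rank_one_idem q.
Proof.
move=> qq trq; split=> // m; have [r [C [D [CD DC]]]] := idem_factor qq.
move: trq; rewrite -CD mxtrace_mulC DC mxtrace1 => /eqP.
rewrite -[1]/(1%:R) eqr_nat => /eqP r1; subst r.
have -> : C *m D *m m *m (C *m D) = C *m (D *m m *m C) *m D by rewrite !mulmxA.
have -> : \tr (C *m D *m m) = \tr (D *m m *m C) by rewrite -mulmxA mxtrace_mulC.
rewrite [D *m m *m C]mx11_scalar mxtrace_scalar mulr1n.
by rewrite mul_mx_scalar -scalemxAl.
Qed.

(** Factor q_i = u_i v_i and 1 - q_i = C_i D_i; then u_1 v_0 + C_1 D_0
    intertwines. *)
Lemma idem_tr1_conj n (q0 q1 : 'M[F]_n) :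
  q0 *m q0 = q0 -> q1 *m q1 = q1 -> \tr q0 = 1 -> \tr q1 = 1 ->
  exists g g' : 'M[F]_n, [/\ g *m g' = 1%:M, g' *m g = 1%:M & g *m q0 = q1 *m g].
Proof.
have compl (q : 'M[F]_n) : q *m q = q -> (1%:M - q) *m (1%:M - q) = 1%:M - q.
  by move=> qq; rewrite mulmxBr mulmx1 mulmxBl mul1mx qq subrr subr0.
have factor1 (q : 'M[F]_n) : q *m q = q -> \tr q = 1 ->
    exists (u : 'M[F]_(n, 1)) (v : 'M[F]_(1, n)) (C : 'M[F]_(n, n.-1)) (D : 'M[F]_(n.-1, n)),
    [/\ u *m v = q, v *m u = 1%:M, C *m D = 1%:M - q, D *m C = 1%:M &
        v *m C = 0 /\ D *m u = 0].
  move=> qq trq; have [r [u [v [uv vu]]]] := idem_factor qq.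
  have [s [C [D [CD DC]]]] := idem_factor (compl _ qq).
  have r1 : r = 1%N.
    move: trq; rewrite -uv mxtrace_mulC vu mxtrace1 => /eqP.
    by rewrite -[1]/(1%:R) eqr_nat => /eqP.
  have sn : s = n.-1.
    have := congr1 mxtrace CD; rewrite mxtrace_mulC DC mxtrace1 trB trq mxtrace1 => h.
    (* The trace of 1 - q gives the size of the second factorization. *)
  have /eqP : s%:R + 1%:R = n%:R :> F by rewrite h subrK.
    by rewrite -natrD eqr_nat addn1 => /eqP <-.
  subst r s; exists u, v, C, D; split=> //; split.
    have -> : v = v *m q by rewrite -uv mulmxA vu mul1mx.
    have -> : C = (1%:M - q) *m C by rewrite -CD -mulmxA DC mulmx1.
    by rewrite -mulmxA (mulmxA q) mulmxBr qq mulmx1 subrr mul0mx mulmx0.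
  have -> : u = q *m u by rewrite -uv -mulmxA vu mulmx1.
  have -> : D = D *m (1%:M - q) by rewrite -CD mulmxA DC mul1mx.
  by rewrite -mulmxA (mulmxA _ q) mulmxBl qq mul1mx subrr mul0mx mulmx0.
move=> q0q q1q t0 t1.
have [u [v [C [D [uv vu CD DC [vC Du]]]]]] := factor1 _ q0q t0.
have [x [y [G [H [xy yx GH HG [yG Hx]]]]]] := factor1 _ q1q t1.
exists (x *m v + G *m D), (u *m y + C *m H); split.
- rewrite mulmxDl !mulmxDr -!mulmxA !(mulmxA v) !(mulmxA D) vu vC Du DC.
  by rewrite !mul0mx !mulmx0 !mul1mx addr0 add0r xy GH addrC subrK.
- rewrite mulmxDl !mulmxDr -!mulmxA !(mulmxA y) !(mulmxA H) yx yG Hx HG.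
  by rewrite !mul0mx !mulmx0 !mul1mx addr0 add0r uv CD addrC subrK.
- rewrite -uv -xy mulmxDl mulmxDr -!mulmxA (mulmxA v u) vu (mulmxA D u) Du.
  by rewrite (mulmxA y x) yx (mulmxA y G) yG !mul0mx !mulmx0 !mul1mx !addr0.
Qed.

End FactorNum.

(** * Complex structure and connection on the tangent space at an idempotent *)

Section Hermitian.
Variables (B : comNzRingType) (star : {rmorphism B -> B}) (n : nat).
Hypothesis starK : involutive star.
Implicit Types a b c d q m : 'M[B]_n.

(** [dagger] for an arbitrary commutative ring with involution. *)
Definition dag a : 'M[B]_n := map_mx star a^T.

Lemma dagD a b : dag (a + b) = dag a + dag b.
Proof. by rewrite /dag linearD map_mxD. Qed.

Lemma dagN a : dag (- a) = - dag a.
Proof. by rewrite /dag linearN map_mxN. Qed.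

Lemma dagB a b : dag (a - b) = dag a - dag b.
Proof. by rewrite dagD dagN. Qed.

Lemma dagM a b : dag (a *m b) = dag b *m dag a.
Proof. by rewrite /dag trmx_mul map_mxM. Qed.

Lemma dagZ x a : dag (x *: a) = star x *: dag a.
Proof. by rewrite /dag linearZ map_mxZ. Qed.

Lemma dagK : involutive dag.
Proof. by move=> a; apply/matrixP => i j; rewrite !mxE starK. Qed.

Lemma tr_dag a : \tr (dag a) = star (\tr a).
Proof. by rewrite /dag trace_map_mx mxtrace_tr. Qed.

Lemma dag_comm a b : dag (comm a b) = comm (dag b) (dag a).
Proof. by rewrite /comm dagB !dagM. Qed.

Lemma rank_one_dag q : rank_one_idem q -> rank_one_idem (dag q).
Proof.
move=> [qq trq q1]; split; first by rewrite -dagM qq.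
  by rewrite tr_dag trq rmorph1.
move=> m; have /(congr1 dag) := q1 (dag m).
by rewrite !dagM dagZ -tr_dag dagM dagK mulmxA [in RHS]mxtrace_mulC.
Qed.

Section Forms.
Variables (half z : B) (q : 'M[B]_n).
Hypotheses (half2 : half + half = 1) (star_half : star half = half) (star_z : star z = z).

Definition hform a b := herm half z q (dag q) a (dag b).
Definition kappa a b c := kap half z q (dag q) a b (dag c).
(** The endomorphism I, with z and the constant 1/2 as parameters. *)
Definition Jend a := z *: comm (dag a) q + (z ^+ 3 * half * \tr (dag a *m q)) *: comm q (dag q).

Lemma star_z3 : star (z ^+ 3 * half) = z ^+ 3 * half.
Proof. by rewrite rmorphM rmorphXn /= star_z star_half. Qed.

Lemma dag_J a : dag (Jend a) = idag half z q (dag q) a.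
Proof.
rewrite /Jend dagD !dagZ !dag_comm !dagK rmorphM star_z3.
by rewrite /= star_z -tr_dag dagM dagK.
Qed.

Lemma h_star a b : star (hform a b) = hform b a.
Proof.
rewrite /hform /herm rmorphB /= (rmorphM star z) (rmorphM star (_ * half * _)).
rewrite (rmorphM star (_ * half)) star_z3 star_z.
rewrite -!tr_dag !dagM !dagK mulrAC.
by rewrite [\tr (b *m dag q)]mxtrace_mulC [\tr (dag a *m q)]mxtrace_mulC.
Qed.

Lemma hDl a b c : hform (a + b) c = hform a c + hform b c.
Proof. by rewrite /hform /herm mulmxDl mulmxDr !mxtraceD; ring. Qed.

Lemma hZl x a b : hform (x *: a) b = x * hform a b.
Proof. by rewrite /hform /herm -scalemxAl -scalemxAr !mxtraceZ; ring. Qed.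

Lemma hDr a b c : hform a (b + c) = hform a b + hform a c.
Proof. by rewrite /hform /herm dagD !mulmxDr !mxtraceD; ring. Qed.

Lemma hZr x a b : hform a (x *: b) = star x * hform a b.
Proof. by rewrite /hform /herm dagZ -!scalemxAr !mxtraceZ; ring. Qed.

Lemma hNl a b : hform (- a) b = - hform a b.
Proof. by rewrite -scaleN1r hZl mulN1r. Qed.

Lemma hNr a b : hform a (- b) = - hform a b.
Proof. by rewrite -scaleN1r hZr rmorphN rmorph1 mulN1r. Qed.

Lemma kappaZr x a b c : kappa a b (x *: c) = star x * kappa a b c.
Proof. by rewrite /kappa /kap dagZ -!scalemxAr !mxtraceZ; ring. Qed.

Lemma kappaDr a b c d : kappa a b (c + d) = kappa a b c + kappa a b d.
Proof. by rewrite /kappa /kap dagD !mulmxDr !mxtraceD; ring. Qed.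

Lemma kappaZm x a b c : kappa a (x *: b) c = x * kappa a b c.
Proof. by rewrite /kappa /kap -!scalemxAl -!scalemxAr !mxtraceZ; ring. Qed.

Lemma kappaDm a b c d : kappa a (b + c) d = kappa a b d + kappa a c d.
Proof. by rewrite /kappa /kap !mulmxDl !mulmxDr !mxtraceD; ring. Qed.

Lemma kappaC a b c : kappa a b c = kappa b a c.
Proof. by rewrite /kappa /kap; ring. Qed.

Lemma kappaZl x a b c : kappa (x *: a) b c = x * kappa a b c.
Proof. by rewrite kappaC kappaZm kappaC. Qed.

Lemma kappaDl a b c d : kappa (a + b) c d = kappa a c d + kappa b c d.
Proof. by rewrite kappaC kappaDm !(kappaC c). Qed.

Lemma J_D a b : Jend (a + b) = Jend a + Jend b.
Proof.
rewrite /Jend /comm dagD mulmxDl mulmxDr mxtraceD; mxring.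
Qed.

(** I anticommutes with the multiplications by elements that the involution
    sends to their opposite. *)
Lemma J_Z x a : Jend (x *: a) = star x *: Jend a.
Proof.
rewrite /Jend /comm dagZ -!scalemxAl -!scalemxAr mxtraceZ; mxring.
Qed.

Section OnM.
Hypotheses (q_idem : rank_one_idem q) (zt : z ^+ 2 * \tr (dag q *m q) = 1).

Let qd_idem : rank_one_idem (dag q).
Proof. exact: rank_one_dag. Qed.

Lemma J_tang a : tang q (Jend a).
Proof.
have [qq _ _] := q_idem; rewrite /Jend.
by apply: tangD; apply: tangZ; [exact: tang_comm|exact: tang_comm_r].
Qed.

Lemma J_sqr a : tang q a -> Jend (Jend a) = - a.
Proof.
move=> ta; rewrite /Jend dag_J.
exact: (idag_comm half2 q_idem qd_idem zt ta).
Qed.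

Lemma h_J b c : tang q b -> tang q c -> hform c (Jend b) = \tr (q *m comm b c).
Proof.
by move=> tb tc; rewrite /hform dag_J; exact: (herm_idag half2 q_idem qd_idem zt).
Qed.

Lemma tr_commC a b : \tr (q *m comm a b) = - \tr (q *m comm b a).
Proof. by rewrite /comm -(opprB (b *m a)) mulmxN raddfN. Qed.

(** Since I is onto, this is the nondegeneracy of the Kirillov-Kostant form. *)
Lemma h_nondegenerate a : tang q a -> (forall c, tang q c -> hform a c = 0) -> a = 0.
Proof.
move=> ta h; apply: (kks_nondegenerate q_idem ta) => b tb.
by rewrite -h_J //; apply: h; exact: J_tang.
Qed.

(** The operator x + y I. Because of [J_Z] these operators form a quaternion
    algebra, see [act_mul]. *)
Definition act x y a := x *: a + y *: Jend a.

Lemma act_tang x y a : tang q a -> tang q (act x y a).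
Proof. by move=> ta; apply: tangD; apply: tangZ => //; exact: J_tang. Qed.

Lemma act_mul x y x' y' a : tang q a ->
  act x y (act x' y' a) = act (x * x' - y * star y') (x * y' + y * star x') a.
Proof. by move=> ta; rewrite /act J_D !J_Z J_sqr //; mxring. Qed.

Lemma act_linear x y r a b : star r = r -> act x y (r *: a + b) = r *: act x y a + act x y b.
Proof. by move=> sr; rewrite /act J_D J_Z sr; mxring. Qed.

(** For x with x^* = - x the operator x + y I is skew for the real part of h:
    multiplication by x is skew because h is Hermitian, and y I is skew because
    h(b, I a) is alternating. *)
Lemma act_skew (V : zmodType) (re : {additive B -> V}) x y a b :
  (forall t, re (star t) = re t) -> star x = - x -> tang q a -> tang q b ->
  re (hform (act x y a) b) = - re (hform a (act x y b)).
Proof.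
move=> re_star sx ta tb; rewrite /act hDl hDr !hZl !hZr -(h_star b (Jend a)) h_J // h_J //.
rewrite [\tr (q *m comm b a)]tr_commC sx; move: (\tr _) => t.
rewrite !raddfD /= -[re (y * star t)]re_star rmorphM /= starK.
by rewrite mulrN mulNr !raddfN /= !opprK.
Qed.

(** The Koszul formula for e = nabla_X Y, where a and b are the values of X and
    Y, and d is the derivative of Y along X in the ambient space. *)
Definition levi_civita_vec a b d e :=
  forall c, tang q c -> hform e c = hform d c + kappa a b c.

Definition lc_defect a b d e c := hform e c - (hform d c + kappa a b c).

Lemma lc_defectZ a b d e x c : lc_defect a b d e (x *: c) = star x * lc_defect a b d e c.
Proof. by rewrite /lc_defect !hZr kappaZr; ring. Qed.

Lemma lc_defectD a b d e c c' :
  lc_defect a b d e (c + c') = lc_defect a b d e c + lc_defect a b d e c'.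
Proof. by rewrite /lc_defect !hDr kappaDr; ring. Qed.

(** Here d, c', dJ are the derivatives along a of the fields b, c and I b. The
    first two equations are the derivatives of the tangent condition and the
    third one is the derivative of h(c, I b) = Tr(q [b, c]). *)
Lemma levi_civita_J a b c d e dJ c' : tang q a -> tang q b -> tang q c -> tang q e ->
  a *m b + q *m d + d *m q + b *m a = d ->
  a *m c + q *m c' + c' *m q + c *m a = c' ->
  hform c' (Jend b) + hform c dJ + kappa a c (Jend b) + star (kappa a (Jend b) c)
    = \tr (a *m comm b c + q *m (comm d c + comm b c')) ->
  levi_civita_vec a b d e ->
  hform (Jend e) c = hform dJ c + kappa a (Jend b) c.
Proof.
move=> ta tb tc te eb ec E LC; apply: (can_inj starK); rewrite h_star h_J //.
rewrite rmorphD /= h_star.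
have F x x' y : tang q x -> tang q y -> a *m x + q *m x' + x' *m q + x *m a = x' ->
    hform x' (Jend y) + kappa a x (Jend y)
    = \tr (q *m comm y x') + cubic half z q (dag q) a x y.
  move=> tx ty ex; rewrite /hform /kappa dag_J.
  exact: (second_derivative_idag half2 q_idem qd_idem zt ta tx ty ex).
have Fb := F _ _ _ tb tc eb; have Fc := F _ _ _ tc tb ec.
have Le := LC _ (J_tang c); rewrite h_J // Fb in Le.
rewrite mxtraceD (tr_tang3 q_idem ta tb tc) add0r mulmxDr mxtraceD in E.
rewrite tr_commC Le [\tr (q *m comm c d)]tr_commC opprD opprK cubicC.
apply: (addrI (\tr (q *m comm b c') + cubic half z q (dag q) a c b)).
rewrite -[in RHS]Fc; move: E; clear.
move: (hform c' _) (hform c dJ) (kappa a c _) (star _) (\tr _) (\tr _) (cubic _ _ _ _ _ _ _).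
move=> h1 h2 k s t1 t2 u E; have -> : t2 = h1 + h2 + k + s - t1 by rewrite E; ring.
by ring.
Qed.

Lemma levi_civita_act x y a b c d e dJ :
  hform e c = hform d c + kappa a b c ->
  hform (Jend e) c = hform dJ c + kappa a (Jend b) c ->
  hform (act x y e) c = hform (x *: d + y *: dJ) c + kappa a (act x y b) c.
Proof.
move=> e1; rewrite /act; move: (Jend b) (Jend e) => Jb Je e2.
by rewrite !hDl !hZl e1 e2 kappaDm !kappaZm; ring.
Qed.

Lemma levi_civita_uniq a b d e e' : tang q e -> tang q e' ->
  levi_civita_vec a b d e -> levi_civita_vec a b d e' -> e = e'.
Proof.
move=> te te' h h'; apply/eqP; rewrite -subr_eq0; apply/eqP; apply: h_nondegenerate.
  by rewrite -scaleN1r; apply: tangD => //; exact: tangZ.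
by move=> c tc; rewrite hDl hNl h // h' // subrr.
Qed.

End OnM.

Section Derivative.

(** Written without kappa on the right, in the shape in which the terms occur
    when h is differentiated. *)
Lemma star_kappa a b c : star (kappa a b c) =
  - (z ^+ 3 * half * (\tr (dag a *m q) * \tr (c *m dag b) + \tr (dag b *m q) * \tr (c *m dag a)))
  + 3%:R * half ^+ 2 * z ^+ 5 * \tr (dag a *m q) * \tr (dag b *m q) * \tr (c *m dag q).
Proof.
rewrite /kappa /kap !(rmorphXn, rmorphD, rmorphN, rmorph_nat, rmorphM) /=.
by rewrite star_z star_half -!tr_dag !dagM !dagK.
Qed.

(** The left side is what the product rule gives for h(a, b), with q' and z' the
    derivatives of q and z; the hypothesis is the derivative of
    z^2 Tr(q^dagger q) = 1, solved for z'. *)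
Lemma hform_derivative a b a' b' q' z' :
  z' = - (z ^+ 3 * half * \tr (dag q' *m q + dag q *m q')) ->
  z' * \tr (a *m dag b) + z * \tr (a' *m dag b + a *m dag b')
  - ((((z' * (z * z) + z * (z' * z + z * z')) * half + z ^+ 3 * 0) * \tr (dag q *m a)
       + z ^+ 3 * half * \tr (dag q' *m a + dag q *m a')) * \tr (q *m dag b)
     + z ^+ 3 * half * \tr (dag q *m a) * \tr (q' *m dag b + q *m dag b'))
  = hform a' b + hform a b' + kappa q' a b + star (kappa q' b a).
Proof.
move=> ->; rewrite star_kappa /hform /herm /kappa /kap !mxtraceD.
rewrite [\tr (dag b *m q)]mxtrace_mulC [\tr (a *m dag q)]mxtrace_mulC.
rewrite [\tr (a *m dag q')]mxtrace_mulC; ring.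
Qed.

End Derivative.
End Forms.
End Hermitian.

(** * The graph of a rank-one idempotent *)

Section Graph.
Variables (B : comNzRingType) (n : nat) (q0 : 'M[B]_n).
Hypothesis q0_idem : rank_one_idem q0.
Implicit Types (a q : 'M[B]_n) (x y : B).

(** For a tangent at q0, its image is the graph of a over the image of q0 and
    its kernel is the graph of - a over the kernel of q0; hence it is idempotent
    up to a scalar, which is [graph_den]. *)
Definition graph_num a := (1%:M + a) *m q0 *m (1%:M + a).
Definition graph_den a := 1 + \tr (q0 *m a *m a).

Lemma q0_graph_mid a : tang q0 a ->
  q0 *m (1%:M + a) *m (1%:M + a) *m q0 = graph_den a *: q0.
Proof.
have [qq trq q1] := q0_idem => ta; rewrite /graph_den scalerDl scale1r.
have -> : q0 *m (1%:M + a) *m (1%:M + a) *m q0 =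
    q0 *m q0 + q0 *m a *m q0 + q0 *m a *m q0 + q0 *m (a *m a) *m q0.
  by mxexpand; rewrite !mulmx1; mxring.
by rewrite (tang_qaq qq ta) q1 qq !addr0 mulmxA.
Qed.

Lemma q0_graph_num a : tang q0 a -> q0 *m graph_num a = q0 + q0 *m a.
Proof.
have [qq trq q1] := q0_idem => ta; rewrite /graph_num; mxexpand.
by rewrite !mulmx1 (tang_qaq qq ta) qq mul0mx !addr0.
Qed.

Lemma graph_num_q0 a : tang q0 a -> graph_num a *m q0 = q0 + a *m q0.
Proof.
have [qq trq q1] := q0_idem => ta.
have -> : graph_num a *m q0 = q0 *m q0 + a *m (q0 *m q0)
    + q0 *m a *m q0 + a *m (q0 *m a *m q0).
  by rewrite /graph_num; mxexpand; rewrite !mul1mx !mulmx1; mxring.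
by rewrite (tang_qaq qq ta) qq mulmx0 !addr0.
Qed.

Lemma tr_q0_tang a : tang q0 a -> \tr (q0 *m a) = 0.
Proof.
have [qq _ _] := q0_idem => ta.
by rewrite -{1}qq -mulmxA mxtrace_mulC (tang_qaq qq ta) mxtrace0.
Qed.

Lemma graph_num_sqr a : tang q0 a ->
  graph_num a *m graph_num a = graph_den a *: graph_num a.
Proof.
move=> ta; transitivity ((1%:M + a) *m (q0 *m (1%:M + a) *m (1%:M + a) *m q0) *m (1%:M + a)).
  by rewrite /graph_num !mulmxA.
by rewrite q0_graph_mid // -scalemxAr -scalemxAl.
Qed.

Lemma tr_graph_num a : tang q0 a -> \tr (graph_num a) = graph_den a.
Proof.
have [qq trq q1] := q0_idem => ta; rewrite /graph_num -mulmxA mxtrace_mulC.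
have := congr1 mxtrace (q0_graph_mid ta); rewrite mxtraceZ trq mulr1 => <-.
by rewrite [RHS]mxtrace_mulC !mulmxA qq.
Qed.

Lemma tr_q0_graph_num a : tang q0 a -> \tr (q0 *m graph_num a) = 1.
Proof.
have [_ trq _] := q0_idem => ta.
by rewrite q0_graph_num // mxtraceD trq tr_q0_tang // addr0.
Qed.

(** Recovers a from the graph up to the scalar Tr(q0 q). *)
Lemma graph_numK a : tang q0 a ->
  q0 *m graph_num a + graph_num a *m q0 = q0 + q0 + a.
Proof.
by move=> ta; rewrite q0_graph_num // graph_num_q0 // addrACA ta.
Qed.

Section Inverse.
Variables (q : 'M[B]_n) (w : B).
Hypotheses (q_idem : rank_one_idem q) (yw : \tr (q0 *m q) * w = 1).

(** Here w stands for the inverse of Tr(q0 q). *)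
Definition graph_inv := w *: (q0 *m q + q *m q0) - (q0 + q0).

Let q0qq0 : q0 *m q *m q0 = \tr (q0 *m q) *: q0.
Proof. by have [_ _ ->] := q0_idem. Qed.

Let q0_inv : q0 *m graph_inv = w *: (q0 *m q) - q0.
Proof.
have [qq _ _] := q0_idem; rewrite /graph_inv; mxexpand; rewrite qq q0qq0 scalerA.
by rewrite [w * _]mulrC yw scale1r opprD addrA addrK.
Qed.

Let inv_q0 : graph_inv *m q0 = w *: (q *m q0) - q0.
Proof.
have [qq _ _] := q0_idem; rewrite /graph_inv; mxexpand.
rewrite -(mulmxA q) qq q0qq0 scalerA [w * _]mulrC yw scale1r.
by mxring.
Qed.

Let q0_1inv : q0 *m (1%:M + graph_inv) = w *: (q0 *m q).
Proof. by rewrite mulmxDr mulmx1 q0_inv addrC subrK. Qed.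

Let inv1_q0 : (1%:M + graph_inv) *m q0 = w *: (q *m q0).
Proof. by rewrite mulmxDl mul1mx inv_q0 addrC subrK. Qed.

Lemma graph_inv_tang : tang q0 graph_inv.
Proof. by rewrite /tang q0_inv inv_q0 /graph_inv; mxring. Qed.

Lemma graph_inv_den : graph_den graph_inv = w.
Proof.
have [qq trq _] := q0_idem; have [qq' _ _] := q_idem.
have := congr1 mxtrace (q0_graph_mid graph_inv_tang); rewrite mxtraceZ trq mulr1 => <-.
rewrite -(mulmxA _ (1%:M + _)) q0_1inv inv1_q0.
rewrite -scalemxAl -scalemxAr mulmxA -(mulmxA q0 q q) qq' q0qq0.
by rewrite !mxtraceZ trq mulr1 mulrA [w * w]mulrC -mulrA [w * \tr _]mulrC yw mulr1.
Qed.

Lemma graph_inv_num : graph_num graph_inv = w *: q.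
Proof.
have [qq trq _] := q0_idem; have [_ _ qm] := q_idem.
transitivity (((1%:M + graph_inv) *m q0) *m (q0 *m (1%:M + graph_inv))).
  by rewrite mulmxA -(mulmxA _ q0 q0) qq.
rewrite q0_1inv inv1_q0 -scalemxAl -scalemxAr mulmxA -(mulmxA q q0 q0) qq qm.
by rewrite !scalerA mxtrace_mulC -mulrA [w * \tr _]mulrC yw mulr1.
Qed.

End Inverse.
End Graph.

(** * Projection to the tangent space and product rules *)

Section Proj.
Variables (B : comNzRingType) (n : nat).
Implicit Types a b c d q : 'M[B]_n.

(** Extends a vector tangent at one point to a tangent field: q is replaced by
    the idempotent of the moving point. *)
Definition tang_proj q c := q *m c + c *m q - (q *m c *m q + q *m c *m q).

Lemma tang_proj_tang q c : q *m q = q -> tang q (tang_proj q c).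
Proof.
move=> qq; rewrite /tang /tang_proj; mxexpand.
by rewrite -!(mulmxA _ q q) !qq; mxring.
Qed.

Lemma tang_proj_id q c : q *m q = q -> tang q c -> tang_proj q c = c.
Proof. by move=> qq tc; rewrite /tang_proj tang_qaq // addr0 subr0. Qed.

Lemma comm_product_rule b c d c' :
  (d *m c + b *m c') - (c' *m b + c *m d) = comm d c + comm b c'.
Proof. by rewrite /comm; mxring. Qed.

(** The derivative of x b + y I b for constant x and y. The vanishing
    derivatives of the scalars are kept because this is the literal shape
    produced by the product rule. *)
Lemma act_product_rule x y a b d e :
  (0 : B) *: a + x *: d + (0 *: b + y *: e) = x *: d + y *: e :> 'M[B]_n.
Proof. by mxring. Qed.

End Proj.

(** * Bicomplex numbers *)

Section Bicomplex.
Variable R : realType.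
Local Notation B := (bicomplex R).
Implicit Types (b c : B) (x y : R[i]).

Lemma bc_starD : {morph @bc_star R : b c / b + c}.
Proof. by move=> [b b'] [c c']; rewrite /bc_star /= !rmorphD. Qed.

Lemma bc_starM : {morph @bc_star R : b c / b * c}.
Proof.
by move=> [b b'] [c c']; rewrite /bc_star /= rmorphB rmorphD !rmorphM.
Qed.

Lemma bc_star0 : bc_star (0 : B) = 0.
Proof. by rewrite /bc_star /= !oppr0. Qed.

Lemma bc_star1 : bc_star (1 : B) = 1.
Proof. by rewrite /bc_star /= !oppr0. Qed.

Lemma bc_starN b : bc_star (- b) = - bc_star b.
Proof. by apply/eqP; rewrite -addr_eq0 -bc_starD addNr bc_star0. Qed.

Lemma bc_starK : involutive (@bc_star R).
Proof. by move=> [b c]; rewrite /bc_star /= !conjcK. Qed.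

HB.instance Definition _ := GRing.isNmodMorphism.Build B B (@bc_star R)
  (bc_star0, bc_starD).
HB.instance Definition _ := GRing.isMonoidMorphism.Build B B (@bc_star R)
  (bc_star1, bc_starM).

Lemma of_Rx0 : of_Rx (0 : R[i]) = 0.
Proof. by []. Qed.

HB.instance Definition _ := GRing.isNmodMorphism.Build R[i] B (@of_Rx R)
  (of_Rx0, @of_RxD R).
HB.instance Definition _ := GRing.isMonoidMorphism.Build R[i] B (@of_Rx R)
  (@of_Rx1 R, @of_RxM R).

Lemma star_of_Rx x : bc_star (of_Rx x) = of_Rx x.
Proof. by rewrite /bc_star /= !oppr0. Qed.

Lemma star_bc_i : bc_star (bc_i R) = - bc_i R.
Proof.
rewrite /bc_star /bc_i /= !oppr0.
by congr Complex; apply/eqP; rewrite eq_complex /= oppr0 !eqxx.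
Qed.

Lemma bc_i2 : bc_i R * bc_i R = -1.
Proof.
have e (x y z t : R) : x = z -> y = t -> x +i* y = z +i* t by move=> -> ->.
have f (x y z t : R[i]) : x = z -> y = t ->
  @Complex R[i] x y = Complex z t by move=> -> ->.
by apply: f; apply: e; rewrite /=; ring.
Qed.

(** A retraction onto R[x]/(x^2+1), the fixed points of the involution. *)
Definition to_Rx b : R[i] := complex.Re (complex.Re b) +i* complex.Re (complex.Im b).

Lemma to_RxK b : bc_star b = b -> of_Rx (to_Rx b) = b.
Proof.
case: b => [[a b] [c d]]; rewrite /bc_star /of_Rx /to_Rx /= => -[Hb Hd].
have e0 (u : R) : - u = u -> u = 0 by lra.
by rewrite (e0 _ Hb) (e0 _ Hd).
Qed.

Lemma of_RxK x : to_Rx (of_Rx x) = x.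
Proof. by case: x. Qed.

Lemma bc_reD b c : bc_re (b + c) = bc_re b + bc_re c.
Proof. by case: b c => [[? ?] [? ?]] [[? ?] [? ?]]. Qed.

Lemma bc_re_star b : bc_re (bc_star b) = bc_re b.
Proof. by case: b => [[? ?] [? ?]]. Qed.

Lemma bc_reZ (r : R) b : bc_re (of_Rx r%:C * b) = r * bc_re b.
Proof.
by case: b => [[b ?] [c ?]]; rewrite /bc_re /= !mul0r !subr0.
Qed.

Lemma bc_re0 : bc_re (0 : B) = 0.
Proof. by []. Qed.

HB.instance Definition _ := GRing.isNmodMorphism.Build B R (@bc_re R)
  (bc_re0, bc_reD).

(** Testing against 1, i, x and ix reads off the four real coordinates. *)
Lemma bc_re_nondegenerate b : (forall c, bc_re (c * b) = 0) -> b = 0.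
Proof.
move=> h; have := (h (Complex 1 0), h (Complex (0 +i* 1) 0),
   h (Complex 0 1), h (Complex 0 (0 +i* 1))).
case: b {h} => [[b1 b2] [b3 b4]]; rewrite /bc_re /= => -[[[h1 h2] h3] h4].
have -> : b1 = 0 by lra.
have -> : b2 = 0 by lra.
have -> : b3 = 0 by lra.
by have -> : b4 = 0 by lra.
Qed.

(** The two square roots s = i and s = -i of -1 give ring morphisms to the
    complex numbers which send x to s and together identify B with C x C. *)
Definition bc_eval (s : R[i]) (b : B) : R[i] := complex.Re b + s * complex.Im b.

Section Eval.
Variables (s : R[i]) (s2 : s * s = -1).

Lemma bc_evalD : {morph bc_eval s : b c / b + c}.
Proof. by move=> [b b'] [c c']; rewrite /bc_eval /= mulrDr addrACA. Qed.

Lemma bc_evalM : {morph bc_eval s : b c / b * c}.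
Proof.
move=> [b b'] [c c']; rewrite /bc_eval /=.
rewrite -[- _]mulN1r -s2; ring.
Qed.

Lemma bc_eval0 : bc_eval s 0 = 0.
Proof. by rewrite /bc_eval mulr0 addr0. Qed.

Lemma bc_eval1 : bc_eval s 1 = 1.
Proof. by rewrite /bc_eval mulr0 addr0. Qed.

End Eval.

Local Notation ii := (@Complex R 0 1).

Definition bc_p := bc_eval ii.
Definition bc_m := bc_eval (- ii).

Lemma i_sqr : ii * ii = -1.
Proof.
by apply/eqP; rewrite eq_complex /= !mulr0 !mul0r mulr1 sub0r addr0 oppr0 !eqxx.
Qed.

Lemma Ni_sqr : (- ii) * (- ii) = -1 :> R[i].
Proof. by rewrite mulrNN i_sqr. Qed.

HB.instance Definition _ := GRing.isNmodMorphism.Build B R[i] bc_p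
  (bc_eval0 ii, bc_evalD ii).
HB.instance Definition _ := GRing.isMonoidMorphism.Build B R[i] bc_p
  (bc_eval1 ii, bc_evalM i_sqr).
HB.instance Definition _ := GRing.isNmodMorphism.Build B R[i] bc_m
  (bc_eval0 (- ii), bc_evalD (- ii)).
HB.instance Definition _ := GRing.isMonoidMorphism.Build B R[i] bc_m
  (bc_eval1 (- ii), bc_evalM Ni_sqr).

(** The inverse of b |-> (bc_p b, bc_m b). *)
Definition bc_glue (x y : R[i]) : B :=
  @Complex R[i] ((x + y) / 2) (- ii * ((x - y) / 2)).

Lemma bc_p_glue x y : bc_p (bc_glue x y) = x.
Proof.
rewrite /bc_p /bc_eval /bc_glue /= mulrA mulrN i_sqr; by field.
Qed.

Lemma bc_m_glue x y : bc_m (bc_glue x y) = y.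
Proof.
rewrite /bc_m /bc_eval /bc_glue /= mulrA Ni_sqr; by field.
Qed.

Lemma bc_pm_inj b c : bc_p b = bc_p c -> bc_m b = bc_m c -> b = c.
Proof.
move: b c => [b b'] [c c']; rewrite /bc_p /bc_m /bc_eval /= => hp hm.
have bc : b = c.
  have : b + b = c + c.
    transitivity ((b + ii * b') + (b + - ii * b')); first by ring.
    by rewrite hp hm; ring.
  by rewrite -!mulr2n => /eqP; rewrite eqrMn2r //= => /eqP.
congr Complex => //; move: hp; rewrite bc => /addrI/mulfI; apply.
by rewrite eq_complex /= oner_eq0 andbF.
Qed.

(** Apply the corresponding fact over a field in both factors of B = C x C. *)
Lemma bc_rank_one n (q : 'M[B]_n) : q *m q = q -> \tr q = 1 -> rank_one_idem q.
Proof.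
move=> qq trq; split=> // m.
have T (f : {rmorphism B -> R[i]}) :
    map_mx f (q *m m *m q) = map_mx f (\tr (q *m m) *: q).
  have qqf : map_mx f q *m map_mx f q = map_mx f q by rewrite -map_mxM qq.
  have trf : \tr (map_mx f q) = 1 by rewrite trace_map_mx trq rmorph1.
  have [_ _ h] := idem_tr1_rank_one qqf trf.
  by rewrite !map_mxM h map_mxZ -map_mxM trace_map_mx.
apply/matrixP => i j; apply: bc_pm_inj.
  by move: (congr1 (fun a : 'M[R[i]]_n => a i j) (T bc_p)); rewrite !mxE.
by move: (congr1 (fun a : 'M[R[i]]_n => a i j) (T bc_m)); rewrite !mxE.
Qed.

Lemma bc_idem_conj n (q0 q1 : 'M[B]_n) : rank_one_idem q0 -> rank_one_idem q1 ->
  exists g g' : 'M[B]_n, [/\ g *m g' = 1%:M, g' *m g = 1%:M & g *m q0 = q1 *m g].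
Proof.
move=> [q0q tr0 _] [q1q tr1 _].
have T (f : {rmorphism B -> R[i]}) : exists g g' : 'M[R[i]]_n,
    [/\ g *m g' = 1%:M, g' *m g = 1%:M & g *m map_mx f q0 = map_mx f q1 *m g].
  by apply: idem_tr1_conj; rewrite ?trace_map_mx -?map_mxM ?q0q ?q1q ?tr0 ?tr1 ?rmorph1.
have [gp [gp' [p1 p2 p3]]] := T bc_p; have [gm [gm' [m1 m2 m3]]] := T bc_m.
pose glue (x y : 'M[R[i]]_n) : 'M[B]_n := \matrix_(i, j) bc_glue (x i j) (y i j).
have Ep (x y : 'M[R[i]]_n) : map_mx bc_p (glue x y) = x.
  by apply/matrixP => i j; rewrite !mxE bc_p_glue.
have Em (x y : 'M[R[i]]_n) : map_mx bc_m (glue x y) = y.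
  by apply/matrixP => i j; rewrite !mxE bc_m_glue.
have inj (a b : 'M[B]_n) : map_mx bc_p a = map_mx bc_p b ->
    map_mx bc_m a = map_mx bc_m b -> a = b.
  move=> hp hm; apply/matrixP => i j; apply: bc_pm_inj.
    by move: (congr1 (fun a : 'M[R[i]]_n => a i j) hp); rewrite !mxE.
  by move: (congr1 (fun a : 'M[R[i]]_n => a i j) hm); rewrite !mxE.
exists (glue gp gm), (glue gp' gm'); split; apply: inj;
  by rewrite !map_mxM ?map_scalar_mx ?rmorph1 ?Ep ?Em.
Qed.

(** For b = alpha + x beta let nu = alpha^2 + beta^2. Then [bc_norm] is the
    squared absolute value of nu, and [bc_adj] is (alpha - x beta) times the
    complex conjugate of nu. *)
Definition bc_adj b : B :=
  let nu := complex.Re b ^+ 2 + complex.Im b ^+ 2 in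
  @Complex R[i] (complex.Re b * conjc nu) (- complex.Im b * conjc nu).

Definition bc_norm b : R :=
  let nu := complex.Re b ^+ 2 + complex.Im b ^+ 2 in
  complex.Re nu ^+ 2 + complex.Im nu ^+ 2.

Definition bc_inv b : B := of_Rx (bc_norm b)^-1%:C * bc_adj b.

Lemma bc_mul_adj b : b * bc_adj b = of_Rx (bc_norm b)%:C.
Proof.
have e (x y z t : R) : x = z -> y = t -> x +i* y = z +i* t by move=> -> ->.
have f (x y z t : R[i]) : x = z -> y = t ->
  @Complex R[i] x y = Complex z t by move=> -> ->.
case: b => [[a b] [c d]]; rewrite /bc_adj /bc_norm /of_Rx /= !expr2 /=.
by apply: f; apply: e; rewrite /=; ring.
Qed.

Lemma bc_normM b c : bc_norm (b * c) = bc_norm b * bc_norm c.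
Proof.
case: b c => [[a b] [c d]] [[a' b'] [c' d']].
by rewrite /bc_norm /= !expr2 /=; ring.
Qed.

Lemma bc_norm1 : bc_norm 1 = 1.
Proof. by rewrite /bc_norm /= !expr2 /=; ring. Qed.

Lemma bc_mulV b : bc_norm b != 0 -> b * bc_inv b = 1.
Proof.
move=> nb; rewrite /bc_inv mulrCA bc_mul_adj -of_RxM -rmorphM mulVf //.
Qed.

(** The norm is multiplicative, so it does not vanish on invertible elements. *)
Lemma bc_norm_unit b c : b * c = 1 -> bc_norm b != 0.
Proof.
move=> /(congr1 (@bc_norm)); rewrite bc_normM bc_norm1 => h.
by apply/eqP => b0; move: h; rewrite b0 mul0r => /esym/eqP; rewrite oner_eq0.
Qed.

Lemma bc_inv_uniq b c : b * c = 1 -> bc_inv b = c.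
Proof.
move=> bc; rewrite -[LHS]mulr1 -bc mulrA [bc_inv b * b]mulrC.
by rewrite bc_mulV ?mul1r // (bc_norm_unit bc).
Qed.

Lemma bc_star_inv b : bc_star b = b -> bc_norm b != 0 -> bc_star (bc_inv b) = bc_inv b.
Proof.
move=> sb nb; symmetry; apply: bc_inv_uniq.
by rewrite -{1}sb -bc_starM bc_mulV // bc_star1.
Qed.

Section Dagger.
Variable n : nat.
Implicit Types a q m : 'M[B]_n.

Lemma daggerD a q : dagger (a + q) = dagger a + dagger q.
Proof. exact: (dagD (@bc_star R : {rmorphism B -> B})). Qed.

Lemma daggerM a q : dagger (a *m q) = dagger q *m dagger a.
Proof. exact: (dagM (@bc_star R : {rmorphism B -> B})). Qed.

Lemma daggerZ b a : dagger (b *: a) = bc_star b *: dagger a.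
Proof. exact: (dagZ (@bc_star R : {rmorphism B -> B})). Qed.

Lemma daggerK : involutive (@dagger R n).
Proof. exact: (dagK bc_starK). Qed.

Lemma tr_dagger a : \tr (dagger a) = bc_star (\tr a).
Proof. exact: (tr_dag (@bc_star R : {rmorphism B -> B})). Qed.

Lemma star_tr_dagger q : bc_star (\tr (dagger q *m q)) = \tr (dagger q *m q).
Proof. by rewrite -tr_dagger daggerM daggerK. Qed.

End Dagger.
End Bicomplex.

(** * Smooth functions on open subsets of row vectors *)

Section NearEq.
Variables (R : realType) (V W : normedModType R).

(** Derivatives on an open set are computed through formulas that hold only on
    that set, so differentiability has to be transported along local equality. *)
Lemma near_eq_differentiable (f g : V -> W) (a : V) :
  (\near a, f a = g a) -> differentiable f a -> differentiable g a.
Proof.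
move=> fg df; have [dfc dfE] := (diff_locallyP _ _).1 df.
have ga : f a = g a by exact: nbhs_singleton fg.
have dgE : g \o shift a = cst (g a) + 'd f a +o_ 0 id.
  apply/eqaddoP => e e0; move/eqaddoP : dfE => /(_ _ e0).
  have : \forall h \near 0, f (h + a) = g (h + a).
    by move: fg; rewrite (near_shift 0 a) subr0.
  apply: filter_app2; near=> h => fgh.
  by rewrite !fctE /= fgh ga.
apply/diff_locallyP; rewrite (diff_unique dfc dgE); split=> //.
Unshelve. all: by end_near. Qed.

End NearEq.

Section Smooth.
Variables (R : realType) (m : nat) (W : normedModType R).
Local Notation V := 'rV[R]_m.
Implicit Types (f g : V -> W) (U : set V).

(** Smoothness of finite order, on which closure properties are proved by
    induction: a derivative of a product involves the factors themselves and
    their derivatives, all of them of smaller order. *)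
Definition smooth_upto (k : nat) U f := forall s : seq V, (size s <= k)%N ->
  forall u, U u -> differentiable (foldr (fun v h => 'D_v h) f s) u.

Lemma smooth_onP U f : smooth_on U f <-> forall k, smooth_upto k U f.
Proof.
split=> [sf k s _|sf s]; first exact: sf.
exact: (sf (size s) s (leqnn _)).
Qed.

Lemma smooth_uptoW k l U f : (k <= l)%N -> smooth_upto l U f -> smooth_upto k U f.
Proof. by move=> kl sf s sk; apply: sf; exact: leq_trans kl. Qed.

Lemma smooth_upto_diff k U f u : smooth_upto k U f -> U u -> differentiable f u.
Proof. by move=> sf; exact: (sf [::]). Qed.

Lemma smooth_uptoSP k U f : smooth_upto k.+1 U f <->
  (forall u, U u -> differentiable f u) /\ forall v, smooth_upto k U ('D_v f).
Proof.
split=> [sf|[df sf] s].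
  split=> [u Uu|v s sk u Uu]; first exact: smooth_upto_diff sf Uu.
  by have := sf (rcons s v); rewrite size_rcons foldr_rcons; apply.
case/lastP : s => [_|s v]; first exact: df.
by rewrite size_rcons foldr_rcons ltnS; apply: sf.
Qed.

Lemma smooth_on_D U f v : smooth_on U f -> smooth_on U ('D_v f).
Proof.
move=> sf s u Uu; have := sf (rcons s v) u Uu.
by rewrite foldr_rcons.
Qed.

Lemma smooth_on_diff U f u : smooth_on U f -> U u -> differentiable f u.
Proof. by move=> sf; exact: (sf [::]). Qed.

Lemma open_near_eq U f g u : open U -> U u -> (forall x, U x -> f x = g x) ->
  \near u, f u = g u.
Proof. by move=> oU Uu fg; near=> x; apply: fg; near: x; exact: open_nbhs_nbhs.
Unshelve. all: by end_near. Qed.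

Lemma eq_on_derive U f g u v : open U -> U u -> (forall x, U x -> f x = g x) ->
  'D_v f u = 'D_v g u.
Proof. by move=> oU Uu fg; apply: near_eq_derive; exact: open_near_eq fg. Qed.

Lemma smooth_upto_ext k U f g : open U -> (forall x, U x -> f x = g x) ->
  smooth_upto k U f -> smooth_upto k U g.
Proof.
move=> oU; elim: k f g => [|k IH] f g fg.
  move=> sf [|//] _ u Uu /=.
  apply: near_eq_differentiable (open_near_eq oU Uu fg) (smooth_upto_diff sf Uu).
move=> /smooth_uptoSP[df sf]; apply/smooth_uptoSP; split=> [u Uu|v].
  exact: near_eq_differentiable (open_near_eq oU Uu fg) (df _ Uu).
by apply: IH (sf v) => u Uu; exact: eq_on_derive Uu fg.
Qed.

Lemma smooth_on_ext U f g : open U -> (forall x, U x -> f x = g x) ->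
  smooth_on U f -> smooth_on U g.
Proof.
by move=> oU fg /smooth_onP sf; apply/smooth_onP => k; exact: smooth_upto_ext fg _.
Qed.

Lemma smooth_upto_cst k U (c : W) : open U -> smooth_upto k U (cst c).
Proof.
move=> oU; elim: k c => [|k IH] c; first by move=> [|//] _ u Uu; exact: differentiable_cst.
apply/smooth_uptoSP; split=> [u _|v]; first exact: differentiable_cst.
by apply: smooth_upto_ext (IH 0) => // u _; rewrite derive_cst.
Qed.

Lemma smooth_on_cst U (c : W) : open U -> smooth_on U (cst c).
Proof. by move=> oU; apply/smooth_onP => k; exact: smooth_upto_cst. Qed.

Lemma smooth_uptoD k U f g : open U -> smooth_upto k U f -> smooth_upto k U g ->
  smooth_upto k U (f + g).
Proof.
move=> oU; elim: k f g => [|k IH] f g.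
  move=> sf sg [|//] _ u Uu /=.
  by apply: differentiableD; [exact: smooth_upto_diff sf Uu | exact: smooth_upto_diff sg Uu].
move=> /smooth_uptoSP[df sf] /smooth_uptoSP[dg sg]; apply/smooth_uptoSP.
split=> [u Uu|v]; first by apply: differentiableD; [exact: df|exact: dg].
apply: smooth_upto_ext (IH _ _ (sf v) (sg v)) => // u Uu.
by rewrite deriveD //; apply: diff_derivable; [exact: df|exact: dg].
Qed.

Lemma smooth_onD U f g : open U -> smooth_on U f -> smooth_on U g ->
  smooth_on U (f + g).
Proof.
by move=> oU /smooth_onP sf /smooth_onP sg; apply/smooth_onP => k; exact: smooth_uptoD.
Qed.

End Smooth.

Section SmoothReal.
Variables (R : realType) (m : nat).
Local Notation V := 'rV[R]_m.
Implicit Types (f g : V -> R) (U : set V).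

Lemma smooth_uptoM k U f g : open U -> smooth_upto k U f -> smooth_upto k U g ->
  smooth_upto k U (fun x => f x * g x).
Proof.
move=> oU; elim: k f g => [|k IH] f g.
  move=> sf sg [|//] _ u Uu /=.
  by apply: differentiableM; [exact: smooth_upto_diff sf Uu | exact: smooth_upto_diff sg Uu].
move=> sf' sg'; have /smooth_uptoSP[df sf] := sf'; have /smooth_uptoSP[dg sg] := sg'.
apply/smooth_uptoSP.
split=> [u Uu|v]; first by apply: differentiableM; [exact: df|exact: dg].
have [sf0 sg0] := (smooth_uptoW (leqnSn _) sf', smooth_uptoW (leqnSn _) sg').
apply: smooth_upto_ext (smooth_uptoD oU (IH _ _ sf0 (sg v)) (IH _ _ sg0 (sf v))) => // u Uu.
by rewrite deriveM //; apply: diff_derivable; [exact: df|exact: dg].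
Qed.

Lemma smooth_onM U f g : open U -> smooth_on U f -> smooth_on U g ->
  smooth_on U (fun x => f x * g x).
Proof.
by move=> oU /smooth_onP sf /smooth_onP sg; apply/smooth_onP => k; exact: smooth_uptoM.
Qed.

(** The derivative - f' f^-2 contains the inverse itself, with one order of
    smoothness less to be proved. *)
Lemma smooth_uptoV k U f : open U -> (forall x, U x -> f x != 0) ->
  smooth_upto k U f -> smooth_upto k U (fun x => (f x)^-1).
Proof.
move=> oU f0; elim: k => [|k IH].
  move=> sf [|//] _ u Uu /=.
  by apply: differentiableV; [exact: smooth_upto_diff sf Uu | exact: f0].
move=> sf'; have /smooth_uptoSP[df sf] := sf'.
apply/smooth_uptoSP; split=> [u Uu|v].
  by apply: differentiableV; [exact: df|exact: f0].
have sV := IH (smooth_uptoW (leqnSn _) sf').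
have := smooth_uptoM oU (@smooth_upto_cst R m R^o k U (-1) oU)
  (smooth_uptoM oU (sf v) (smooth_uptoM oU sV sV)).
apply: smooth_upto_ext => // u Uu; rewrite deriveV ?f0 //; last first.
  by apply: diff_derivable; exact: df.
rewrite /cst /= -[LHS]/(-1 * ('D_v f u * ((f u)^-1 * (f u)^-1))).
by rewrite expr2 invfM mulN1r -[RHS]/(_ * _) mulNr mulrC.
Qed.

Lemma smooth_onV U f : open U -> (forall x, U x -> f x != 0) ->
  smooth_on U f -> smooth_on U (fun x => (f x)^-1).
Proof.
by move=> oU f0 /smooth_onP sf; apply/smooth_onP => k; exact: smooth_uptoV.
Qed.

Lemma differentiable_sqrt f u : 0 < f u -> differentiable f u ->
  differentiable (fun x => Num.sqrt (f x)) u.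
Proof.
move=> f0 df; apply: differentiable_comp df _.
by apply/derivable1_diffP; have [] := is_derive1_sqrt f0.
Qed.

Lemma derive_sqrt_comp f u v : 0 < f u -> differentiable f u ->
  'D_v (fun x => Num.sqrt (f x)) u = 'D_v f u * (2 * Num.sqrt (f u))^-1.
Proof.
move=> f0 df; rewrite deriveE; last exact: differentiable_sqrt.
have ds := is_derive1_sqrt f0.
have dd : differentiable (@Num.sqrt R : R -> R) (f u).
  by apply/derivable1_diffP; have [] := ds.
rewrite (diff_comp df dd) /= diff1E ?derive1E //.
by rewrite (@derive_val _ _ _ _ _ _ _ ds) deriveE.
Qed.

Lemma smooth_upto_sqrt k U f : open U -> (forall x, U x -> 0 < f x) ->
  smooth_upto k U f -> smooth_upto k U (fun x => Num.sqrt (f x)).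
Proof.
move=> oU f0; elim: k => [|k IH].
  move=> sf [|//] _ u Uu /=.
  by apply: differentiable_sqrt; [exact: f0 | exact: smooth_upto_diff sf Uu].
move=> sf'; have /smooth_uptoSP[df sf] := sf'.
apply/smooth_uptoSP; split=> [u Uu|v].
  by apply: differentiable_sqrt; [exact: f0|exact: df].
have sS := IH (smooth_uptoW (leqnSn _) sf').
have s2S := smooth_uptoM oU (@smooth_upto_cst R m R^o k U 2 oU) sS.
have S0 x : U x -> (2 : R) * Num.sqrt (f x) != 0.
  by move=> Ux; rewrite mulf_neq0 // gt_eqF // sqrtr_gt0 f0.
have := smooth_uptoM oU (sf v) (smooth_uptoV oU S0 s2S).
apply: smooth_upto_ext => // u Uu.
by rewrite derive_sqrt_comp ?f0 //; exact: df.
Qed.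

Lemma smooth_on_sqrt U f : open U -> (forall x, U x -> 0 < f x) ->
  smooth_on U f -> smooth_on U (fun x => Num.sqrt (f x)).
Proof.
by move=> oU f0 /smooth_onP sf; apply/smooth_onP => k; exact: smooth_upto_sqrt.
Qed.

End SmoothReal.

(** * Linear maps, matrix entries and symmetry of second derivatives *)

Section Linear.
Variables (R : realType) (m : nat).
Local Notation V := 'rV[R]_m.

Lemma derive_lin (W W' : normedModType R) (L : {linear W -> W'}) (f : V -> W) u v :
  continuous L -> differentiable f u -> 'D_v (L \o f) u = L ('D_v f u).
Proof.
move=> cL df; have dL x : differentiable L x by exact: linear_differentiable.
rewrite deriveE; last exact: differentiable_comp.
by rewrite diff_comp // diff_lin //= deriveE.
Qed.

Lemma smooth_on_lin (W W' : normedModType R) (L : {linear W -> W'}) (f : V -> W) U :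
  open U -> continuous L -> smooth_on U f -> smooth_on U (L \o f).
Proof.
move=> oU cL /smooth_onP sf; apply/smooth_onP => k.
have dL x : differentiable L x by exact: linear_differentiable.
elim: k f {sf}(sf k) => [|k IH] f sf.
  move=> [|//] _ u Uu /=; apply: differentiable_comp (dL _).
  exact: smooth_upto_diff sf Uu.
have [df sDf] := (smooth_uptoSP _ _ _).1 sf.
apply/smooth_uptoSP; split=> [u Uu|v]; first exact: differentiable_comp (df _ Uu) (dL _).
apply: smooth_upto_ext (IH _ (sDf v)) => // u Uu.
by rewrite derive_lin //; exact: df.
Qed.

Lemma smooth_on_sum (W : normedModType R) (I : Type) (r : seq I) (F : I -> V -> W) U :
  open U -> (forall i, smooth_on U (F i)) -> smooth_on U (fun u => \sum_(i <- r) F i u).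
Proof.
move=> oU sF; elim: r => [|i r IH].
  by apply: smooth_on_ext (smooth_on_cst (0 : W) oU) => // u _; rewrite big_nil.
by apply: smooth_on_ext (smooth_onD oU (sF i) IH) => // u _; rewrite big_cons.
Qed.

Section Matrix.
Variables p q : nat.

Lemma entry_linear i j : linear (fun N : 'M[R]_(p, q) => N i j : R^o).
Proof. by move=> a x y; rewrite !mxE. Qed.

Lemma smooth_on_mxP (f : V -> 'M[R]_(p, q)) U : open U ->
  smooth_on U f <-> forall i j, smooth_on U (fun u => f u i j : R^o).
Proof.
move=> oU; split=> [sf i j|sf].
  pose L : {linear 'M[R]_(p, q) -> R^o} := HB.pack (fun N : 'M[R]_(p, q) => N i j : R^o)
    (GRing.isLinear.Build _ _ _ _ _ (entry_linear i j)).
  apply: (@smooth_on_lin _ _ L f U oU _ sf); exact: coord_continuous.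
have S i j : smooth_on U (fun u => f u i j *: (delta_mx i j : 'M[R]_(p, q))).
  have lin : linear ( *:%R^~ (delta_mx i j : 'M[R]_(p, q)) : R^o -> _).
    by move=> a x y /=; rewrite scalerDl scalerA.
  pose L : {linear R^o -> 'M[R]_(p, q)} := HB.pack ( *:%R^~ (delta_mx i j : 'M[R]_(p, q)) : R^o -> _)
    (GRing.isLinear.Build _ _ _ _ _ lin).
  by apply: (@smooth_on_lin _ _ L _ U oU _ (sf i j)); exact: scalel_continuous.
apply: smooth_on_ext (smooth_on_sum (index_enum _) oU
   (fun i => smooth_on_sum (index_enum _) oU (S i))) => // u _.
by rewrite -matrix_sum_delta.
Qed.

Lemma derive_entry (f : V -> 'M[R]_(p, q)) u v i j : differentiable f u ->
  'D_v f u i j = 'D_v (fun x => f x i j : R^o) u.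
Proof. by move=> df; rewrite derive_mx ?mxE //; exact: diff_derivable. Qed.

End Matrix.

Lemma derive_dirD (W : normedModType R) (f : V -> W) u r v w : differentiable f u ->
  'D_(r *: v + w) f u = r *: 'D_v f u + 'D_w f u.
Proof. by move=> df; rewrite !deriveE // linearP. Qed.

Lemma derive_dir_sum (W : normedModType R) (f : V -> W) u v : differentiable f u ->
  'D_v f u = \sum_i v 0 i *: 'D_(delta_mx 0 i) f u.
Proof.
move=> df; rewrite deriveE // {1}(row_sum_delta v) linear_sum.
by apply: eq_bigr => i _; rewrite linearZ deriveE.
Qed.

Lemma open_preimage_on (W : topologicalType) (f : V -> W) U O : open U ->
  (forall u, U u -> {for u, continuous f}) -> open O -> open (U `&` f @^-1` O).
Proof.
move=> oU cf oO; rewrite openE => u [Uu Ou]; apply: filterI.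
  exact: open_nbhs_nbhs.
by apply: (cf u Uu); exact: open_nbhs_nbhs.
Qed.

End Linear.

Section Schwarz.
Variables (R : realType) (m : nat).
Local Notation V := 'rV[R]_m.

Lemma is_derive_line (f : V -> R) (v c : V) s : differentiable f (s *: v + c) ->
  is_derive s 1 (fun s : R => f (s *: v + c) : R) ('D_v f (s *: v + c)).
Proof.
move=> df.
have dl : is_diff s (fun s : R^o => s *: v + c) (fun t => t *: v).
  apply: is_diff_eq; last exact: addr0.
have [dl1 dl2] := dl.
have dc : differentiable (f \o (fun s : R^o => s *: v + c)) s.
  exact: differentiable_comp.
split; first exact: diff_derivable dc.
by rewrite [LHS]deriveE // diff_comp //= dl2 scale1r deriveE.
Qed.

Let diff2 (f : V -> R) (u v w : V) (h : R) :=
  f (h *: v + (h *: w + u)) - f (h *: v + u) - f (h *: w + u) + f u.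

Lemma diff2C f u v w h : diff2 f u v w h = diff2 f u w v h.
Proof. by rewrite /diff2 addrCA; ring. Qed.

(** Mean value theorem for s |-> f (s v + h w + u) - f (s v + u), combined with
    the differentiability of D_v f at u. *)
Lemma diff2_limit (f : V -> R) U u v w e : open U -> U u ->
  (forall x, U x -> differentiable f x) ->
  differentiable ('D_v f) u -> 0 < e ->
  \forall h \near 0^'+,
    `|diff2 f u v w h - h ^+ 2 * 'D_w ('D_v f) u| <= e * (2 * `|v| + `|w|) * h ^+ 2.
Proof.
move=> oU Uu df dDf e0.
set g := 'D_v f; have dg := diff_locallyx dDf.
have [d1 /= d10 hd1] : exists2 d : R, 0 < d & forall x, `|x| < d ->
    `|g (x + u) - g u - 'd g u x| <= e * `|x|.
  have [_ /eqaddoP /(_ _ e0)] := (diff_locallyP _ _).1 dDf.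
  move=> /nbhs_normP[d /= d0 hd]; exists d => // x xd.
  have := hd x; rewrite /ball_ /= sub0r normrN => /(_ xd).
  by rewrite !fctE /= opprD addrA.
have [d2 /= d20 hd2] : exists2 d : R, 0 < d & forall x, `|x| < d -> U (x + u).
  have : \forall x \near u, U x by exact: open_nbhs_nbhs.
  rewrite (near_shift 0 u) subr0 => /nbhs_normP[d /= d0 hd]; exists d => // x xd.
  by apply: (hd x); rewrite /ball_ /= sub0r normrN.
(* Points of the parallelogram spanned by h v and h w have norm at most h K. *)
pose K : R := `|v| + `|w| + 1.
have K0 : 0 < K by rewrite ltr_wpDl // addr_ge0.
near=> h.
have h0 : 0 < h by [].
have hK1 : h * K < d1.
  by rewrite -ltr_pdivlMr //; near: h; apply: nbhs_right_lt; exact: divr_gt0.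
have hK2 : h * K < d2.
  by rewrite -ltr_pdivlMr //; near: h; apply: nbhs_right_lt; exact: divr_gt0.
have bound s t : 0 <= s <= h -> 0 <= t <= h -> `|s *: v + t *: w| <= s * `|v| + t * `|w|.
  move=> /andP[s0 sh] /andP[t0 th].
  by rewrite (le_trans (ler_normD _ _)) // !normrZ !ger0_norm.
have small s t : 0 <= s <= h -> 0 <= t <= h -> `|s *: v + t *: w| <= h * K.
  move=> sh th; apply: le_trans (bound _ _ sh th) _.
  case/andP: sh => s0 sh; case/andP: th => t0 th.
  rewrite /K !mulrDr mulr1 -[leLHS]addr0 !lerD ?ler_wpM2r // ltW //.
have hh : 0 <= h <= h by rewrite lexx ltW.
have h00 : 0 <= (0 : R) <= h by rewrite lexx ltW.
pose phi s := f (s *: v + (h *: w + u)) - f (s *: v + u).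
pose dphi s := g (s *: v + (h *: w + u)) - g (s *: v + u).
have dphiP s : 0 <= s <= h -> is_derive s 1 phi (dphi s).
  move=> sh; apply: is_deriveB; apply: is_derive_line; apply: df.
    rewrite addrA; apply: hd2; exact: le_lt_trans (small _ _ sh hh) hK2.
  apply: hd2; have := le_lt_trans (small _ _ sh h00) hK2; by rewrite scale0r addr0.
have [xi xih Exi] : exists2 xi, xi \in `]0, h[%R & phi h - phi 0 = dphi xi * (h - 0).
  apply: MVT => // [x|].
    by rewrite in_itv /= => /andP[x0 xh]; apply: dphiP; rewrite !ltW.
  apply: derivable_within_continuous => x; rewrite in_itv /= => xh.
  by have [] := dphiP x xh.
have {}xih : 0 <= xi <= h by move: xih; rewrite in_itv /= => /andP[? ?]; rewrite !ltW.
have -> : diff2 f u v w h = dphi xi * h.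
  move: Exi; rewrite subr0 => <-; rewrite /phi /diff2 !scale0r !add0r; ring.
have dw : 'D_w g u = 'd g u w by rewrite deriveE.
have -> : dphi xi * h - h ^+ 2 * 'D_w g u =
    h * ((g (xi *: v + h *: w + u) - g u - 'd g u (xi *: v + h *: w))
       - (g (xi *: v + 0 *: w + u) - g u - 'd g u (xi *: v + 0 *: w))).
  by rewrite dw /dphi !linearD !linearZ /= scale0r !addr0 -!addrA /GRing.scale /=; ring.
rewrite normrM (gtr0_norm h0) [leRHS]mulrC expr2 -mulrA ler_pM2l //.
apply: le_trans (ler_normB _ _) _.
have b1 := hd1 _ (le_lt_trans (small _ _ xih hh) hK1).
have b2 := hd1 _ (le_lt_trans (small _ _ xih h00) hK1).
apply: le_trans (lerD b1 b2) _; rewrite -mulrDr mulrCA ler_pM2l //.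
apply: le_trans (lerD (bound _ _ xih hh) (bound _ _ xih h00)) _.
case/andP: xih => x0 xh; rewrite mul0r addr0.
have := ler_wpM2r (normr_ge0 v) xh; lra.
Unshelve. all: by end_near. Qed.

(** By the symmetry [diff2C] both iterated derivatives are limits of the same
    second difference divided by h^2. *)
Lemma derive_swap (f : V -> R) U u v w : open U -> U u -> smooth_on U f ->
  'D_w ('D_v f) u = 'D_v ('D_w f) u.
Proof.
move=> oU Uu sf; have df x (Ux : U x) := smooth_on_diff sf Ux.
have dD v' : differentiable ('D_v' f) u := smooth_on_diff (smooth_on_D v' sf) Uu.
set A := 'D_w _ _; set B := 'D_v _ _; apply/eqP; rewrite -subr_eq0 -normr_le0.
apply/ler_addgt0Pr => e e0; rewrite add0r.
(* The two error bounds add up to at most (e / K) K h^2. *)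
pose K : R := 2 * `|v| + `|w| + (2 * `|w| + `|v|) + 1.
have K0 : 0 < K by rewrite ltr_wpDl // !addr_ge0 // mulr_ge0.
have eK : 0 < e / K by exact: divr_gt0.
near (0 : R)^'+ => h.
have h0 : 0 < h by [].
have h2 : 0 < h ^+ 2 by exact: exprn_gt0.
have H1 : `|diff2 f u v w h - h ^+ 2 * A| <= e / K * (2 * `|v| + `|w|) * h ^+ 2.
  by near: h; exact: diff2_limit oU Uu df (dD v) eK.
have H2 : `|diff2 f u w v h - h ^+ 2 * B| <= e / K * (2 * `|w| + `|v|) * h ^+ 2.
  by near: h; exact: diff2_limit oU Uu df (dD w) eK.
rewrite -(ler_pM2r h2) -[X in `|_| * X](gtr0_norm h2) -normrM.
rewrite diff2C in H2.
have -> : (A - B) * h ^+ 2 = (diff2 f u v w h - h ^+ 2 * B) - (diff2 f u v w h - h ^+ 2 * A).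
  rewrite diff2C; ring.
apply: (le_trans (ler_normB _ _)); apply: le_trans (lerD H2 H1) _.
rewrite -mulrDl -mulrDr ler_pM2r // -ler_pdivlMl; last by rewrite divr_gt0.
rewrite invf_div divfK ?gt_eqF // /K.
by rewrite (addrC (2 * `|w| + _)) lerDl.
Unshelve. all: by end_near. Qed.

End Schwarz.

(** * Smoothness and derivatives of bicomplex matrix functions *)

Notation bc0 b := (complex.Re (complex.Re b)).
Notation bc1 b := (complex.Im (complex.Re b)).
Notation bc2 b := (complex.Re (complex.Im b)).
Notation bc3 b := (complex.Im (complex.Im b)).

Section FunAlg.
Variables (R : realType) (T : Type).
Local Notation B := (bicomplex R).

(** Applied with P the smooth functions on an open set ([smooth_fun_alg]).
    Being closed under polynomial operations passes to bicomplex matrices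
    entry by entry, without a topology on B. *)
Record fun_alg (P : (T -> R) -> Prop) : Prop := FunAlg {
  fa_cst : forall c, P (fun=> c);
  fa_D : forall f g, P f -> P g -> P (fun x => f x + g x);
  fa_M : forall f g, P f -> P g -> P (fun x => f x * g x) }.

Definition cx_fun (P : (T -> R) -> Prop) (f : T -> R[i]) :=
  P (fun x => complex.Re (f x)) /\ P (fun x => complex.Im (f x)).

Definition bc_fun (P : (T -> R) -> Prop) (f : T -> B) :=
  [/\ P (fun x => bc0 (f x)), P (fun x => bc1 (f x)),
      P (fun x => bc2 (f x)) & P (fun x => bc3 (f x))].

Definition mx_fun (P : (T -> R) -> Prop) p q (f : T -> 'M[B]_(p, q)) :=
  forall i j, bc_fun P (fun x => f x i j).

Variables (P : (T -> R) -> Prop) (aP : fun_alg P).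

Lemma fun_ext f g : P f -> (forall x, f x = g x) -> P g.
Proof. by move=> Pf fg; rewrite -(funext fg). Qed.

Lemma fa_N f : P f -> P (fun x => - f x).
Proof.
by move=> Pf; apply: fun_ext (fa_M aP (fa_cst aP (-1)) Pf) _ => x; rewrite mulN1r.
Qed.

Lemma fa_B f g : P f -> P g -> P (fun x => f x - g x).
Proof. by move=> Pf Pg; exact (fa_D aP Pf (fa_N Pg)). Qed.

Lemma bc_fun_cst (b : B) : bc_fun P (fun=> b).
Proof. by split; exact: fa_cst. Qed.

Lemma bc_fun_ext (f g : T -> B) : bc_fun P f -> (forall x, f x = g x) -> bc_fun P g.
Proof. by move=> Pf fg; rewrite -(funext fg). Qed.

Lemma bc_funD f g : bc_fun P f -> bc_fun P g -> bc_fun P (fun x => f x + g x).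
Proof.
move=> [f0 f1 f2 f3] [g0 g1 g2 g3]; split;
  [apply: fun_ext (fa_D aP f0 g0) _|apply: fun_ext (fa_D aP f1 g1) _|
   apply: fun_ext (fa_D aP f2 g2) _|apply: fun_ext (fa_D aP f3 g3) _] => x;
  by case: (f x) (g x) => [[? ?] [? ?]] [[? ?] [? ?]].
Qed.

Lemma bc_funM f g : bc_fun P f -> bc_fun P g -> bc_fun P (fun x => f x * g x).
Proof.
move=> [f0 f1 f2 f3] [g0 g1 g2 g3].
have Q a b c d a' b' c' d' : P a -> P b -> P c -> P d -> P a' -> P b' -> P c' -> P d' ->
    P (fun x => a x * a' x - b x * b' x - (c x * c' x - d x * d' x)).
  by move=> *; do !apply: fa_B; apply: fa_M.
have S a b c d a' b' c' d' : P a -> P b -> P c -> P d -> P a' -> P b' -> P c' -> P d' ->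
    P (fun x => a x * a' x + b x * b' x - (c x * c' x + d x * d' x)).
  by move=> *; apply: fa_B; apply: fa_D => //; apply: fa_M.
have U a b c d a' b' c' d' : P a -> P b -> P c -> P d -> P a' -> P b' -> P c' -> P d' ->
    P (fun x => a x * a' x - b x * b' x + (c x * c' x - d x * d' x)).
  by move=> *; apply: fa_D => //; apply: fa_B; apply: fa_M.
have W a b c d a' b' c' d' : P a -> P b -> P c -> P d -> P a' -> P b' -> P c' -> P d' ->
    P (fun x => a x * a' x + b x * b' x + (c x * c' x + d x * d' x)).
  by move=> *; do !apply: fa_D => //; apply: fa_M.
split.
- apply: fun_ext (Q _ _ _ _ _ _ _ _ f0 f1 f2 f3 g0 g1 g2 g3) _ => x.
  by case: (f x) (g x) => [[? ?] [? ?]] [[? ?] [? ?]].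
- apply: fun_ext (S _ _ _ _ _ _ _ _ f0 f1 f2 f3 g1 g0 g3 g2) _ => x.
  by case: (f x) (g x) => [[? ?] [? ?]] [[? ?] [? ?]].
- apply: fun_ext (U _ _ _ _ _ _ _ _ f0 f1 f2 f3 g2 g3 g0 g1) _ => x.
  by case: (f x) (g x) => [[? ?] [? ?]] [[? ?] [? ?]].
- apply: fun_ext (W _ _ _ _ _ _ _ _ f0 f1 f2 f3 g3 g2 g1 g0) _ => x.
  by case: (f x) (g x) => [[? ?] [? ?]] [[? ?] [? ?]].
Qed.

Lemma bc_funN f : bc_fun P f -> bc_fun P (fun x => - f x).
Proof.
by move=> Pf; apply: bc_fun_ext (bc_funM (bc_fun_cst (-1)) Pf) _ => x; rewrite mulN1r.
Qed.

Lemma bc_funB f g : bc_fun P f -> bc_fun P g -> bc_fun P (fun x => f x - g x).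
Proof. by move=> Pf Pg; exact (bc_funD Pf (bc_funN Pg)). Qed.

Lemma bc_funX f k : bc_fun P f -> bc_fun P (fun x => f x ^+ k).
Proof.
move=> Pf; elim: k => [|k IH]; first exact: bc_fun_cst.
by apply: bc_fun_ext (bc_funM Pf IH) _ => x; rewrite exprS.
Qed.

Lemma bc_fun_star f : bc_fun P f -> bc_fun P (fun x => bc_star (f x)).
Proof.
move=> [f0 f1 f2 f3]; split;
  [apply: fun_ext f0 _|apply: fun_ext (fa_N f1) _|
   apply: fun_ext f2 _|apply: fun_ext (fa_N f3) _] => x;
  by case: (f x) => [[? ?] [? ?]].
Qed.

Lemma bc_fun_re f : bc_fun P f -> P (fun x => bc_re (f x)).
Proof. by case. Qed.

Lemma bc_fun_of_Rx (f : T -> R[i]) : cx_fun P f -> bc_fun P (fun x => of_Rx (f x)).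
Proof. by move=> [f0 f1]; split => //; exact: fa_cst. Qed.

Lemma bc_fun_of_real (f : T -> R) : P f -> bc_fun P (fun x => of_Rx (f x)%:C).
Proof. by move=> Pf; apply: bc_fun_of_Rx; split=> //; exact: fa_cst. Qed.

Lemma bc_fun_to_Rx f : bc_fun P f -> cx_fun P (fun x => to_Rx (f x)).
Proof. by case. Qed.

Lemma bc_fun_adj f : bc_fun P f -> bc_fun P (fun x => bc_adj (f x)).
Proof.
move=> [f0 f1 f2 f3].
have X : bc_fun P (fun x => @Complex R[i] (complex.Re (f x)) (- complex.Im (f x))).
  split; [exact: f0|exact: f1|apply: fun_ext (fa_N f2) _|apply: fun_ext (fa_N f3) _] => x;
  by case: (f x) => [[? ?] [? ?]].
apply: bc_fun_ext (bc_funM X (bc_fun_star (bc_funM (And4 f0 f1 f2 f3) X))) _ => x.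
case: (f x) => [[a b] [c d]]; rewrite /bc_adj /bc_star /= ?expr2 /=.
by congr (@Complex R[i] (@Complex R _ _) (@Complex R _ _)); ring.
Qed.

Lemma bc_fun_norm f : bc_fun P f -> P (fun x => bc_norm (f x)).
Proof.
move=> Pf; have [H _ _ _] := bc_funM Pf (bc_fun_adj Pf).
by apply: fun_ext H _ => x; rewrite bc_mul_adj.
Qed.

Lemma bc_fun_inv f : P (fun x => (bc_norm (f x))^-1) -> bc_fun P f ->
  bc_fun P (fun x => bc_inv (f x)).
Proof. by move=> Pn Pf; exact (bc_funM (bc_fun_of_real Pn) (bc_fun_adj Pf)). Qed.

Lemma bc_fun_sum (I : Type) (r : seq I) (F : I -> T -> B) :
  (forall i, bc_fun P (F i)) -> bc_fun P (fun x => \sum_(i <- r) F i x).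
Proof.
move=> PF; elim: r => [|i r IH].
  by apply: bc_fun_ext (bc_fun_cst 0) _ => x; rewrite big_nil.
by apply: bc_fun_ext (bc_funD (PF i) IH) _ => x; rewrite big_cons.
Qed.

Lemma fa_sum (I : Type) (r : seq I) (F : I -> T -> R) :
  (forall i, P (F i)) -> P (fun x => \sum_(i <- r) F i x).
Proof.
move=> PF; elim: r => [|i r IH].
  by apply: fun_ext (fa_cst aP 0) _ => x; rewrite big_nil.
by apply: fun_ext (fa_D aP (PF i) IH) _ => x; rewrite big_cons.
Qed.

Lemma fa_prod (I : Type) (r : seq I) (F : I -> T -> R) :
  (forall i, P (F i)) -> P (fun x => \prod_(i <- r) F i x).
Proof.
move=> PF; elim: r => [|i r IH].
  by apply: fun_ext (fa_cst aP 1) _ => x; rewrite big_nil.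
by apply: fun_ext (fa_M aP (PF i) IH) _ => x; rewrite big_cons.
Qed.

Lemma fa_det k (A : T -> 'M[R]_k) : (forall i j, P (fun x => A x i j)) ->
  P (fun x => \det (A x)).
Proof.
move=> PA; apply: fa_sum => s; apply: fa_M => //; first exact: fa_cst.
by apply: fa_prod => i.
Qed.

Lemma fa_adj k (A : T -> 'M[R]_k) i j : (forall i j, P (fun x => A x i j)) ->
  P (fun x => \adj (A x) i j).
Proof.
move=> PA; apply: (@fun_ext (fun x => (-1) ^+ (j + i) *
   \det (row' j (col' i (A x))))); last by move=> x; rewrite !mxE.
apply: fa_M => //; first exact: fa_cst.
by apply: fa_det => a b; apply: fun_ext (PA _ _) _ => x; rewrite !mxE.
Qed.

Section Mx.
Variables p q : nat.

Lemma mx_fun_cst (a : 'M[B]_(p, q)) : mx_fun P (fun=> a).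
Proof. by move=> i j; exact: bc_fun_cst. Qed.

Lemma mx_funD (f g : T -> 'M[B]_(p, q)) : mx_fun P f -> mx_fun P g -> mx_fun P (fun x => f x + g x).
Proof. by move=> Pf Pg i j; apply: bc_fun_ext (bc_funD (Pf i j) (Pg i j)) _ => x; rewrite mxE. Qed.

Lemma mx_funN (f : T -> 'M[B]_(p, q)) : mx_fun P f -> mx_fun P (fun x => - f x).
Proof. by move=> Pf i j; apply: bc_fun_ext (bc_funN (Pf i j)) _ => x; rewrite mxE. Qed.

Lemma mx_funB (f g : T -> 'M[B]_(p, q)) : mx_fun P f -> mx_fun P g -> mx_fun P (fun x => f x - g x).
Proof. by move=> Pf Pg; exact (mx_funD Pf (mx_funN Pg)). Qed.

Lemma mx_funZ b (f : T -> 'M[B]_(p, q)) : bc_fun P b -> mx_fun P f -> mx_fun P (fun x => b x *: f x).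
Proof. by move=> Pb Pf i j; apply: bc_fun_ext (bc_funM Pb (Pf i j)) _ => x; rewrite mxE. Qed.

Lemma mx_funM r (f : T -> 'M[B]_(p, q)) (g : T -> 'M[B]_(q, r)) :
  mx_fun P f -> mx_fun P g -> mx_fun P (fun x => f x *m g x).
Proof.
move=> Pf Pg i j.
apply: bc_fun_ext (bc_fun_sum (index_enum _) (fun k => bc_funM (Pf i k) (Pg k j))) _ => x.
by rewrite mxE.
Qed.

End Mx.

Lemma mx_fun_tr n (f : T -> 'M[B]_n) : mx_fun P f -> bc_fun P (fun x => \tr (f x)).
Proof. by move=> Pf; exact: bc_fun_sum (fun i => Pf i i). Qed.

Lemma mx_fun_dagger n (f : T -> 'M[B]_n) : mx_fun P f -> mx_fun P (fun x => dagger (f x)).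
Proof. by move=> Pf i j; apply: bc_fun_ext (bc_fun_star (Pf j i)) _ => x; rewrite !mxE. Qed.

End FunAlg.

Section Smooth.
Variables (R : realType) (m : nat) (U : set 'rV[R]_m) (oU : open U).

Lemma smooth_fun_alg : fun_alg (fun f : 'rV[R]_m -> R => smooth_on U (f : _ -> R^o)).
Proof.
by split=> [c|f g|f g]; [exact: smooth_on_cst|exact: smooth_onD|exact: smooth_onM].
Qed.

End Smooth.

Section Der.
Variables (R : realType) (m : nat) (u v : 'rV[R]_m).
Local Notation V := 'rV[R]_m.
Local Notation B := (bicomplex R).

(** The calculus of bicomplex derivatives is likewise reduced to the four real
    components: [bder] and [mder] say that the derivative at u along v is d. *)
Definition rder (f : V -> R) (d : R) := is_derive u v (f : V -> R^o) d.

Definition bder (f : V -> B) (d : B) :=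
  [/\ rder (fun x => bc0 (f x)) (bc0 d), rder (fun x => bc1 (f x)) (bc1 d),
      rder (fun x => bc2 (f x)) (bc2 d) & rder (fun x => bc3 (f x)) (bc3 d)].

Definition mder p q (f : V -> 'M[B]_(p, q)) (d : 'M[B]_(p, q)) :=
  forall i j, bder (fun x => f x i j) (d i j).

Lemma rder_uniq f d e : rder f d -> rder f e -> d = e.
Proof. by move=> [_ <-] [_ <-]. Qed.

Lemma rder_cst c : rder (fun=> c) 0.
Proof. exact: is_derive_cst. Qed.

Lemma rderD f g d e : rder f d -> rder g e -> rder (fun x => f x + g x) (d + e).
Proof. exact: is_deriveD. Qed.

Lemma rderN f d : rder f d -> rder (fun x => - f x) (- d).
Proof. exact: is_deriveN. Qed.

Lemma rderM f g d e : rder f d -> rder g e ->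
  rder (fun x => f x * g x) (f u * e + g u * d).
Proof. exact: is_deriveM. Qed.

Lemma rder_ext f g d e : rder f d -> (forall x, f x = g x) -> d = e -> rder g e.
Proof. by move=> Df fg <-; rewrite -(funext fg). Qed.

Lemma bder_ext f g d e : bder f d -> (forall x, f x = g x) -> d = e -> bder g e.
Proof. by move=> Df fg <-; rewrite -(funext fg). Qed.

Lemma bder_uniq f d e : bder f d -> bder f e -> d = e.
Proof.
case: d e => [[? ?] [? ?]] [[? ?] [? ?]] [/= a b c d] [a' b' c' d'].
rewrite (rder_uniq a a') (rder_uniq b b') (rder_uniq c c').
by rewrite (rder_uniq d d').
Qed.

Lemma bder_cst b : bder (fun=> b) 0.
Proof. by split; exact: rder_cst. Qed.

Lemma bderD f g d e : bder f d -> bder g e -> bder (fun x => f x + g x) (d + e).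
Proof.
move=> [f0 f1 f2 f3] [g0 g1 g2 g3]; split;
  [apply: rder_ext (rderD f0 g0) _ _|apply: rder_ext (rderD f1 g1) _ _|
   apply: rder_ext (rderD f2 g2) _ _|apply: rder_ext (rderD f3 g3) _ _];
  first [by move=> x; case: (f x) (g x) => [[? ?] [? ?]] [[? ?] [? ?]]
        |by case: (d) (e) => [[? ?] [? ?]] [[? ?] [? ?]]].
Qed.

Lemma bderN f d : bder f d -> bder (fun x => - f x) (- d).
Proof.
move=> [f0 f1 f2 f3]; split;
  [apply: rder_ext (rderN f0) _ _|apply: rder_ext (rderN f1) _ _|
   apply: rder_ext (rderN f2) _ _|apply: rder_ext (rderN f3) _ _];
  first [by move=> x; case: (f x) => [[? ?] [? ?]]|by case: (d) => [[? ?] [? ?]]].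
Qed.

Lemma bder_star f d : bder f d -> bder (fun x => bc_star (f x)) (bc_star d).
Proof.
move=> [f0 f1 f2 f3]; split;
  [apply: rder_ext f0 _ _|apply: rder_ext (rderN f1) _ _|
   apply: rder_ext f2 _ _|apply: rder_ext (rderN f3) _ _];
  first [by move=> x; case: (f x) => [[? ?] [? ?]]|by case: (d) => [[? ?] [? ?]]].
Qed.

Lemma bderM f g d e : bder f d -> bder g e ->
  bder (fun x => f x * g x) (d * g u + f u * e).
Proof.
move=> [f0 f1 f2 f3] [g0 g1 g2 g3].
split.
- apply: rder_ext (rderD (rderD (rderM f0 g0) (rderN (rderM f1 g1)))
    (rderN (rderD (rderM f2 g2) (rderN (rderM f3 g3))))) _ _ => [x|].
    by case: (f x) (g x) => [[? ?] [? ?]] [[? ?] [? ?]].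
  by case: (f u) (g u) (d) (e) => [[? ?] [? ?]] [[? ?] [? ?]] [[? ?] [? ?]] [[? ?] [? ?]] /=; ring.
- apply: rder_ext (rderD (rderD (rderM f0 g1) (rderM f1 g0))
    (rderN (rderD (rderM f2 g3) (rderM f3 g2)))) _ _ => [x|].
    by case: (f x) (g x) => [[? ?] [? ?]] [[? ?] [? ?]].
  by case: (f u) (g u) (d) (e) => [[? ?] [? ?]] [[? ?] [? ?]] [[? ?] [? ?]] [[? ?] [? ?]] /=; ring.
- apply: rder_ext (rderD (rderD (rderM f0 g2) (rderN (rderM f1 g3)))
    (rderD (rderM f2 g0) (rderN (rderM f3 g1)))) _ _ => [x|].
    by case: (f x) (g x) => [[? ?] [? ?]] [[? ?] [? ?]].
  by case: (f u) (g u) (d) (e) => [[? ?] [? ?]] [[? ?] [? ?]] [[? ?] [? ?]] [[? ?] [? ?]] /=; ring.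
- apply: rder_ext (rderD (rderD (rderM f0 g3) (rderM f1 g2))
    (rderD (rderM f2 g1) (rderM f3 g0))) _ _ => [x|].
    by case: (f x) (g x) => [[? ?] [? ?]] [[? ?] [? ?]].
  by case: (f u) (g u) (d) (e) => [[? ?] [? ?]] [[? ?] [? ?]] [[? ?] [? ?]] [[? ?] [? ?]] /=; ring.
Qed.

Lemma bder_re f d : bder f d -> rder (fun x => bc_re (f x)) (bc_re d).
Proof. by case. Qed.

Lemma bder_sum (I : Type) (r : seq I) (F : I -> V -> B) (d : I -> B) :
  (forall i, bder (F i) (d i)) ->
  bder (fun x => \sum_(i <- r) F i x) (\sum_(i <- r) d i).
Proof.
move=> DF; elim: r => [|i r IH].
  by apply: bder_ext (bder_cst 0) _ _ => [x|]; rewrite big_nil.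
by apply: bder_ext (bderD (DF i) IH) _ _ => [x|]; rewrite big_cons.
Qed.

Section Mx.
Variables p q : nat.
Implicit Types f g : V -> 'M[B]_(p, q).

Lemma mder_ext f g d e : mder f d -> (forall x, f x = g x) -> d = e -> mder g e.
Proof. by move=> Df fg <-; rewrite -(funext fg). Qed.

Lemma mder_uniq f d e : mder f d -> mder f e -> d = e.
Proof.
by move=> Df Ef; apply/matrixP => i j; exact: bder_uniq (Df i j) (Ef i j).
Qed.

Lemma mder_cst (a : 'M[B]_(p, q)) : mder (fun=> a) 0.
Proof. by move=> i j; apply: bder_ext (bder_cst (a i j)) _ _ => //; rewrite mxE. Qed.

Lemma mderD f g d e : mder f d -> mder g e -> mder (fun x => f x + g x) (d + e).
Proof.
by move=> Df Dg i j; apply: bder_ext (bderD (Df i j) (Dg i j)) _ _ => [x|]; rewrite mxE.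
Qed.

Lemma mderN f d : mder f d -> mder (fun x => - f x) (- d).
Proof. by move=> Df i j; apply: bder_ext (bderN (Df i j)) _ _ => [x|]; rewrite mxE. Qed.

Lemma mderB f g d e : mder f d -> mder g e -> mder (fun x => f x - g x) (d - e).
Proof. by move=> Df Dg; exact (mderD Df (mderN Dg)). Qed.

Lemma mderZ b db f d : bder b db -> mder f d ->
  mder (fun x => b x *: f x) (db *: f u + b u *: d).
Proof.
by move=> Db Df i j; apply: bder_ext (bderM Db (Df i j)) _ _ => [x|]; rewrite !mxE.
Qed.

Lemma mderM r f (g : V -> 'M[B]_(q, r)) d e : mder f d -> mder g e ->
  mder (fun x => f x *m g x) (d *m g u + f u *m e).
Proof.
move=> Df Dg i j.
apply: bder_ext (bder_sum (index_enum _) (fun k => bderM (Df i k) (Dg k j))) _ _ => [x|].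
  by rewrite mxE.
by rewrite !mxE -big_split.
Qed.

Lemma mder_sum (I : Type) (r : seq I) (F : I -> V -> 'M[B]_(p, q)) d :
  (forall i, mder (F i) (d i)) ->
  mder (fun x => \sum_(i <- r) F i x) (\sum_(i <- r) d i).
Proof.
move=> DF; elim: r => [|i r IH].
  by apply: mder_ext (mder_cst 0) _ _ => [x|]; rewrite big_nil.
by apply: mder_ext (mderD (DF i) IH) _ _ => [x|]; rewrite big_cons.
Qed.

End Mx.

Lemma mder_tr n (f : V -> 'M[B]_n) d : mder f d -> bder (fun x => \tr (f x)) (\tr d).
Proof. by move=> Df; exact: bder_sum (fun i => Df i i). Qed.

Lemma mder_dagger n (f : V -> 'M[B]_n) d : mder f d ->
  mder (fun x => dagger (f x)) (dagger d).
Proof.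
by move=> Df i j; apply: bder_ext (bder_star (Df j i)) _ _ => [x|]; rewrite !mxE.
Qed.

Lemma mder_near p q (f g : V -> 'M[B]_(p, q)) d U : open U -> U u ->
  (forall x, U x -> f x = g x) -> mder f d -> mder g d.
Proof.
move=> oU Uu fg Df i j; have [D0 D1 D2 D3] := Df i j.
by split; [apply: near_eq_is_derive D0|apply: near_eq_is_derive D1
          |apply: near_eq_is_derive D2|apply: near_eq_is_derive D3];
  apply: open_near_eq oU Uu _ => x /fg ->.
Qed.

Lemma bder_near (f g : V -> B) d U : open U -> U u ->
  (forall x, U x -> f x = g x) -> bder f d -> bder g d.
Proof.
move=> oU Uu fg [D0 D1 D2 D3].
by split; [apply: near_eq_is_derive D0|apply: near_eq_is_derive D1
          |apply: near_eq_is_derive D2|apply: near_eq_is_derive D3];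
  apply: open_near_eq oU Uu _ => x /fg ->.
Qed.

End Der.

(** * Coordinates and parametrizations *)

Section Coords.
Variables (R : realType) (E : vectType R).
Local Notation N := (\dim {:E}).

Lemma coordsK (p : E) : of_coords (coords p) = p.
Proof. by rewrite /coords /of_coords passmx.rVofK // vbasisP. Qed.

Lemma of_coordsK (w : 'rV[R]_N) : coords (@of_coords R E w) = w.
Proof. by rewrite /coords /of_coords passmx.vecofK // vbasisP. Qed.

Lemma coords_linear : linear (@coords R E).
Proof. exact: passmx.rVof_linear. Qed.

HB.instance Definition _ := GRing.isLinear.Build R E 'rV[R]_N _ _ coords_linear.

Lemma of_coords_linear : linear (@of_coords R E).
Proof.
by move=> r x y; apply: (can_inj coordsK); rewrite coords_linear !of_coordsK.
Qed.

HB.instance Definition _ := GRing.isLinear.Build R 'rV[R]_N E _ _ of_coords_linear.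

(** A linear form on E, written in the fixed coordinates. *)
Definition functional_row (l : E -> R) (w : 'rV[R]_N) : R^o :=
  \sum_k w 0 k * l (@of_coords R E (delta_mx 0 k)).

Lemma functionalE (l : {linear E -> R^o}) (p : E) :
  l p = functional_row l (coords p).
Proof.
rewrite -{1}(coordsK p) {1}(row_sum_delta (coords p)).
rewrite (linear_sum (@of_coords R E)) (linear_sum l).
by apply: eq_bigr => k _; rewrite (linearZZ (@of_coords R E)) (linearZZ l).
Qed.

Section Param.
Variables (m : nat) (phi : 'rV[R]_m -> E).

(** The differential of phi at u. *)
Definition dparam (u v : 'rV[R]_m) : E := @of_coords R E ('D_v (@coords R E \o phi) u).

Lemma tnth_frame u j : tnth (frame phi u) j = dparam u (delta_mx 0 j).
Proof. by rewrite tnth_mktuple. Qed.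

Lemma rder_functional (l : {linear E -> R^o}) u v :
  differentiable (@coords R E \o phi) u ->
  rder u v (fun x => l (phi x)) (l (dparam u v)).
Proof.
move=> d.
have dk k : is_derive u v (fun x => coords (phi x) 0 k : R^o)
   ('D_v (@coords R E \o phi) u 0 k).
  have dd : derivable (@coords R E \o phi) u v by exact: diff_derivable.
  split; first by move/derivable_mxP: dd => /(_ 0 k).
  by rewrite derive_mx // mxE.
rewrite functionalE /dparam of_coordsK /functional_row.
have : rder u v (fun x => \sum_k coords (phi x) 0 k * l (@of_coords R E (delta_mx 0 k)))
  (\sum_k 'D_v (@coords R E \o phi) u 0 k * l (@of_coords R E (delta_mx 0 k))).
  elim: (index_enum _) => [|k s IH].
    by apply: rder_ext (rder_cst _ _ 0) _ _ => [x|]; rewrite big_nil.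
  apply: rder_ext (rderD (rderM (dk k) (rder_cst u v (l (@of_coords R E (delta_mx 0 k))))) IH) _ _ => [x|].
    by rewrite big_cons.
  by rewrite big_cons mulr0 add0r [X in X + _]mulrC.
by move=> h; apply: rder_ext h _ _ => // x; rewrite functionalE.
Qed.

Lemma smooth_functional (l : {linear E -> R^o}) U : open U ->
  smooth_on U (@coords R E \o phi) -> smooth_on U (fun x => l (phi x) : R^o).
Proof.
move=> oU /(smooth_on_mxP _ oU) s; have aP := smooth_fun_alg oU.
have := fa_sum aP (index_enum _) (fun k => fa_M aP (s 0 k)
  (fa_cst aP (l (@of_coords R E (delta_mx 0 k))))).
by move=> h; apply: fun_ext h _ => x; rewrite functionalE.
Qed.

(** Smoothness can be tested on linear forms, in particular on the real
    components of points of the ambient space. *)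
Lemma smooth_coords U : open U ->
  (forall l : {linear E -> R^o}, smooth_on U (fun x => l (phi x) : R^o)) ->
  smooth_on U (@coords R E \o phi).
Proof.
move=> oU h; apply/smooth_on_mxP => // i j; rewrite (ord1 i).
have lin : linear (fun p : E => coords p 0 j : R^o).
  by move=> a x y; rewrite coords_linear !mxE.
exact: (h (HB.pack (fun p : E => coords p 0 j : R^o) (GRing.isLinear.Build _ _ _ _ _ lin))).
Qed.

Lemma dparam_sum u v : differentiable (@coords R E \o phi) u ->
  dparam u v = \sum_j v 0 j *: tnth (frame phi u) j.
Proof.
move=> d; rewrite /dparam derive_dir_sum // linear_sum.
by apply: eq_bigr => j _; rewrite linearZ tnth_frame.
Qed.

Lemma dparam_linear u : differentiable (@coords R E \o phi) u -> linear (dparam u).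
Proof.
move=> d r x y; rewrite /dparam derive_dirD // linearP.
by [].
Qed.

Lemma span_frameP u a : differentiable (@coords R E \o phi) u ->
  a \in <<frame phi u>>%VS <-> exists v, a = dparam u v.
Proof.
move=> d; split=> [/coord_span ->|[v ->]].
  exists (\row_j coord (frame phi u) j a); rewrite dparam_sum //.
  by apply: eq_bigr => j _; rewrite mxE (tnth_nth 0).
rewrite dparam_sum //; apply: memv_suml => j _; apply: memvZ; apply: memv_span.
exact: mem_tnth.
Qed.

Lemma free_frameP u : differentiable (@coords R E \o phi) u ->
  free (frame phi u) <-> forall v, dparam u v = 0 -> v = 0.
Proof.
move=> d; split=> [/freeP fr v|h].
  rewrite dparam_sum // => e; apply/rowP => j; rewrite mxE.
  by apply: (fr (fun j => v 0 j)); rewrite -[RHS]e; apply: eq_bigr => i _; rewrite (tnth_nth 0).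
apply/freeP => k e i; have := h (\row_j k j).
rewrite dparam_sum // -[X in _ = X -> _]e => /(_ _)/rowP/(_ i).
rewrite !mxE; apply; apply: eq_bigr => j _.
by rewrite mxE (tnth_nth 0).
Qed.

End Param.

Lemma smooth_id m (U : set 'rV[R]_m) : open U -> smooth_on U (@id 'rV[R]_m).
Proof.
move=> oU; apply/smooth_onP => -[|k]; first by move=> [|//] _ u _; exact: ex_diff.
apply/smooth_uptoSP; split=> [u _|v]; first exact: ex_diff.
by apply: smooth_upto_ext (smooth_upto_cst v oU) => // u _; rewrite derive_id.
Qed.

Lemma smooth_of_coords (U : set 'rV[R]_N) : open U ->
  smooth_on U (@coords R E \o @of_coords R E).
Proof.
move=> oU; apply: smooth_on_ext (smooth_id oU) => // u _.
by rewrite /= of_coordsK.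
Qed.

End Coords.

Section Ambient.
Variables (R : realType) (n : nat).
Local Notation B := (bicomplex R).
Local Notation E := (ambient R n).

Lemma ambientZ1 (r : R) (p : E) : (r *: p).1 = of_Rx r%:C *: p.1.
Proof. by []. Qed.
Lemma ambientZ2 (r : R) (p : E) : (r *: p).2 = r%:C * p.2.
Proof. by []. Qed.
Lemma ambientD1 (p p' : E) : (p + p').1 = p.1 + p'.1.
Proof. by []. Qed.
Lemma ambientD2 (p p' : E) : (p + p').2 = p.2 + p'.2.
Proof. by []. Qed.
Lemma ambient_sum1 I (r : seq I) (F : I -> E) : (\sum_(i <- r) F i).1 = \sum_(i <- r) (F i).1.
Proof. by elim: r => [|i r IH]; rewrite ?big_nil // !big_cons ambientD1 IH. Qed.
Lemma ambient_sum2 I (r : seq I) (F : I -> E) : (\sum_(i <- r) F i).2 = \sum_(i <- r) (F i).2.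
Proof. by elim: r => [|i r IH]; rewrite ?big_nil // !big_cons ambientD2 IH. Qed.

(** The real coordinates of a point, each declared to be a linear form. *)
Definition comp0 i j (p : E) : R^o := bc0 (p.1 i j).
Lemma comp0_linear i j : linear (comp0 i j).
Proof.
move=> r [q s] [q' s']; rewrite /comp0 /= !mxE.
by case: (q i j) (q' i j) => [[? ?] [? ?]] [[? ?] [? ?]] /=; rewrite !(mul0r, subr0, addr0, oppr0).
Qed.
Definition comp1 i j (p : E) : R^o := bc1 (p.1 i j).
Lemma comp1_linear i j : linear (comp1 i j).
Proof.
move=> r [q s] [q' s']; rewrite /comp1 /= !mxE.
by case: (q i j) (q' i j) => [[? ?] [? ?]] [[? ?] [? ?]] /=; rewrite !(mul0r, subr0, addr0, oppr0).
Qed.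
Definition comp2 i j (p : E) : R^o := bc2 (p.1 i j).
Lemma comp2_linear i j : linear (comp2 i j).
Proof.
move=> r [q s] [q' s']; rewrite /comp2 /= !mxE.
by case: (q i j) (q' i j) => [[? ?] [? ?]] [[? ?] [? ?]] /=; rewrite !(mul0r, subr0, addr0, oppr0).
Qed.
Definition comp3 i j (p : E) : R^o := bc3 (p.1 i j).
Lemma comp3_linear i j : linear (comp3 i j).
Proof.
move=> r [q s] [q' s']; rewrite /comp3 /= !mxE.
by case: (q i j) (q' i j) => [[? ?] [? ?]] [[? ?] [? ?]] /=; rewrite !(mul0r, subr0, addr0, oppr0).
Qed.
Definition comp_z_re (p : E) : R^o := complex.Re p.2.
Lemma comp_z_re_linear : linear comp_z_re.
Proof. by move=> r [q [s t]] [q' [s' t']]; rewrite /comp_z_re /= !(mul0r, subr0). Qed.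
Definition comp_z_im (p : E) : R^o := complex.Im p.2.
Lemma comp_z_im_linear : linear comp_z_im.
Proof. by move=> r [q [s t]] [q' [s' t']]; rewrite /comp_z_im /= !(mul0r, addr0). Qed.

HB.instance Definition _ i j := GRing.isLinear.Build R E R^o _ (comp0 i j) (comp0_linear i j).
HB.instance Definition _ i j := GRing.isLinear.Build R E R^o _ (comp1 i j) (comp1_linear i j).
HB.instance Definition _ i j := GRing.isLinear.Build R E R^o _ (comp2 i j) (comp2_linear i j).
HB.instance Definition _ i j := GRing.isLinear.Build R E R^o _ (comp3 i j) (comp3_linear i j).
HB.instance Definition _ := GRing.isLinear.Build R E R^o _ comp_z_re comp_z_re_linear.
HB.instance Definition _ := GRing.isLinear.Build R E R^o _ comp_z_im comp_z_im_linear.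

Section Param.
Variables (m : nat) (phi : 'rV[R]_m -> E).

Lemma mder_param u v : differentiable (@coords R E \o phi) u ->
  mder u v (fun x => (phi x).1) (dparam phi u v).1.
Proof.
move=> d i j; split.
- exact: (rder_functional (comp0 i j) v d).
- exact: (rder_functional (comp1 i j) v d).
- exact: (rder_functional (comp2 i j) v d).
- exact: (rder_functional (comp3 i j) v d).
Qed.

Lemma bder_param u v : differentiable (@coords R E \o phi) u ->
  bder u v (fun x => of_Rx (phi x).2) (of_Rx (dparam phi u v).2).
Proof.
move=> d; split; try exact: rder_cst.
- exact: (rder_functional comp_z_re v d).
- exact: (rder_functional comp_z_im v d).
Qed.

Section Smooth.
Variables (U : set 'rV[R]_m) (oU : open U).
Let P (f : 'rV[R]_m -> R) := smooth_on U (f : _ -> R^o).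

Lemma mx_fun_param : smooth_on U (@coords R E \o phi) -> mx_fun P (fun x => (phi x).1).
Proof.
move=> s i j; split.
- exact: (smooth_functional (comp0 i j) oU s).
- exact: (smooth_functional (comp1 i j) oU s).
- exact: (smooth_functional (comp2 i j) oU s).
- exact: (smooth_functional (comp3 i j) oU s).
Qed.

Lemma cx_fun_param : smooth_on U (@coords R E \o phi) -> cx_fun P (fun x => (phi x).2).
Proof.
move=> s; split.
- exact: (smooth_functional comp_z_re oU s).
- exact: (smooth_functional comp_z_im oU s).
Qed.

(** Together with the vectors of the second factor, the images of 1, i, x and
    ix under these maps span the ambient space over R. *)
Definition entry_vec (b : B) (i j : 'I_n) : E := (b *: delta_mx i j, 0).

Lemma bc_decomp (b : B) : b = of_Rx (bc0 b)%:C * 1 + of_Rx (bc1 b)%:C * bc_i R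
  + of_Rx (bc2 b)%:C * (@Complex R[i] 0 1)
  + of_Rx (bc3 b)%:C * (@Complex R[i] 0 (Complex 0 1)).
Proof.
have e (x y z w : R) : x = z -> y = w -> x +i* y = z +i* w by move=> -> ->.
have f (x y z w : R[i]) : x = z -> y = w -> @Complex R[i] x y = Complex z w by move=> -> ->.
case: b => [[? ?] [? ?]]; apply: f; apply: e; rewrite /=; ring.
Qed.

Definition entry_sum (b : B) (i j : 'I_n) : E :=
  bc0 b *: entry_vec 1 i j + bc1 b *: entry_vec (bc_i R) i j
  + bc2 b *: entry_vec (@Complex R[i] 0 1) i j
  + bc3 b *: entry_vec (@Complex R[i] 0 (Complex 0 1)) i j.

Lemma entry_sumE b i j : entry_sum b i j = (b *: delta_mx i j, 0).
Proof.
have e (r : R) (b' : B) : r *: entry_vec b' i j = ((of_Rx r%:C * b') *: delta_mx i j, 0).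
  by congr (_, _); rewrite /= ?mulr0 // scalerA.
have d (b1 b2 : B) : (((b1 *: delta_mx i j, 0) : E) + ((b2 *: delta_mx i j, 0) : E))
    = ((b1 + b2) *: delta_mx i j, 0) :> E.
  by congr (_, _); rewrite /= ?addr0 // -scalerDl.
by rewrite /entry_sum !e !d -bc_decomp.
Qed.

Lemma ambient_decomp (p : E) : p =
  \sum_i \sum_j entry_sum (p.1 i j) i j
  + (complex.Re p.2 *: ((0, 1) : E) + complex.Im p.2 *: ((0, Complex 0 1) : E)).
Proof.
case: p => q [s t].
have -> : \sum_i \sum_j entry_sum ((q, s +i* t).1 i j) i j = ((q, 0) : E).
  set X := \sum_i _; have X1 : X.1 = q.
    rewrite /X ambient_sum1 [RHS]matrix_sum_delta; apply: eq_bigr => i _.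
    by rewrite ambient_sum1; apply: eq_bigr => j _; rewrite entry_sumE.
  have X2 : X.2 = 0.
    rewrite /X ambient_sum2 big1 // => i _; rewrite ambient_sum2 big1 // => j _.
    by rewrite entry_sumE.
  by rewrite -X1 -X2; case: (X).
have e (a b c d : R) : a = c -> b = d -> a +i* b = c +i* d by move=> -> ->.
have pe (a b : 'M[B]_n) (c d : R[i]) : a = b -> c = d -> (a, c) = (b, d) by move=> -> ->.
apply: pe; first by rewrite /= !scaler0 !addr0.
by apply: e; rewrite /=; ring.
Qed.

Lemma smooth_param : mx_fun P (fun x => (phi x).1) -> cx_fun P (fun x => (phi x).2) ->
  smooth_on U (@coords R E \o phi).
Proof.
move=> Pq [P4 P5]; have aP : fun_alg P := smooth_fun_alg oU.
apply: smooth_coords => // l.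
have PZ (f : 'rV[R]_m -> R) (e : E) : P f -> P (fun x => l (f x *: e)).
  move=> Pf; apply: fun_ext (fa_M aP Pf (fa_cst aP (l e))) _ => x.
  by rewrite linearZ.
have PD (f g : 'rV[R]_m -> E) : P (fun x => l (f x)) -> P (fun x => l (g x)) ->
    P (fun x => l (f x + g x)).
  by move=> Pf Pg; apply: fun_ext (fa_D aP Pf Pg) _ => x; rewrite linearD.
have PS (I : Type) (r : seq I) (F : I -> 'rV[R]_m -> E) :
    (forall i, P (fun x => l (F i x))) -> P (fun x => l (\sum_(i <- r) F i x)).
  by move=> PF; apply: fun_ext (fa_sum aP r PF) _ => x; rewrite linear_sum.
have : P (fun x => l (\sum_i \sum_j entry_sum ((phi x).1 i j) i j
  + (complex.Re (phi x).2 *: ((0, 1) : E) + complex.Im (phi x).2 *: ((0, Complex 0 1) : E)))).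
  apply: (PD (fun x => \sum_i \sum_j entry_sum ((phi x).1 i j) i j)); last first.
    by apply: (PD (fun x => complex.Re (phi x).2 *: ((0, 1) : E))); exact: PZ.
  apply: (PS) => i; apply: (PS) => j; have [P0 P1 P2 P3] := Pq i j.
  by apply: (PD _ _ (PD _ _ (PD _ _ (PZ _ _ P0) (PZ _ _ P1)) (PZ _ _ P2)) (PZ _ _ P3)).
by move=> h; apply: fun_ext h _ => x; rewrite -ambient_decomp.
Qed.

End Smooth.
End Param.

End Ambient.

(** * The biquaternion action at a point *)

Section Model.
Variables (R : realType) (n : nat).
Local Notation B := (bicomplex R).
Local Notation E := (ambient R n).
Implicit Types (p : E) (a b c : 'M[B]_n).

(** The constant 1/2 of the definitions of h and I. *)
Definition half : B := of_Rx 2^-1.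

Lemma half2 : half + half = 1.
Proof.
rewrite /half -of_RxD -[RHS](@of_Rx1 R); congr of_Rx.
by field.
Qed.

Lemma star_half : bc_star half = half.
Proof. exact: star_of_Rx. Qed.

Local Notation zz p := (of_Rx p.2).

Local Notation bstar := (@bc_star R : {rmorphism B -> B}).

Lemma h_formE p a b : h_form p a b = hform bstar half (zz p) p.1 a b.
Proof. by []. Qed.

Lemma I_endE p a : I_end p a = Jend bstar half (zz p) p.1 a.
Proof. by []. Qed.

(** The biquaternion s acts as the operator x + y I with x = [bq_scalar] and
    y = [bq_antilin]. *)
Definition bq_scalar (s : biquaternion R) : B :=
  let: (s0, s1, s2, s3) := s in of_Rx s0 + of_Rx s1 * bc_i R.
Definition bq_antilin (s : biquaternion R) : B :=
  let: (s0, s1, s2, s3) := s in of_Rx s2 + of_Rx s3 * bc_i R.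

Lemma bq_actE s p a :
  bq_act_model s p a = act bstar half (zz p) p.1 (bq_scalar s) (bq_antilin s) a.
Proof.
case: s => [[[s0 s1] s2] s3]; rewrite /act -I_endE /bq_scalar /bq_antilin !scalerDl -!scalerA !addrA.
by [].
Qed.

(** Both sides multiply x + y I and x' + y' I by the rule I x = x^* I, I^2 = -1. *)
Lemma bq_mulE s t :
  bq_scalar (bq_mul s t) = bq_scalar s * bq_scalar t - bq_antilin s * bc_star (bq_antilin t)
  /\ bq_antilin (bq_mul s t) = bq_scalar s * bq_antilin t + bq_antilin s * bc_star (bq_scalar t).
Proof.
have sD x y : bc_star (of_Rx x + of_Rx y * bc_i R) = of_Rx x - of_Rx y * bc_i R.
  by rewrite bc_starD (bc_starM (of_Rx y)) !star_of_Rx star_bc_i mulrN.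
case: s t => [[[s0 s1] s2] s3] [[[t0 t1] t2] t3]; rewrite /bq_scalar /bq_antilin !sD /bq_mul.
rewrite !of_RxD !of_RxM.
have oN x : of_Rx (- x) = - of_Rx x by rewrite rmorphN.
rewrite !oN !of_RxM.
have i2 := bc_i2 R.
move: (of_Rx s0) (of_Rx s1) (of_Rx s2) (of_Rx s3) (of_Rx t0) (of_Rx t1) (of_Rx t2) (of_Rx t3).
move: (bc_i R) i2 => i i2 a0 a1 a2 a3 b0 b1 b2 b3.
split; apply/eqP; rewrite -subr_eq0; apply/eqP.
  transitivity ((- a3 * b3 - a1 * b1) * (i * i + 1)); first by ring.
  by rewrite i2 addNr mulr0.
transitivity ((a3 * b1 - a1 * b3) * (i * i + 1)); first by ring.
by rewrite i2 addNr mulr0.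
Qed.

Lemma bq_act_scale (r : R) s t p a :
  bq_act_model (bq_add (bq_scale r%:C s) t) p a =
  of_Rx r%:C *: bq_act_model s p a + bq_act_model t p a.
Proof.
rewrite !bq_actE.
have -> : bq_scalar (bq_add (bq_scale r%:C s) t) = of_Rx r%:C * bq_scalar s + bq_scalar t.
  case: s t => [[[s0 s1] s2] s3] [[[t0 t1] t2] t3].
  rewrite /bq_scalar /bq_add /bq_scale !of_RxD !of_RxM; ring.
have -> : bq_antilin (bq_add (bq_scale r%:C s) t) = of_Rx r%:C * bq_antilin s + bq_antilin t.
  case: s t => [[[s0 s1] s2] s3] [[[t0 t1] t2] t3].
  rewrite /bq_antilin /bq_add /bq_scale !of_RxD !of_RxM; ring.
rewrite /act; move: (bq_scalar s) (bq_scalar t) (bq_antilin s) (bq_antilin t) (of_Rx r%:C) (Jend _ _ _ _ _).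
move=> x x' y y' k J; rewrite !scalerDl scalerDr -!scalerA addrACA.
by [].
Qed.

Lemma bq_act_one p a : bq_act_model (bq_one R) p a = a.
Proof.
rewrite bq_actE /act.
have -> : bq_scalar (bq_one R) = 1 by rewrite /bq_scalar /bq_one of_Rx1 of_Rx0 mul0r addr0.
have -> : bq_antilin (bq_one R) = 0 by rewrite /bq_antilin /bq_one of_Rx0 mul0r addr0.
by rewrite scale1r scale0r addr0.
Qed.

Section OnM.
Variables (p : E) (Mp : M_space R n p).
Local Notation q := p.1.

Lemma M_idem : rank_one_idem q.
Proof. by case: Mp => qq trq _; exact: bc_rank_one. Qed.

Lemma M_zt : zz p ^+ 2 * \tr (dag bstar q *m q) = 1.
Proof. by case: Mp. Qed.

Lemma bq_act_tang s a : tang q a -> tang q (bq_act_model s p a).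
Proof. by move=> ta; rewrite bq_actE; exact: act_tang M_idem _ _ _ ta. Qed.

Lemma bq_act_linear s (r : R) a b :
  bq_act_model s p (of_Rx r%:C *: a + b) =
  of_Rx r%:C *: bq_act_model s p a + bq_act_model s p b.
Proof. by rewrite !bq_actE; apply: act_linear; exact: star_of_Rx. Qed.

Lemma bq_act_mul s t a : tang q a ->
  bq_act_model (bq_mul s t) p a = bq_act_model s p (bq_act_model t p a).
Proof.
move=> ta; rewrite !bq_actE; have [-> ->] := bq_mulE s t; symmetry.
exact: (act_mul (@bc_starK R) half2 star_half (star_of_Rx _) M_idem M_zt).
Qed.

Lemma g_sym a b : bc_re (h_form p a b) = bc_re (h_form p b a).
Proof.
have e : bc_star (h_form p a b) = h_form p b a.
  exact: (h_star (@bc_starK R) q star_half (star_of_Rx p.2) a b).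
by rewrite -e bc_re_star.
Qed.

Lemma g_linear (r : R) a b c : bc_re (h_form p (of_Rx r%:C *: a + b) c) =
  r * bc_re (h_form p a c) + bc_re (h_form p b c).
Proof.
by rewrite !h_formE hDl hZl bc_reD bc_reZ.
Qed.

(** The tangent space is a B-module, so an antilinear form whose real part
    vanishes on it vanishes. *)
Lemma re_nondegenerate (f : 'M[B]_n -> B) :
  (forall x c, f (x *: c) = bc_star x * f c) ->
  (forall c, tang q c -> bc_re (f c) = 0) -> forall c, tang q c -> f c = 0.
Proof.
move=> fZ h c tc; apply: bc_re_nondegenerate => x.
by rewrite -(bc_starK x) -fZ; apply: h; exact: tangZ.
Qed.

Lemma g_nondegenerate a : tang q a ->
  (forall c, tang q c -> bc_re (h_form p a c) = 0) -> a = 0.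
Proof.
move=> ta h.
apply: (h_nondegenerate (@bc_starK R) half2 star_half (star_of_Rx p.2) M_idem M_zt ta).
apply: (re_nondegenerate (f := h_form p a)) => // x c'.
by rewrite h_formE hZr.
Qed.

Lemma scalars_adj (s : R[i]) a b :
  h_form p (bq_act_model (s, 0, 0, 0) p a) b = h_form p a (bq_act_model (s, 0, 0, 0) p b).
Proof.
have e c : bq_act_model (s, 0, 0, 0) p c = of_Rx s *: c.
  by rewrite /bq_act_model of_Rx0 !scale0r !addr0.
by rewrite !e !h_formE hZl hZr /= star_of_Rx.
Qed.

Lemma unit_skew (u v w : R[i]) a b : tang q a -> tang q b ->
  bc_re (h_form p (bq_act_model (0, u, v, w) p a) b) =
  - bc_re (h_form p a (bq_act_model (0, u, v, w) p b)).
Proof.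
move=> ta tb; rewrite !bq_actE !h_formE.
apply: (act_skew (@bc_starK R) half2 star_half (star_of_Rx p.2) M_idem M_zt
  (re := @bc_re R) _ (@bc_re_star R)) => //.
by rewrite /bq_scalar of_Rx0 add0r /= (bc_starM (of_Rx u)) star_of_Rx star_bc_i mulrN.
Qed.

End OnM.
End Model.

(** * The tangent spaces and their dimension *)

Section Tangent.
Variables (R : realType) (n : nat).
Local Notation B := (bicomplex R).
Local Notation E := (ambient R n).
Local Notation M := (M_space R n).
Local Notation zz p := (of_Rx p.2).

Lemma of_Rx_inj : injective (@of_Rx R).
Proof. by move=> x y /(congr1 (@to_Rx R)); rewrite !of_RxK. Qed.

(** The derivative of z in the direction a: the derivative of the equation
    z^2 Tr(q^dagger q) = 1, solved for z. *)
Definition dz (p : E) (a : 'M[B]_n) : B :=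
  - (zz p ^+ 3 * half R * \tr (dagger a *m p.1 + dagger p.1 *m a)).

(** The solutions of the linearized equations of M, identified with the tangent
    space in [tangentP]. *)
Definition tspace (p : E) : set E :=
  [set v | tang p.1 v.1 /\ of_Rx v.2 = dz p v.1].

Lemma tspace_inj p v w : tspace p v -> tspace p w -> v.1 = w.1 -> v = w.
Proof.
case: v w => [a x] [b y] [_ /= ex] [_ /= ey] ab; move: ex; rewrite ab -ey.
by move=> /of_Rx_inj ->.
Qed.

Lemma dzZD p (r : R) a b : dz p (of_Rx r%:C *: a + b) = of_Rx r%:C * dz p a + dz p b.
Proof.
rewrite /dz daggerD daggerZ star_of_Rx mulmxDl mulmxDr -scalemxAl -scalemxAr !mxtraceD.
by rewrite !mxtraceZ; ring.
Qed.

Lemma tspace_lin p (r : R) v w : tspace p v -> tspace p w -> tspace p (r *: v + w).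
Proof.
move=> [tv ev] [tw ew]; split.
  by rewrite ambientD1 ambientZ1; apply: tangD => //; exact: tangZ.
by rewrite ambientD1 ambientZ1 dzZD -ev -ew ambientD2 ambientZ2 of_RxD of_RxM.
Qed.

Lemma solve_dz (K : comNzRingType) (y z t t' k : K) : k + k = 1 -> z ^+ 2 * t = 1 ->
  (y * z + z * y) * t + z ^+ 2 * t' = 0 -> y = - (z ^+ 3 * k * t').
Proof.
move=> k2 zt e; apply/eqP; rewrite -subr_eq0 opprK; apply/eqP.
transitivity (z * k * ((y * z + z * y) * t + z ^+ 2 * t') -
   ((z ^+ 2 * t - 1) * (k + k) * y + (k + k - 1) * y)); first by ring.
by rewrite e zt k2 !subrr !mul0r mulr0 addr0 subr0.
Qed.

Section Param.
Variables (m : nat) (U : set 'rV[R]_m) (phi : 'rV[R]_m -> E).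
Hypothesis lp : local_param M U phi.

Lemma lp_M u : U u -> M (phi u).
Proof.
move=> Uu; have [W [_ e]] := lp_homeo lp (lp_open lp) (@subset_refl _ U).
have : (phi @` U) (phi u) by exists u.
by rewrite e => -[].
Qed.

Lemma lp_diff u : U u -> differentiable (@coords R E \o phi) u.
Proof. by move=> Uu; exact: smooth_on_diff (lp_smooth lp) Uu. Qed.

(** Differentiate the equations of M along a curve in M. *)
Lemma dparam_tspace u v : U u -> tspace (phi u) (dparam phi u v).
Proof.
move=> Uu; have d := lp_diff Uu; have oU := lp_open lp.
have Dq := mder_param v d; have Dz := bder_param v d.
set a := (dparam phi u v).1 in Dq *; set y := (dparam phi u v).2 in Dz *.
have Mu := lp_M Uu.
split.
  have e := mder_near oU Uu _ (mderM Dq Dq).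
  have {}e := mder_uniq (e _ _) Dq; rewrite /tang addrC; apply: e => x Ux.
  by case: (lp_M Ux).
have Dc := bderM (bderM Dz Dz) (mder_tr (mderM (mder_dagger Dq) Dq)).
have {}Dc := bder_near oU Uu _ Dc.
have e := bder_uniq (Dc (fun=> 1) _) (bder_cst u v 1).
apply: (solve_dz (@half2 R) (M_zt Mu)); apply: e => x Ux.
by case: (lp_M Ux).
Qed.

End Param.

Definition tang_defect (q : 'M[B]_n) (v : E) : E := (q *m v.1 + v.1 *m q - v.1, v.2).

Lemma tang_defect_linear q : linear (tang_defect q).
Proof.
move=> r [a x] [b y]; congr (_, _); rewrite /=.
by mxexpand; rewrite -?scalemxAl -?scalemxAr; mxring.
Qed.

HB.instance Definition _ q := GRing.isLinear.Build R E E _ (tang_defect q) (tang_defect_linear q).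

(** The space of a with q a + a q = a, placed in the ambient space so that its
    dimension can be spoken of. *)
Definition tang_vs (q : 'M[B]_n) : {vspace E} := lker (linfun (tang_defect q)).

Lemma mem_tang_vs q v : v \in tang_vs q <-> tang q v.1 /\ v.2 = 0.
Proof.
rewrite memv_ker lfunE; split=> [/eqP[e ->]|[e e2]].
  by split=> //; apply/eqP; rewrite -subr_eq0 e.
by rewrite /= /tang_defect e e2 subrr.
Qed.

Definition conj_by (g g' : 'M[B]_n) (v : E) : E := (g *m v.1 *m g', v.2).

Lemma conj_by_linear g g' : linear (conj_by g g').
Proof.
move=> r [a x] [b y]; congr (_, _); rewrite /=.
by rewrite mulmxDr mulmxDl -scalemxAr -scalemxAl.
Qed.

HB.instance Definition _ g g' := GRing.isLinear.Build R E E _ (conj_by g g') (conj_by_linear g g').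

(** Conjugating by g maps the tangent space at q0 injectively to the one at
    g q0 g^-1. *)
Lemma dim_tang_vs_le q0 q1 : rank_one_idem q0 -> rank_one_idem q1 ->
  (\dim (tang_vs q0) <= \dim (tang_vs q1))%N.
Proof.
move=> r0 r1; have [g [g' [gg' g'g gq]]] := bc_idem_conj r0 r1.
pose f := linfun (conj_by g g').
have k0 : (tang_vs q0 :&: lker f)%VS = 0%VS.
  apply/eqP; rewrite -subv0; apply/subvP => v; rewrite memv_cap => /andP[_].
  rewrite memv_ker lfunE /= => /eqP; rewrite /conj_by => -[e1 e2].
  rewrite memv0; apply/eqP; case: v e1 e2 => a x /= e1 ->; congr (_, _).
  have -> : a = g' *m (g *m a *m g') *m g.
    by rewrite !mulmxA g'g mul1mx -mulmxA g'g mulmx1.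
  by rewrite e1 mulmx0 mul0mx.
rewrite -(limg_dim_eq k0); apply: dimvS; apply/subvP => w /memv_imgP[v v0 ->].
rewrite lfunE /=; have [tv v2] := (mem_tang_vs _ _).1 v0.
apply/mem_tang_vs; split=> //; rewrite /conj_by /tang /=.
rewrite -[in RHS]tv !mulmxA -gq mulmxDr mulmxDl !mulmxA.
congr (_ + _); rewrite -!mulmxA; congr (_ *m (_ *m _)).
by rewrite -[g' *m q1]mulmx1 -gg' mulmxA -(mulmxA g') -gq !mulmxA g'g mul1mx.
Qed.

Lemma dim_tang_vs q0 q1 : rank_one_idem q0 -> rank_one_idem q1 ->
  \dim (tang_vs q0) = \dim (tang_vs q1).
Proof. by move=> r0 r1; apply/eqP; rewrite eqn_leq !dim_tang_vs_le. Qed.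

Lemma tspace0 p : tspace p 0.
Proof.
split; first by rewrite /tang mulmx0 mul0mx addr0.
by rewrite /dz /dag mulmx0 /dagger trmx0 map_mx0 mul0mx addr0 mxtrace0 mulr0 oppr0.
Qed.

(** The first components of the frame are m independent tangent vectors in a
    space of dimension m. *)
Lemma frame_spans m (U : set 'rV[R]_m) (phi : 'rV[R]_m -> E) u a :
  local_param M U phi -> U u -> m = \dim (tang_vs (phi u).1) ->
  tang (phi u).1 a -> exists v, (dparam phi u v).1 = a.
Proof.
move=> lp Uu em ta; have d := lp_diff lp Uu.
pose X := [tuple (((tnth (frame phi u) j).1, 0) : E) | j < m].
have sumX (k : 'I_m -> R) : (\sum_j k j *: X`_j).1 = (dparam phi u (\row_j k j)).1.
  rewrite dparam_sum // !ambient_sum1; apply: eq_bigr => j _.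
  by rewrite -tnth_nth tnth_mktuple mxE.
have frX : free X.
  apply/freeP => k e j; have /freeP fr := lp_immersion lp Uu; apply: (fr k).
  transitivity (dparam phi u (\row_j k j)).
    by rewrite dparam_sum //; apply: eq_bigr => l _; rewrite mxE (tnth_nth 0).
  apply: tspace_inj (dparam_tspace lp _ Uu) (tspace0 _) _.
  by rewrite -sumX e.
have sX : (<<X>> <= tang_vs (phi u).1)%VS.
  apply/span_subvP => x /tnthP[j ->]; rewrite tnth_mktuple; apply/mem_tang_vs; split=> //=.
  by rewrite tnth_frame; have [] := dparam_tspace lp (delta_mx 0 j) Uu.
have bX : basis_of (tang_vs (phi u).1) X by rewrite basisEfree frX sX size_tuple -em leqnn.
have va : ((a, 0) : E) \in tang_vs (phi u).1 by apply/mem_tang_vs.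
exists (\row_j coord X j (a, 0)).
by rewrite -(sumX (fun j => coord X j (a, 0))) -(coord_basis bX va).
Qed.

End Tangent.

(** * Complex square roots and open conditions *)

Section Csqrt.
Variable R : realType.
Implicit Types s x y : R[i].

(** The real part of the principal square root: ((|s| + Re s) / 2)^(1/2). *)
Definition csqrt_re s : R :=
  Num.sqrt ((Num.sqrt (complex.Re s * complex.Re s + complex.Im s * complex.Im s)
    + complex.Re s) * 2^-1).

(** The principal square root on the half plane Re s > 0, where it is smooth. *)
Definition csqrt s : R[i] := csqrt_re s +i* (complex.Im s * (2 * csqrt_re s)^-1).

Lemma csqrt_re_gt0 s : 0 < complex.Re s -> 0 < csqrt_re s.
Proof.
move=> s0; rewrite /csqrt_re sqrtr_gt0 mulr_gt0 ?invr_gt0 ?ltr0n //.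
by rewrite ltr_wpDl ?sqrtr_ge0.
Qed.

Lemma csqrt_sqr s : 0 < complex.Re s -> csqrt s ^+ 2 = s.
Proof.
move=> s0; have r0 := csqrt_re_gt0 s0.
have r2 : csqrt_re s ^+ 2 = (Num.sqrt (complex.Re s * complex.Re s
    + complex.Im s * complex.Im s) + complex.Re s) * 2^-1.
  by rewrite sqr_sqrtr // mulr_ge0 // addr_ge0 ?sqrtr_ge0 // ltW.
have N2 : Num.sqrt (complex.Re s * complex.Re s + complex.Im s * complex.Im s) ^+ 2
    = complex.Re s * complex.Re s + complex.Im s * complex.Im s.
  by rewrite sqr_sqrtr // -!expr2 addr_ge0 ?sqr_ge0.
rewrite /csqrt; move: (csqrt_re s) r0 r2 => r r0 r2.
move: (Num.sqrt _) N2 r2 => N N2 r2; case: s s0 N2 r2 => a b /= a0 N2 r2.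
have rn0 : r != 0 by rewrite gt_eqF.
have e (x y z w : R) : x = z -> y = w -> x +i* y = z +i* w by move=> -> ->.
rewrite expr2; apply: e; last by field.
have b2 : b * b = 4 * r ^+ 2 * (r ^+ 2 - a).
  have -> : b * b = N ^+ 2 - a * a by rewrite N2; ring.
  by rewrite r2; field.
transitivity (r ^+ 2 - b * b * (4 * r ^+ 2)^-1); first by field.
by rewrite b2; field.
Qed.

Lemma sqr_inj_Re x y : 0 < complex.Re x -> 0 < complex.Re y -> x ^+ 2 = y ^+ 2 -> x = y.
Proof.
move=> x0 y0 /eqP; rewrite eqf_sqr => /orP[/eqP //|/eqP e].
by move: x0; rewrite e; case: (y) y0 => a b /= a0; rewrite oppr_gt0 ltNge ltW.
Qed.

Lemma cx_fun_csqrt m (U : set 'rV[R]_m) (s : 'rV[R]_m -> R[i]) : open U ->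
  (forall u, U u -> 0 < complex.Re (s u)) ->
  cx_fun (fun f => smooth_on U (f : _ -> R^o)) s ->
  cx_fun (fun f => smooth_on U (f : _ -> R^o)) (fun u => csqrt (s u)).
Proof.
move=> oU s0 [sre sim]; have aP := smooth_fun_alg oU.
have S1 : smooth_on U (fun u => Num.sqrt (complex.Re (s u) * complex.Re (s u)
    + complex.Im (s u) * complex.Im (s u)) : R^o).
  apply: smooth_on_sqrt => // [u Uu|].
    by rewrite ltr_pwDl ?mulr_gt0 ?s0 // -expr2 sqr_ge0.
  by apply: (fa_D aP (fa_M aP sre sre) (fa_M aP sim sim)).
have S2 : smooth_on U (fun u => csqrt_re (s u) : R^o).
  apply: smooth_on_sqrt => // [u Uu|].
    by rewrite mulr_gt0 ?invr_gt0 ?ltr0n // ltr_wpDl ?sqrtr_ge0 ?s0.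
  exact: (fa_M aP (fa_D aP S1 sre) (fa_cst aP _)).
split; first exact: S2.
apply: (fa_M aP sim); apply: smooth_onV => // [u Uu|].
  by rewrite mulf_neq0 // gt_eqF // csqrt_re_gt0 ?s0.
exact: (fa_M aP (fa_cst aP 2) S2).
Qed.

Lemma open_ne0 m (U : set 'rV[R]_m) (f : 'rV[R]_m -> R) : open U ->
  smooth_on U (f : _ -> R^o) -> open (U `&` [set u | f u != 0]).
Proof.
move=> oU sf.
have -> : [set u | f u != 0] = f @^-1` [set x | x != 0] by [].
apply: open_preimage_on; [by []|move=> u Uu|exact: open_neq].
exact: differentiable_continuous (smooth_on_diff sf Uu).
Qed.

Lemma open_pos m (U : set 'rV[R]_m) (f : 'rV[R]_m -> R) : open U ->
  smooth_on U (f : _ -> R^o) -> open (U `&` [set u | 0 < f u]).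
Proof.
move=> oU sf.
have -> : [set u | 0 < f u] = f @^-1` [set x | 0 < x] by [].
apply: open_preimage_on; [by []|move=> u Uu|exact: open_gt].
exact: differentiable_continuous (smooth_on_diff sf Uu).
Qed.

Lemma bc_fun_inv_smooth m (U : set 'rV[R]_m) (f : 'rV[R]_m -> bicomplex R) : open U ->
  (forall u, U u -> bc_norm (f u) != 0) ->
  bc_fun (fun g => smooth_on U (g : _ -> R^o)) f ->
  bc_fun (fun g => smooth_on U (g : _ -> R^o)) (fun u => bc_inv (f u)).
Proof.
move=> oU f0 sf; have aP := smooth_fun_alg oU; apply: bc_fun_inv => //.
apply: smooth_onV => //; exact: (bc_fun_norm aP sf).
Qed.

End Csqrt.

(** * The graph chart *)

Lemma mul0mx_sum (K : nzRingType) k (a b c d : 'M[K]_k) :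
  0 *m a + b *m 0 + (0 *m c + d *m 0) = 0.
Proof. by rewrite !mul0mx !mulmx0 !addr0. Qed.

Lemma mul0mx_scale (K : nzRingType) k (a b d d' : 'M[K]_k) x :
  \tr (0 *m a + b *m 0) *: d + x *: (0 + d') = x *: d'.
Proof. by rewrite mul0mx mulmx0 addr0 mxtrace0 scale0r !add0r. Qed.

Section Chart.
Variables (R : realType) (n : nat).
Local Notation B := (bicomplex R).
Local Notation E := (ambient R n).
Local Notation M := (M_space R n).
Variables (p0 : E) (Mp0 : M p0) (m : nat) (X : m.-tuple E).
Hypothesis bX : basis_of (tang_vs p0.1) X.
Local Notation q0 := p0.1.
Local Notation z0 := p0.2.
Local Notation sm U := (fun f => @smooth_on R m R^o U f).

Let q0_idem : rank_one_idem q0 := M_idem Mp0.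

Definition lin_chart (c : 'rV[R]_m) : E := \sum_j c 0 j *: tnth X j.
Local Notation la c := (lin_chart c).1.

Lemma lin_chart_mem c : lin_chart c \in tang_vs q0.
Proof.
apply: memv_suml => j _; apply: memvZ; rewrite -(span_basis bX).
by apply: memv_span; exact: mem_tnth.
Qed.

Lemma lin_chart_tang c : tang q0 (la c).
Proof. by have [] := (mem_tang_vs _ _).1 (lin_chart_mem c). Qed.

Lemma lin_chart2 c : (lin_chart c).2 = 0.
Proof. by have [] := (mem_tang_vs _ _).1 (lin_chart_mem c). Qed.

Definition lin_coord (a : 'M[B]_n) : 'rV[R]_m := \row_j coord X j ((a, 0) : E).

Lemma lin_coordK a : tang q0 a -> la (lin_coord a) = a.
Proof.
move=> ta.
have va : ((a, 0) : E) \in tang_vs q0 by apply/mem_tang_vs.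
transitivity ((a, 0) : E).1; last by [].
rewrite [in RHS](coord_basis bX va); congr (_.1).
by apply: eq_bigr => j _; rewrite mxE (tnth_nth 0).
Qed.

Lemma coord_lin_chart c j : coord X j (lin_chart c) = c 0 j.
Proof.
rewrite /lin_chart (eq_bigr (fun j => c 0 j *: X`_j)) => [|k _].
  by rewrite coord_sum_free //; exact: basis_free bX.
by rewrite (tnth_nth 0).
Qed.

Lemma lin_chartK c : lin_coord (la c) = c.
Proof.
apply/rowP => j; rewrite mxE -[RHS]coord_lin_chart; congr (coord X j _).
by have := lin_chart2 c; case: (lin_chart c) => a b /= ->.
Qed.

Lemma lin_chart_smooth U : open U -> smooth_on U (@coords R E \o lin_chart).
Proof.
move=> oU; have aP := smooth_fun_alg oU; apply: smooth_coords => // l.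
have sc j : smooth_on U (fun c : 'rV[R]_m => c 0 j : R^o).
  exact: ((smooth_on_mxP _ oU).1 (smooth_id oU) 0 j).
have := fa_sum aP (index_enum _) (fun j => fa_M aP (sc j) (fa_cst aP (l (tnth X j)))).
move=> h; apply: fun_ext h _ => c; rewrite /lin_chart linear_sum.
by apply: eq_bigr => j _; rewrite (linearZZ l).
Qed.

Lemma lin_chart_mx U : open U -> mx_fun (sm U) (fun c => la c).
Proof. by move=> oU; exact: mx_fun_param oU (lin_chart_smooth oU). Qed.

Lemma lin_chart_der u v : mder u v (fun c => la c) (la v).
Proof.
have dj j : bder u v (fun c : 'rV[R]_m => of_Rx (c 0 j)%:C) (of_Rx (v 0 j)%:C).
  split; try exact: rder_cst.
  have di : derivable (@id 'rV[R]_m) u v by exact: derivable_id.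
  split; first by move/derivable_mxP: (di) => /(_ 0 j).
  have := derive_mx di; rewrite derive_id => /rowP /(_ j); rewrite mxE => e.
  by rewrite /= e.
have := mder_sum (index_enum _) (fun j => mderZ (dj j) (mder_cst u v (tnth X j).1)).
move=> h; apply: mder_ext h _ _ => [c|]; rewrite /lin_chart ambient_sum1.
  by [].
by apply: eq_bigr => j _; rewrite scaler0 addr0.
Qed.

Lemma lin_chart_eq0 v : la v = 0 -> v = 0.
Proof.
move=> v0; apply/rowP => j; rewrite mxE -coord_lin_chart.
have -> : lin_chart v = 0 by have := lin_chart2 v; case: (lin_chart v) v0 => a b /= -> ->.
by rewrite linear0.
Qed.

Definition den c : B := graph_den q0 (la c).
Definition chart_q c : 'M[B]_n := bc_inv (den c) *: graph_num q0 (la c).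
Definition chart_t c : B := \tr (dagger (chart_q c) *m chart_q c).
Definition t0 : B := \tr (dagger q0 *m q0).
Definition chart_s c : R[i] := to_Rx (t0 * bc_inv (chart_t c)).
(** The graph of [lin_chart] over q0; the equation for z is solved by
    z = z0 (Tr(q0^dagger q0) / Tr(q^dagger q))^(1/2). *)
Definition chart c : E := (chart_q c, z0 * csqrt (chart_s c)).

(** The three successive conditions make the denominator of q invertible, then
    Tr(q^dagger q), and put the quantity under the root in the half plane where
    the square root is smooth. *)
Definition dom1 : set 'rV[R]_m := setT `&` [set c | bc_norm (den c) != 0].
Definition dom2 := dom1 `&` [set c | bc_norm (chart_t c) != 0].
Definition dom := dom2 `&` [set c | 0 < complex.Re (chart_s c)].

Lemma den_fun U : open U -> bc_fun (sm U) den.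
Proof.
move=> oU; have aP := smooth_fun_alg oU; have sa := lin_chart_mx oU.
apply: bc_funD => //; first exact: bc_fun_cst.
apply: mx_fun_tr => //; apply: mx_funM => //; apply: mx_funM => //; exact: mx_fun_cst.
Qed.

Lemma open_dom1 : open dom1.
Proof.
apply: open_ne0; first exact: openT.
exact: (bc_fun_norm (smooth_fun_alg openT) (den_fun openT)).
Qed.

Lemma chart_q_fun U : open U -> U `<=` dom1 -> mx_fun (sm U) chart_q.
Proof.
move=> oU U1; have aP := smooth_fun_alg oU; have sa := lin_chart_mx oU.
apply: mx_funZ => //.
  by apply: bc_fun_inv_smooth => // [u /U1[]|] //; exact: den_fun.
have s1 : mx_fun (sm U) (fun c => 1%:M + la c) by apply: mx_funD => //; exact: mx_fun_cst.
by apply: mx_funM => //; apply: mx_funM => //; exact: mx_fun_cst.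
Qed.

Lemma chart_t_fun U : open U -> U `<=` dom1 -> bc_fun (sm U) chart_t.
Proof.
move=> oU U1; have aP := smooth_fun_alg oU; have sq := chart_q_fun oU U1.
by apply: mx_fun_tr => //; apply: mx_funM => //; exact: mx_fun_dagger.
Qed.

Lemma open_dom2 : open dom2.
Proof.
apply: open_ne0; first exact: open_dom1.
exact: (bc_fun_norm (smooth_fun_alg open_dom1) (chart_t_fun open_dom1 (@subset_refl _ _))).
Qed.

Lemma chart_s_fun U : open U -> U `<=` dom2 -> cx_fun (sm U) chart_s.
Proof.
move=> oU U2; have aP := smooth_fun_alg oU.
apply: bc_fun_to_Rx; apply: bc_funM => //; first exact: bc_fun_cst.
apply: bc_fun_inv_smooth => // [u /U2[]|] //.
by apply: chart_t_fun => // u /U2[].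
Qed.

Lemma open_dom : open dom.
Proof.
apply: open_pos; first exact: open_dom2.
by have [] := chart_s_fun open_dom2 (@subset_refl _ _).
Qed.

Lemma chart_smooth : smooth_on dom (@coords R E \o chart).
Proof.
have oU := open_dom; have aP := smooth_fun_alg oU.
apply: smooth_param => //; first by apply: chart_q_fun => // u [[]].
have [sre sim] : cx_fun (sm dom) (fun c => csqrt (chart_s c)).
  apply: cx_fun_csqrt => // [u []|] //.
  by apply: chart_s_fun => // u [].
have [s0 s2] : cx_fun (sm dom) (fun c => z0 * csqrt (chart_s c)).
  have h : bc_fun (sm dom) (fun c => of_Rx z0 * of_Rx (csqrt (chart_s c))).
    by apply: bc_funM => //; [exact: bc_fun_cst|exact: bc_fun_of_Rx].
  by have := bc_fun_to_Rx h; rewrite (_ : (fun c => to_Rx _) = (fun c => z0 * csqrt (chart_s c)))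
     // funeqE => c; rewrite -of_RxM of_RxK.
by [].
Qed.

Section Point.
Variables (c : 'rV[R]_m) (dc : dom c).

Let den_inv : den c * bc_inv (den c) = 1.
Proof. by apply: bc_mulV; case: dc => [[[]]]. Qed.

Lemma chart_q_idem : chart_q c *m chart_q c = chart_q c.
Proof.
rewrite /chart_q -scalemxAl -scalemxAr scalerA (graph_num_sqr q0_idem (lin_chart_tang c)).
by rewrite scalerA -mulrA [_ * graph_den _ _]mulrC den_inv mulr1.
Qed.

Lemma chart_q_tr : \tr (chart_q c) = 1.
Proof.
rewrite /chart_q mxtraceZ (tr_graph_num q0_idem (lin_chart_tang c)) mulrC.
exact: den_inv.
Qed.

Lemma tr_q0_chart_q : \tr (q0 *m chart_q c) = bc_inv (den c).
Proof.
by rewrite /chart_q -scalemxAr mxtraceZ (tr_q0_graph_num q0_idem (lin_chart_tang c)) mulr1.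
Qed.

Lemma of_chart_s : of_Rx (chart_s c) = t0 * bc_inv (chart_t c).
Proof.
apply: to_RxK; rewrite bc_starM star_tr_dagger bc_star_inv //; first exact: star_tr_dagger.
by case: dc => [[]].
Qed.

Lemma chart_M : M (chart c).
Proof.
split; [exact: chart_q_idem|exact: chart_q_tr|].
have sq : of_Rx (csqrt (chart_s c)) ^+ 2 = t0 * bc_inv (chart_t c).
  rewrite -of_chart_s -[in RHS](@csqrt_sqr R (chart_s c)); first by rewrite rmorphXn.
  by case: dc.
have [_ _ e0] := Mp0.
rewrite -[\tr _]/(chart_t c) /= of_RxM exprMn sq mulrA e0 mul1r mulrC bc_mulV //.
by case: dc => [[]].
Qed.

Lemma chart_graph_inv : graph_inv q0 (chart_q c) (den c) = la c.
Proof.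
rewrite /graph_inv /chart_q -scalemxAr -scalemxAl -scalerDr scalerA den_inv scale1r.
by rewrite (graph_numK q0_idem (lin_chart_tang c)) addrC addKr.
Qed.

End Point.

(** The open set of ambient points on which the inverse of the chart is defined:
    Tr(q0 q) is invertible, and z / z0 is the principal root of its square. *)
Definition dom_amb : set E :=
  [set p | bc_norm (\tr (q0 *m p.1)) != 0 /\ 0 < complex.Re (p.2 * z0^-1)].

Definition chart_inv_q (p : E) : 'M[B]_n := graph_inv q0 p.1 (bc_inv (\tr (q0 *m p.1))).
Definition chart_inv (p : E) : 'rV[R]_m := lin_coord (chart_inv_q p).

Lemma z0_neq0 : z0 != 0.
Proof.
have [_ _ e0] := Mp0; apply/eqP => z00; move: e0; rewrite z00 of_Rx0 expr0n mul0r.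
by move=> /esym/eqP; rewrite oner_eq0.
Qed.

Lemma den_bc_inv c : dom c -> bc_inv (bc_inv (den c)) = den c.
Proof.
by move=> dc; apply: bc_inv_uniq; rewrite mulrC bc_mulV //; case: dc => [[[]]].
Qed.

Lemma chart_dom_amb c : dom c -> dom_amb (chart c).
Proof.
move=> dc; split.
  rewrite /= tr_q0_chart_q; apply: (bc_norm_unit (c := den c)); rewrite mulrC bc_mulV //.
  by case: dc => [[[]]].
rewrite /= mulrAC mulfV ?z0_neq0 // mul1r; apply: csqrt_re_gt0.
by case: dc.
Qed.

Lemma chartK c : dom c -> chart_inv (chart c) = c.
Proof.
move=> dc; rewrite /chart_inv /chart_inv_q /= tr_q0_chart_q den_bc_inv //.
by rewrite chart_graph_inv // lin_chartK.
Qed.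

(** The square roots agree because both have positive real part. *)
Lemma chart_invK p : M p -> dom_amb p -> dom (chart_inv p) -> chart (chart_inv p) = p.
Proof.
move=> Mp [pn pz] dc; have p_idem := M_idem Mp.
have yw := bc_mulV pn; have ti := graph_inv_tang q0_idem yw.
have ea : la (chart_inv p) = chart_inv_q p by exact: lin_coordK.
have ed : den (chart_inv p) = bc_inv (\tr (q0 *m p.1)).
  by rewrite /den ea; exact: (graph_inv_den q0_idem p_idem yw).
have eq : chart_q (chart_inv p) = p.1.
  rewrite /chart_q ed ea (graph_inv_num q0_idem p_idem yw) scalerA.
  rewrite (bc_inv_uniq (c := \tr (q0 *m p.1))) ?yw ?scale1r //.
  by rewrite mulrC.
have et : chart_t (chart_inv p) = \tr (dagger p.1 *m p.1) by rewrite /chart_t eq.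
have [_ _ e0] := Mp0; have [_ _ e1] := Mp.
have inv_t : bc_inv (chart_t (chart_inv p)) = of_Rx p.2 ^+ 2.
  by apply: bc_inv_uniq; rewrite et mulrC.
have es : chart_s (chart_inv p) = (p.2 * z0^-1) ^+ 2.
  apply: of_Rx_inj; rewrite of_chart_s // inv_t rmorphXn /= of_RxM exprMn mulrC.
  congr (_ * _); rewrite -[RHS]mulr1 -e0 mulrA -exprMn -of_RxM mulVf ?z0_neq0 //.
  by rewrite of_Rx1 expr1n mul1r.
have zE : z0 * csqrt (chart_s (chart_inv p)) = p.2.
  have -> : csqrt (chart_s (chart_inv p)) = p.2 * z0^-1.
    have [_ s0] := dc; apply: sqr_inj_Re => //; last by rewrite csqrt_sqr // es.
    exact: csqrt_re_gt0.
  by rewrite mulrCA mulfV ?mulr1 // z0_neq0.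
by rewrite /chart eq zE; case: (p).
Qed.

Lemma dom0 : dom 0 /\ chart 0 = p0.
Proof.
have a0 : la 0 = 0.
  by rewrite /lin_chart big1 // => j _; rewrite mxE scale0r.
have d0 : den 0 = 1 by rewrite /den a0 /graph_den mulmx0 mxtrace0 addr0.
have [qq _ _] := q0_idem; have [_ _ e0] := Mp0.
have i1 : bc_inv (1 : B) = 1 by apply: bc_inv_uniq; rewrite mulr1.
have eq0 : chart_q 0 = q0.
  by rewrite /chart_q d0 a0 i1 scale1r /graph_num addr0 mul1mx mulmx1.
have et0 : chart_t 0 = t0 by rewrite /chart_t eq0.
have nt0 : bc_norm t0 != 0 by apply: (bc_norm_unit (c := of_Rx z0 ^+ 2)); rewrite mulrC.
have es0 : chart_s 0 = 1 by rewrite /chart_s et0 bc_mulV.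
split; last first.
  rewrite /chart eq0 es0.
  have -> : csqrt (1 : R[i]) = 1.
    have s1 : 0 < complex.Re (1 : R[i]) by exact: ltr01.
    by apply: sqr_inj_Re; [exact: csqrt_re_gt0|by []|rewrite csqrt_sqr // expr1n].
  by rewrite mulr1; case: (p0).
split; [split; [split=> //|]|].
- by rewrite /= d0 bc_norm1 oner_neq0.
- by rewrite /= et0.
- have : 0 < complex.Re (chart_s 0) by rewrite es0 ltr01.
  by [].
Qed.

Lemma dom_amb_open : open [set w | dom_amb (@of_coords R E w)].
Proof.
have oT : open [set: 'rV[R]_(\dim {:E})] by exact: openT.
have sq := mx_fun_param oT (smooth_of_coords oT).
have sz := cx_fun_param oT (smooth_of_coords oT).
have aP := smooth_fun_alg oT.
have s1 : bc_fun (fun f => smooth_on setT (f : 'rV[R]_(\dim {:E}) -> R^o))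
    (fun w => \tr (q0 *m (@of_coords R E w).1)).
  by apply: mx_fun_tr => //; apply: mx_funM => //; exact: mx_fun_cst.
have [s2 _] : cx_fun (fun f => smooth_on setT (f : 'rV[R]_(\dim {:E}) -> R^o))
    (fun w => (@of_coords R E w).2 * z0^-1).
  have := bc_fun_to_Rx (bc_funM aP (bc_fun_of_Rx aP sz) (bc_fun_cst aP (of_Rx z0^-1))).
  rewrite (_ : (fun w => to_Rx _) = (fun w => (@of_coords R E w).2 * z0^-1)) // funeqE => w.
  by rewrite -of_RxM of_RxK.
have := openI (open_ne0 oT (bc_fun_norm aP s1)) (open_pos oT s2).
congr open; apply/seteqP; split=> w; first by move=> [[_ h1] [_ h2]]; split.
by move=> [h1 h2]; split; split.
Qed.

Lemma chart_inv_smooth :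
  smooth_on [set w | dom_amb (@of_coords R E w)] (chart_inv \o @of_coords R E).
Proof.
set O := [set w | _]; have oO : open O := dom_amb_open.
have aP := smooth_fun_alg oO; apply/smooth_on_mxP => // i j; rewrite (ord1 i).
have sq := mx_fun_param oO (smooth_of_coords oO).
have s1 : bc_fun (fun f => smooth_on O (f : 'rV[R]_(\dim {:E}) -> R^o))
    (fun w => \tr (q0 *m (@of_coords R E w).1)).
  by apply: mx_fun_tr => //; apply: mx_funM => //; exact: mx_fun_cst.
have s2 : mx_fun (fun f => smooth_on O (f : 'rV[R]_(\dim {:E}) -> R^o))
    (fun w => chart_inv_q (@of_coords R E w)).
  apply: mx_funB => //; last exact: mx_fun_cst.
  apply: mx_funZ => //; first by apply: bc_fun_inv_smooth => // w [].
  by apply: mx_funD => //; apply: mx_funM => //; exact: mx_fun_cst.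
have s3 : smooth_on O (@coords R E \o (fun w => ((chart_inv_q (@of_coords R E w), 0) : E))).
  by apply: smooth_param => //; split; exact: (fa_cst aP).
have s4 := smooth_functional (coord X j) oO s3.
by apply: fun_ext s4 _ => w; rewrite /= /chart_inv mxE.
Qed.

(** Differentiate q0 q + q q0 = Tr(q0 q) (2 q0 + a), with zero derivative of q. *)
Lemma chart_immersion u v : dom u -> dparam chart u v = 0 -> v = 0.
Proof.
move=> Uu v0; have d := smooth_on_diff chart_smooth Uu.
have Dq : mder u v chart_q 0 by have := mder_param v d; rewrite v0.
have D1 : mder u v (fun x => q0 *m chart_q x + chart_q x *m q0) 0.
  have h := mderD (mderM (mder_cst u v q0) Dq) (mderM Dq (mder_cst u v q0)).
  by rewrite mul0mx_sum in h.
have D2 : mder u v (fun x => \tr (q0 *m chart_q x) *: (q0 + q0 + la x))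
    (\tr (q0 *m chart_q u) *: la v).
  have h := mderZ (mder_tr (mderM (mder_cst u v q0) Dq))
    (mderD (mder_cst u v (q0 + q0)) (lin_chart_der u v)).
  by apply: (mder_ext h) => //; exact: mul0mx_scale.
have e x : dom x -> q0 *m chart_q x + chart_q x *m q0 = \tr (q0 *m chart_q x) *: (q0 + q0 + la x).
  move=> dx; rewrite tr_q0_chart_q /chart_q // -scalemxAr -scalemxAl -scalerDr.
  by rewrite (graph_numK q0_idem (lin_chart_tang x)).
have z := mder_uniq (mder_near open_dom Uu e D1) D2.
apply: lin_chart_eq0; have := congr1 (fun a => den u *: a) z.
rewrite scaler0 scalerA tr_q0_chart_q // bc_mulV ?scale1r; first by move=> <-.
by case: Uu => [[[]]].
Qed.

(** The inverse of the chart extends to a smooth map on an open set of the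
    ambient space, which gives the homeomorphism onto the image. *)
Lemma chart_local_param : local_param M dom chart.
Proof.
split.
- exact: open_dom.
- exact: chart_smooth.
- move=> u Uu; apply/free_frameP; first exact: smooth_on_diff chart_smooth Uu.
  by move=> v; exact: chart_immersion.
- move=> u v /set_mem Uu /set_mem Uv e.
  exact: etrans (esym (chartK Uu)) (etrans (congr1 chart_inv e) (chartK Uv)).
- move=> V oV VU; exists ([set w | dom_amb (@of_coords R E w)] `&`
    (chart_inv \o @of_coords R E) @^-1` V); split.
    apply: open_preimage_on; [exact: dom_amb_open|move=> w Ow|exact: oV].
    by apply: differentiable_continuous; exact: smooth_on_diff chart_inv_smooth Ow.
  apply/seteqP; split=> [p [c Vc <-]|p [Mp]].
    split; first exact: chart_M (VU _ Vc).
    rewrite /preimage /= coordsK; split; first exact: chart_dom_amb (VU _ Vc).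
    by rewrite chartK //; exact: VU.
  rewrite /preimage /= coordsK => -[pO pV]; exists (chart_inv p) => //.
  by apply: chart_invK => //; exact: VU.
Qed.

End Chart.

(** * The metric and the endomorphism fields *)

Section Geometry.
Variables (R : realType) (n : nat) (i0 : 'I_n).
Local Notation B := (bicomplex R).
Local Notation E := (ambient R n).
Local Notation M := (M_space R n).

(** The point q = e_ii, z = 1 lies on M; the dimension is read off there. *)
Definition M_dim : nat := \dim (tang_vs (delta_mx i0 i0 : 'M[B]_n)).

Lemma delta_idem : rank_one_idem (delta_mx i0 i0 : 'M[B]_n).
Proof.
apply: bc_rank_one; first by rewrite mul_delta_mx.
rewrite /mxtrace (bigD1 i0) //= big1 => [|k ki]; first by rewrite mxE !eqxx addr0.
by rewrite mxE (negPf ki).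
Qed.

Lemma M_dimE p : M p -> \dim (tang_vs p.1) = M_dim.
Proof. by move=> Mp; exact: dim_tang_vs (M_idem Mp) delta_idem. Qed.

Lemma M_chart p : M p -> exists (U : set 'rV[R]_M_dim) (phi : 'rV[R]_M_dim -> E),
  [/\ local_param M U phi, U 0 & phi 0 = p].
Proof.
move=> Mp; rewrite -(M_dimE Mp); have bX := vbasisP (tang_vs p.1).
have [d0 c0] := dom0 Mp (vbasis (tang_vs p.1)).
by exists (dom p (vbasis (tang_vs p.1))), (chart p (vbasis (tang_vs p.1))); split;
  [exact: (chart_local_param Mp bX)|exact: d0|exact: c0].
Qed.

Lemma M_submanifold : submanifold M_dim M.
Proof.
move=> p Mp; have [U [phi [lp U0 e]]] := M_chart Mp.
by exists U, phi; split=> //; exists 0.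
Qed.

(** By dimension, the differential of any parametrization of M is onto the
    solutions of the linearized equations. *)
Lemma dparam_onto (U : set 'rV[R]_M_dim) phi u v : local_param M U phi -> U u ->
  tspace (phi u) v -> exists x, dparam phi u x = v.
Proof.
move=> lp Uu tv; have Mu := lp_M lp Uu.
have [x e] := frame_spans lp Uu (esym (M_dimE Mu)) tv.1.
by exists x; exact: (tspace_inj (dparam_tspace lp x Uu) tv e).
Qed.

Lemma tangentP p v : M p -> tangent M p v <-> tspace p v.
Proof.
move=> Mp; split=> [[m [U [phi [u [lp Uu <-]]]]]|tv].
  move=> /(span_frameP _ (lp_diff lp Uu))[x ->]; exact: (dparam_tspace lp x Uu).
have [U [phi [lp U0 e]]] := M_chart Mp.
exists M_dim, U, phi, 0; split=> //; apply/(span_frameP _ (lp_diff lp U0)).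
by rewrite -e in tv; have [x <-] := dparam_onto lp U0 tv; exists x.
Qed.

Lemma tangent_tspace p v : M p -> tangent M p v -> tspace p v.
Proof. by move=> Mp tv; apply/(tangentP v Mp). Qed.

Lemma tspace_tangent p v : M p -> tspace p v -> tangent M p v.
Proof. by move=> Mp tv; apply/(tangentP v Mp). Qed.

Lemma star_dz p a : bc_star (dz p a) = dz (R := R) (n := n) p a.
Proof.
rewrite /dz bc_starN (bc_starM (of_Rx p.2 ^+ 3 * half R)).
rewrite (star_z3 (star_half R) (star_of_Rx p.2)) -tr_dagger daggerD !daggerM !daggerK.
by rewrite addrC.
Qed.

(** The right side of the equation for z is fixed by the involution, so it comes
    from R[x]/(x^2+1). *)
Lemma tspace_lift p a : tang p.1 a -> tspace p ((a, to_Rx (dz p a)) : E).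
Proof. by move=> ta; split=> //=; apply: to_RxK; exact: star_dz. Qed.

Lemma tangent_bij p : M p -> set_bij (tangent M p) (tangent_model p.1) (fun v : E => v.1).
Proof.
move=> Mp; split.
- by move=> v /(tangent_tspace Mp) [tv _].
- move=> v w /set_mem /(tangent_tspace Mp) tv /set_mem /(tangent_tspace Mp) tw.
  exact: tspace_inj tv tw.
- move=> a ta; exists (a, to_Rx (dz p a)); last by [].
  exact: (tspace_tangent Mp (tspace_lift ta)).
Qed.

Lemma liftP p a : M p -> tang p.1 a -> tspace p (Defs.lift p a) /\ (Defs.lift p a).1 = a.
Proof.
move=> Mp ta; have : exists v, [set v : E | tangent M p v /\ v.1 = a] v.
  exists (a, to_Rx (dz p a)); split=> //; exact: (tspace_tangent Mp (tspace_lift ta)).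
by move=> /(xgetPex 0) [/(tangent_tspace Mp) t e].
Qed.

Lemma actionP s p v : M p -> tspace p v ->
  tspace p (M_action R n s p v) /\ (M_action R n s p v).1 = bq_act_model s p v.1.
Proof.
by move=> Mp [tv _]; apply: liftP => //; exact: (bq_act_tang Mp).
Qed.

Lemma action_linear s p (r : R) v w : M p -> tspace p v -> tspace p w ->
  M_action R n s p (r *: v + w) = r *: M_action R n s p v + M_action R n s p w.
Proof.
move=> Mp tv tw.
have [t1 e1] := actionP s Mp (tspace_lin r tv tw).
have [t2 e2] := actionP s Mp tv; have [t3 e3] := actionP s Mp tw.
apply: (tspace_inj t1 (tspace_lin r t2 t3)).
rewrite e1 (ambientD1 (r *: v)) (ambientZ1 r v) bq_act_linear -e2 -e3.
by rewrite (ambientD1 (r *: M_action R n s p v)) (ambientZ1 r (M_action R n s p v)).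
Qed.

Lemma metric_linear p (r : R) a b c : M_metric R n p (r *: a + b) c =
  r * M_metric R n p a c + M_metric R n p b c.
Proof. by rewrite /M_metric ambientD1 ambientZ1; exact: g_linear. Qed.

Lemma metric_sym p a b : M_metric R n p a b = M_metric R n p b a.
Proof. exact: g_sym. Qed.

Lemma metric_nondegenerate p v : M p -> tspace p v ->
  (forall w, tspace p w -> M_metric R n p v w = 0) -> v = 0.
Proof.
move=> Mp tv h; apply: (tspace_inj tv (tspace0 p)).
apply: (g_nondegenerate Mp tv.1) => c tc.
by have := h _ (tspace_lift tc).
Qed.

Lemma metric_sum p k (F : 'I_k -> E) (r : 'I_k -> R) w :
  M_metric R n p (\sum_i r i *: F i) w = \sum_i r i * M_metric R n p (F i) w.
Proof.
have m0 : M_metric R n p 0 w = 0.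
  by have := metric_linear p 1 0 0 w; rewrite scaler0 addr0 mul1r => /eqP;
     rewrite -subr_eq subrr eq_sym => /eqP.
elim: (index_enum _) => [|i s IH]; first by rewrite !big_nil.
by rewrite !big_cons metric_linear IH.
Qed.

Section Param.
Variables (U : set 'rV[R]_M_dim) (phi : 'rV[R]_M_dim -> E).
Hypothesis lp : local_param M U phi.
Local Notation sm := (fun f => @smooth_on R M_dim R^o U f).
Local Notation bstar := (@bc_star R : {rmorphism B -> B}).

Let oU : open U := lp_open lp.
Let aP : fun_alg sm := smooth_fun_alg oU.

Lemma dparam_smooth v : smooth_on U (@coords R E \o (fun u => dparam phi u v)).
Proof.
apply: smooth_on_ext (smooth_on_D v (lp_smooth lp)) => // u _.
by rewrite /= /dparam of_coordsK.
Qed.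

Lemma dparam_mx v : mx_fun sm (fun u => (dparam phi u v).1).
Proof. exact: mx_fun_param oU (dparam_smooth v). Qed.

Lemma q_mx : mx_fun sm (fun u => (phi u).1).
Proof. exact: mx_fun_param oU (lp_smooth lp). Qed.

Lemma z_bc : bc_fun sm (fun u => of_Rx (phi u).2).
Proof. by apply: bc_fun_of_Rx => //; exact: cx_fun_param oU (lp_smooth lp). Qed.

Lemma h_form_smooth a b : mx_fun sm a -> mx_fun sm b ->
  bc_fun sm (fun u => h_form (phi u) (a u) (b u)).
Proof.
move=> sa sb; have sq := q_mx; have sz := z_bc.
have sb' := mx_fun_dagger aP sb; have sq' := mx_fun_dagger aP sq.
apply: (bc_funB aP); first exact: (bc_funM aP sz (mx_fun_tr aP (mx_funM aP sa sb'))).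
apply: (bc_funM aP); last exact: (mx_fun_tr aP (mx_funM aP sq sb')).
apply: (bc_funM aP); last exact: (mx_fun_tr aP (mx_funM aP sq' sa)).
exact: (bc_funM aP (bc_funX aP 3 sz) (bc_fun_cst aP _)).
Qed.

Lemma I_end_smooth a : mx_fun sm a -> mx_fun sm (fun u => I_end (phi u) (a u)).
Proof.
move=> sa; have sq := q_mx; have sz := z_bc.
have sa' := mx_fun_dagger aP sa; have sq' := mx_fun_dagger aP sq.
apply: (mx_funD aP); apply: (mx_funZ aP) => //.
- by apply: (mx_funB aP); exact: (mx_funM aP).
- apply: (bc_funM aP); last exact: (mx_fun_tr aP (mx_funM aP sa' sq)).
  exact: (bc_funM aP (bc_funX aP 3 sz) (bc_fun_cst aP _)).
- by apply: (mx_funB aP); exact: (mx_funM aP).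
Qed.

Lemma bq_act_smooth s a : mx_fun sm a -> mx_fun sm (fun u => bq_act_model s (phi u) (a u)).
Proof.
move=> sa; have si := I_end_smooth sa.
have Z (x : B) (b : _ -> 'M[B]_n) : mx_fun sm b -> mx_fun sm (fun u => x *: b u).
  exact: (mx_funZ aP (bc_fun_cst aP x)).
case: s => [[[s0 s1] s2] s3]; rewrite /bq_act_model.
apply: (mx_funD aP); last exact: (Z _ _ (Z _ _ si)).
apply: (mx_funD aP); last exact: (Z _ _ si).
apply: (mx_funD aP); first exact: (Z _ _ sa).
exact: (Z _ _ (Z _ _ sa)).
Qed.

Lemma gramE u i j : gram (M_metric R n) phi u i j =
  bc_re (h_form (phi u) (dparam phi u (delta_mx 0 i)).1 (dparam phi u (delta_mx 0 j)).1).
Proof. by rewrite mxE !tnth_frame. Qed.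

Lemma gram_smooth : smooth_on U (gram (M_metric R n) phi).
Proof.
apply/smooth_on_mxP => // i j.
have := bc_fun_re (h_form_smooth (dparam_mx (delta_mx 0 i)) (dparam_mx (delta_mx 0 j))).
by move=> h; apply: fun_ext h _ => u; rewrite gramE.
Qed.

Lemma dparam_inj u v w : U u -> (dparam phi u v).1 = (dparam phi u w).1 -> v = w.
Proof.
move=> Uu e; have d := lp_diff lp Uu.
have e' := tspace_inj (dparam_tspace lp v Uu) (dparam_tspace lp w Uu) e.
apply/eqP; rewrite -subr_eq0; apply/eqP.
apply: ((free_frameP d).1 (lp_immersion lp Uu)).
have -> : v - w = -1 *: w + v by rewrite scaleN1r addrC.
by apply: etrans (dparam_linear d (-1) w v) _; rewrite e' scaleN1r; exact: addNr.
Qed.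

Lemma gram_pair u (x : 'rV[R]_M_dim) j : U u ->
  (x *m gram (M_metric R n) phi u) 0 j =
  M_metric R n (phi u) (dparam phi u x) (dparam phi u (delta_mx 0 j)).
Proof.
move=> Uu; rewrite (dparam_sum x (lp_diff lp Uu)) metric_sum mxE.
by apply: eq_bigr => k _; rewrite mxE !tnth_frame.
Qed.

(** The nondegeneracy of the metric, in the frame. *)
Lemma gram_unit u : U u -> gram (M_metric R n) phi u \in unitmx.
Proof.
move=> Uu; rewrite -row_free_unit -kermx_eq0; apply/rowV0P => x /sub_kermxP x0.
have Mu := lp_M lp Uu; have d := lp_diff lp Uu.
apply: ((free_frameP d).1 (lp_immersion lp Uu)).
apply: (metric_nondegenerate Mu (dparam_tspace lp x Uu)) => w tw.
have [y <-] := dparam_onto lp Uu tw.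
rewrite metric_sym (dparam_sum y d) metric_sum big1 // => k _.
by rewrite metric_sym tnth_frame -gram_pair // x0 mxE mulr0.
Qed.

End Param.

Lemma M_pseudo_riemannian : pseudo_riemannian M_dim M (M_metric R n).
Proof.
split.
- by move=> p Mp r a b c _ _ _; exact: metric_linear.
- by move=> p Mp a b _ _; exact: metric_sym.
- move=> p Mp a /(tangent_tspace Mp) ta h; apply: (metric_nondegenerate Mp ta) => w tw.
  by apply: h; apply: (tspace_tangent Mp).
- by move=> U phi lp; exact: gram_smooth.
Qed.

Section Endo.
Variables (s : biquaternion R) (U : set 'rV[R]_M_dim) (phi : 'rV[R]_M_dim -> E).
Hypothesis lp : local_param M U phi.
Local Notation J := (M_action R n s).

Lemma dparam_endo u (x : 'rV[R]_M_dim) : U u ->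
  dparam phi u (x *m endo_mx J phi u) = J (phi u) (dparam phi u x).
Proof.
move=> Uu; have Mu := lp_M lp Uu; have d := lp_diff lp Uu.
have ej j : dparam phi u (row j (endo_mx J phi u)) = J (phi u) (dparam phi u (delta_mx 0 j)).
  have [t _] := actionP s Mu (dparam_tspace lp (delta_mx 0 j) Uu).
  have [y e] := dparam_onto lp Uu t.
  have sp : J (phi u) (dparam phi u (delta_mx 0 j)) \in <<frame phi u>>%VS.
    by apply/(span_frameP _ d); exists y.
  rewrite [RHS](coord_span sp) dparam_sum //; apply: eq_bigr => k _.
  by rewrite !mxE !(tnth_nth 0) -tnth_nth tnth_frame.
have linL : linear (fun x : 'rV[R]_M_dim => dparam phi u (x *m endo_mx J phi u)).
  by move=> r v w; rewrite mulmxDl -scalemxAl dparam_linear.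
have linK : linear (fun x : 'rV[R]_M_dim => J (phi u) (dparam phi u x)).
  move=> r v w; rewrite dparam_linear //.
  exact: (action_linear s r Mu (dparam_tspace lp v Uu) (dparam_tspace lp w Uu)).
pose L : {linear 'rV[R]_M_dim -> E} := HB.pack (fun x : 'rV[R]_M_dim =>
   dparam phi u (x *m endo_mx J phi u)) (GRing.isLinear.Build _ _ _ _ _ linL).
pose K : {linear 'rV[R]_M_dim -> E} := HB.pack (fun x : 'rV[R]_M_dim =>
   J (phi u) (dparam phi u x)) (GRing.isLinear.Build _ _ _ _ _ linK).
rewrite -[LHS]/(L x) -[RHS]/(K x) (row_sum_delta x) !linear_sum.
apply: eq_bigr => j _; rewrite (linearZZ L) (linearZZ K); congr (_ *: _).
by rewrite /= -rowE.
Qed.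

Lemma endo_mxE u j k : U u -> (endo_mx J phi u *m gram (M_metric R n) phi u) j k =
  bc_re (h_form (phi u) (bq_act_model s (phi u) (dparam phi u (delta_mx 0 j)).1)
    (dparam phi u (delta_mx 0 k)).1).
Proof.
move=> Uu; have Mu := lp_M lp Uu.
transitivity ((row j (endo_mx J phi u) *m gram (M_metric R n) phi u) 0 k).
  by rewrite !mxE; apply: eq_bigr => l _; rewrite [in RHS]mxE.
rewrite (gram_pair lp) // rowE dparam_endo // /M_metric.
by have [_ ->] := actionP s Mu (dparam_tspace lp (delta_mx 0 j) Uu).
Qed.

(** In the frame J has the matrix K G^-1, with G the Gram matrix and
    K_jk = g(J e_j, e_k); both are polynomial in smooth functions. *)
Lemma endo_smooth : smooth_on U (endo_mx J phi).
Proof.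
have oU := lp_open lp; have aP := smooth_fun_alg oU.
pose K u : 'M[R]_M_dim := \matrix_(j, k) bc_re (h_form (phi u)
  (bq_act_model s (phi u) (dparam phi u (delta_mx 0 j)).1) (dparam phi u (delta_mx 0 k)).1).
have sK j k : smooth_on U (fun u => K u j k : R^o).
  have := bc_fun_re (h_form_smooth lp (bq_act_smooth lp s (dparam_mx lp (delta_mx 0 j)))
     (dparam_mx lp (delta_mx 0 k))).
  by move=> h; apply: fun_ext h _ => u; rewrite mxE.
have sG i j : smooth_on U (fun u => gram (M_metric R n) phi u i j : R^o).
  exact: ((smooth_on_mxP _ oU).1 (gram_smooth lp) i j).
apply/(smooth_on_mxP _ oU) => i j.
have sV : smooth_on U (fun u => (\det (gram (M_metric R n) phi u))^-1 : R^o).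
  apply: smooth_onV => // [u Uu|]; last exact: (fa_det aP sG).
  by rewrite -unitfE -unitmxE; exact: (gram_unit lp).
have := fa_sum aP (index_enum _) (fun k => fa_M aP (sK i k) (fa_M aP sV (fa_adj aP k j sG))).
apply: smooth_on_ext => // u Uu.
have -> : endo_mx J phi u = K u *m invmx (gram (M_metric R n) phi u).
  have -> : K u = endo_mx J phi u *m gram (M_metric R n) phi u.
    by apply/matrixP => a b; rewrite endo_mxE // mxE.
  by rewrite mulmxK //; exact: (gram_unit lp).
rewrite mxE; apply: eq_bigr => k _.
by rewrite /invmx (gram_unit lp) // scale_mxE.
Qed.

End Endo.

Lemma M_bundle_endo s : bundle_endo M_dim M (M_action R n s).
Proof.
split.
- move=> p Mp a /(tangent_tspace Mp) ta; apply: (tspace_tangent Mp).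
  by have [] := actionP s Mp ta.
- move=> p Mp r a b /(tangent_tspace Mp) ta /(tangent_tspace Mp) tb.
  exact: action_linear.
- by move=> U phi lp; exact: endo_smooth.
Qed.

End Geometry.

(** * The Levi-Civita connection *)

Lemma derive_swap_rV (R : realType) m k (F : 'rV[R]_m -> 'rV[R]_k) U u v w :
  open U -> U u -> smooth_on U F -> 'D_w ('D_v F) u = 'D_v ('D_w F) u.
Proof.
move=> oU Uu sF; apply/rowP => j.
have e v' w' : 'D_w' ('D_v' F) u 0 j = 'D_w' ('D_v' (fun x => F x 0 j : R^o)) u.
  rewrite derive_entry; last exact: smooth_on_diff (smooth_on_D v' sF) Uu.
  apply: eq_on_derive oU Uu _ => x Ux; rewrite derive_entry //.
  exact: smooth_on_diff sF Ux.
have sj := (smooth_on_mxP _ oU).1 sF 0 j.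
exact: etrans (e v w) (etrans (derive_swap v w oU Uu sj) (esym (e w v))).
Qed.

Lemma bc_re_split (R : realType) (a b b' k k' : bicomplex R) : bc_re b = bc_re b' ->
  bc_re (a + b + k + bc_star k') = bc_re (a + k) + bc_re (b' + k').
Proof. by move=> e; rewrite !bc_reD bc_re_star e; ring. Qed.

(** The six terms of the Koszul formula, with the symmetries that make four of
    them cancel. *)
Lemma koszul (R : realType) (x y z a b c d e f : R) :
  x = a + b -> y = c + d -> z = e + f -> f = d -> e = b -> c = a ->
  2^-1 * (x + y - z) = a.
Proof. by move=> -> -> -> -> -> ->; field. Qed.

Section LC.
Variables (R : realType) (n : nat) (i0 : 'I_n).
Local Notation B := (bicomplex R).
Local Notation E := (ambient R n).
Local Notation M := (M_space R n).
Local Notation m := (M_dim R i0).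
Local Notation bstar := (@bc_star R : {rmorphism B -> B}).
Local Notation HF p := (hform bstar (half R) (of_Rx p.2) p.1).
Local Notation KP p := (kappa bstar (half R) (of_Rx p.2) p.1).
Variables (U : set 'rV[R]_m) (phi : 'rV[R]_m -> E).
Hypothesis lp : local_param M U phi.

Let oU : open U := lp_open lp.

Local Notation ee i := (delta_mx 0 i : 'rV[R]_m).

(** The second derivative of phi at u, first along w and then along v. *)
Definition ddparam u v w : E := dparam (fun x => dparam phi x w) u v.

Lemma mder_dparam u v w : U u ->
  mder u v (fun x => (dparam phi x w).1) (ddparam u v w).1.
Proof.
move=> Uu; have d := smooth_on_diff (dparam_smooth lp w) Uu.
exact: (mder_param (phi := fun x => dparam phi x w) v d).
Qed.

Lemma ddparamC u v w : U u -> ddparam u v w = ddparam u w v.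
Proof.
move=> Uu; pose F := @coords R E \o phi.
have e w' v' : ddparam u v' w' = @of_coords R E ('D_v' ('D_w' F) u).
  apply: (congr1 (@of_coords R E)); apply: (eq_on_derive _ oU Uu) => x _.
  exact: of_coordsK.
have sw : 'D_v ('D_w F) u = 'D_w ('D_v F) u.
  exact (derive_swap_rV w v oU Uu (lp_smooth lp)).
exact (etrans (e w v) (etrans (congr1 (@of_coords R E) sw) (esym (e v w)))).
Qed.

Lemma ddparam_sum u v w : U u -> ddparam u v w = \sum_i v 0 i *: ddparam u (ee i) w.
Proof.
move=> Uu; rewrite {1}/ddparam dparam_sum; last exact: smooth_on_diff (dparam_smooth lp w) Uu.
by apply: eq_bigr => i _; rewrite tnth_frame.
Qed.

(** The covariant product rule for h along a parametrization. *)
Lemma h_form_derivative u v a b a' b' : U u -> mder u v a a' -> mder u v b b' ->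
  bder u v (fun x => h_form (phi x) (a x) (b x))
    (HF (phi u) a' (b u) + HF (phi u) (a u) b' + KP (phi u) (dparam phi u v).1 (a u) (b u)
     + bc_star (KP (phi u) (dparam phi u v).1 (b u) (a u))).
Proof.
move=> Uu Da Db; have d := lp_diff lp Uu.
have Dq := mder_param v d; have Dz := bder_param v d.
have Dz3 := bderM Dz (bderM Dz Dz).
have T1 := mder_tr (mderM Da (mder_dagger Db)).
have T2 := mder_tr (mderM (mder_dagger Dq) Da).
have T3 := mder_tr (mderM Dq (mder_dagger Db)).
have h := bderD (bderM Dz T1) (bderN (bderM (bderM (bderM Dz3 (bder_cst u v (half R))) T2) T3)).
have [_ ez] := dparam_tspace lp v Uu.
apply: (bder_ext h) => //.
exact: (hform_derivative (@bc_starK R) (star_half R) (star_of_Rx _) _ _ _ _ ez).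
Qed.

Local Notation f u i := (dparam phi u (ee i)).1.
Local Notation sec u i j := (ddparam u (ee i) (ee j)).1.

(** The Christoffel symbol with its last index lowered. *)
Definition lowered u i j l : R :=
  bc_re (HF (phi u) (sec u i j) (f u l) + KP (phi u) (f u i) (f u j) (f u l)).

Lemma HF_sym u a b : bc_re (HF (phi u) a b) = bc_re (HF (phi u) b a).
Proof. exact: g_sym. Qed.

Lemma gram_derivative u i j l : U u ->
  'D_(ee i) (gram (M_metric R n) phi) u j l = lowered u i j l + lowered u i l j.
Proof.
move=> Uu; rewrite derive_entry; last exact: smooth_on_diff (gram_smooth lp) Uu.
have h := bder_re (h_form_derivative Uu (mder_dparam (ee i) (ee j) Uu) (mder_dparam (ee i) (ee l) Uu)).
have h' : rder u (ee i) (fun x => gram (M_metric R n) phi x j l) (lowered u i j l + lowered u i l j).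
  apply: (rder_ext h) => [x|]; first by rewrite gramE.
  exact (bc_re_split _ _ _ (HF_sym u (f u j) _)).
by have [_ <-] := h'.
Qed.

Lemma loweredC u i j l : U u -> lowered u i j l = lowered u j i l.
Proof.
move=> Uu; have e1 := ddparamC (ee i) (ee j) Uu.
have e2 := kappaC bstar (half R) (of_Rx (phi u).2) (phi u).1 (f u i) (f u j) (f u l).
exact (congr1 (@bc_re R) (congr2 +%R (congr1 (fun a : E => HF (phi u) a.1 (f u l)) e1) e2)).
Qed.

Lemma christoffel_lower u i j l : U u ->
  \sum_k christoffel (M_metric R n) phi u i j k * gram (M_metric R n) phi u k l
  = lowered u i j l.
Proof.
move=> Uu; pose r : 'rV[R]_m := \row_l (2^-1 *
  ('D_(ee i) (gram (M_metric R n) phi) u j l + 'D_(ee j) (gram (M_metric R n) phi) u i l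
   - 'D_(ee l) (gram (M_metric R n) phi) u i j)).
transitivity (((r *m invmx (gram (M_metric R n) phi u)) *m gram (M_metric R n) phi u) 0 l).
  rewrite mxE; apply: eq_bigr => k _; congr (_ * _); rewrite /christoffel mxE mulr_sumr.
  by apply: eq_bigr => a _; rewrite mxE mulrA.
rewrite (mulmxKV (gram_unit lp Uu)) mxE.
exact (koszul (gram_derivative i j l Uu) (gram_derivative j i l Uu)
  (gram_derivative l i j Uu) (loweredC l j i Uu) (loweredC l i j Uu) (loweredC j i l Uu)).
Qed.

Definition real_linear (g : 'M[B]_n -> R) := forall r a b,
  g (of_Rx r%:C *: a + b) = r * g a + g b.

Lemma real_linear_sum g k (r : 'I_k -> R) (F : 'I_k -> 'M[B]_n) : real_linear g ->
  g (\sum_i of_Rx (r i)%:C *: F i) = \sum_i r i * g (F i).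
Proof.
move=> lg; have g0 : g 0 = 0.
  by have := lg (-1) 0 0; rewrite scaler0 addr0 mulN1r addNr.
elim: (index_enum _) => [|i s IH]; first by rewrite !big_nil.
by rewrite !big_cons lg IH.
Qed.

Lemma HF_real_linear u c : real_linear (fun a => bc_re (HF (phi u) a c)).
Proof. by move=> r a b; exact: g_linear. Qed.

Lemma KP_real_linear_l u b c : real_linear (fun a => bc_re (KP (phi u) a b c)).
Proof. by move=> r a a'; rewrite kappaDl kappaZl bc_reD bc_reZ. Qed.

Lemma KP_real_linear_m u a c : real_linear (fun b => bc_re (KP (phi u) a b c)).
Proof. by move=> r b b'; rewrite kappaDm kappaZm bc_reD bc_reZ. Qed.

Lemma dparam1 u v : U u -> (dparam phi u v).1 = \sum_i of_Rx (v 0 i)%:C *: f u i.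
Proof.
move=> Uu; rewrite (dparam_sum v (lp_diff lp Uu)) ambient_sum1.
by apply: eq_bigr => i _; rewrite ambientZ1 tnth_frame.
Qed.

Lemma ddparam1 u v w : U u -> (ddparam u v w).1 = \sum_i of_Rx (v 0 i)%:C *: (ddparam u (ee i) w).1.
Proof.
move=> Uu; rewrite (ddparam_sum v w Uu) ambient_sum1.
by apply: eq_bigr => i _; rewrite ambientZ1.
Qed.

Lemma KP_expand u x y c : U u ->
  bc_re (KP (phi u) (dparam phi u x).1 (dparam phi u y).1 c) =
  \sum_i \sum_j x 0 i * (y 0 j * bc_re (KP (phi u) (f u i) (f u j) c)).
Proof.
move=> Uu; have e b := etrans (congr1 (fun a => bc_re (KP (phi u) a b c)) (dparam1 x Uu))
  (real_linear_sum _ _ (KP_real_linear_l u b c)).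
have e' a := etrans (congr1 (fun b => bc_re (KP (phi u) a b c)) (dparam1 y Uu))
  (real_linear_sum _ _ (KP_real_linear_m u a c)).
apply: (etrans (e _)); apply: eq_bigr => i _.
exact (etrans (congr1 (fun t => x 0 i * t) (e' _)) (mulr_sumr _ _ _ _)).
Qed.

Lemma HF_ddparam_expand u x (y : 'rV[R]_m) c : U u ->
  bc_re (HF (phi u) (\sum_j of_Rx (y 0 j)%:C *: (ddparam u x (ee j)).1) c) =
  \sum_j \sum_i y 0 j * (x 0 i * bc_re (HF (phi u) (sec u i j) c)).
Proof.
move=> Uu; apply: (etrans (real_linear_sum _ _ (HF_real_linear u c))).
apply: eq_bigr => j _.
have e := etrans (congr1 (fun a => bc_re (HF (phi u) a c)) (ddparam1 x (ee j) Uu))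
  (real_linear_sum _ _ (HF_real_linear u c)).
exact (etrans (congr1 (fun t => y 0 j * t) e) (mulr_sumr _ _ _ _)).
Qed.

(** The derivative in the ambient space of the tangent field with components Y. *)
Lemma mder_field u x (Y : 'rV[R]_m -> 'rV[R]_m) : U u -> differentiable Y u ->
  mder u x (fun u => (dparam phi u (Y u)).1)
    ((dparam phi u ('D_x Y u)).1 + \sum_j of_Rx (Y u 0 j)%:C *: (ddparam u x (ee j)).1).
Proof.
move=> Uu dY.
have dj j : bder u x (fun u => of_Rx (Y u 0 j)%:C) (of_Rx ('D_x Y u 0 j)%:C).
  split; try exact: rder_cst.
  have dYx : derivable Y u x by exact: diff_derivable.
  split; first by move/derivable_mxP: (dYx) => /(_ 0 j).
  by rewrite derive_entry.
have h := mder_sum (index_enum _) (fun j => mderZ (dj j) (mder_dparam x (ee j) Uu)).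
have h2 : mder u x (fun u => \sum_j of_Rx (Y u 0 j)%:C *: f u j)
  ((dparam phi u ('D_x Y u)).1 + \sum_j of_Rx (Y u 0 j)%:C *: (ddparam u x (ee j)).1).
  apply: (mder_ext h (fun=> erefl)); rewrite big_split.
  exact (congr2 +%R (esym (dparam1 ('D_x Y u) Uu)) erefl).
exact (mder_near oU Uu (fun y Uy => esym (dparam1 (Y y) Uy)) h2).
Qed.

(** The Levi-Civita derivative, defined through Christoffel symbols, satisfies
    the Koszul formula against the coordinate fields. *)
Lemma levi_civita_lower u (X Y : 'rV[R]_m -> 'rV[R]_m) D l : U u -> differentiable Y u ->
  mder u (X u) (fun u => (dparam phi u (Y u)).1) D ->
  bc_re (HF (phi u) (dparam phi u (levi_civita (M_metric R n) phi X Y u)).1 (f u l)) =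
  bc_re (HF (phi u) D (f u l)
    + KP (phi u) (dparam phi u (X u)).1 (dparam phi u (Y u)).1 (f u l)).
Proof.
move=> Uu dY DD; set x := X u; set y := Y u.
have eD := mder_uniq DD (mder_field x Uu dY).
pose S k := \sum_i \sum_j x 0 i * y 0 j * lowered u i j k.
transitivity (bc_re (HF (phi u) (dparam phi u ('D_x Y u)).1 (f u l)) + S l).
  rewrite -[LHS]/(M_metric R n (phi u) _ _) -(gram_pair lp) //.
  rewrite /levi_civita mulmxDl [LHS]mxE (gram_pair lp) //; congr (_ + _).
  rewrite mxE.
  transitivity (\sum_k \sum_i \sum_j x 0 i * y 0 j *
     (christoffel (M_metric R n) phi u i j k * gram (M_metric R n) phi u k l)).
    apply: eq_bigr => k _; rewrite mxE mulr_suml; apply: eq_bigr => i _.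
    by rewrite mulr_suml; apply: eq_bigr => j _; rewrite mulrA.
  rewrite exchange_big; apply: eq_bigr => i _.
  rewrite exchange_big; apply: eq_bigr => j _.
  by rewrite -mulr_sumr christoffel_lower.
have hs (a b c : 'M[B]_n) : bc_re (HF (phi u) (a + b) c)
    = bc_re (HF (phi u) a c) + bc_re (HF (phi u) b c).
  exact (etrans (congr1 (@bc_re R) (hDl _ _ _ _ _ _ _)) (bc_reD _ _)).
rewrite eD; apply: etrans _ (esym (bc_reD _ _)).
apply: etrans _ (congr2 +%R (esym (hs _ _ _)) erefl).
rewrite -addrA; congr (_ + _).
apply: etrans _ (congr2 +%R (esym (HF_ddparam_expand _ _ _ Uu)) (esym (KP_expand _ _ _ Uu))).
rewrite /S exchange_big /= [X in _ = _ + X]exchange_big /= -big_split.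
apply: eq_bigr => j _; rewrite -big_split; apply: eq_bigr => i _.
rewrite /lowered; apply: etrans (congr1 (fun t => x 0 i * y 0 j * t) (bc_reD _ _)) _.
by move: (bc_re _) (bc_re _) => r1 r2 /=; ring.
Qed.

End LC.

(** * Covariant differentiation of I *)

Section Parallel.
Variables (R : realType) (n : nat) (i0 : 'I_n).
Local Notation B := (bicomplex R).
Local Notation E := (ambient R n).
Local Notation M := (M_space R n).
Local Notation m := (M_dim R i0).
Local Notation bstar := (@bc_star R : {rmorphism B -> B}).
Local Notation HF p := (hform bstar (half R) (of_Rx p.2) p.1).
Local Notation KP p := (kappa bstar (half R) (of_Rx p.2) p.1).
Local Notation JE p := (Jend bstar (half R) (of_Rx p.2) p.1).
Local Notation LCV p := (levi_civita_vec bstar (half R) (of_Rx p.2) p.1).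
Variables (U : set 'rV[R]_m) (phi : 'rV[R]_m -> E).
Hypothesis lp : local_param M U phi.

Let oU : open U := lp_open lp.
Local Notation ee i := (delta_mx 0 i : 'rV[R]_m).
Local Notation nabla X Y u := (levi_civita (M_metric R n) phi X Y u).
Local Notation hat v u := (dparam phi u v).1.

Lemma hat_tang u v : U u -> tang (phi u).1 (hat v u).
Proof. by move=> Uu; have [t _] := dparam_tspace lp v Uu. Qed.

(** Real linear combinations of the frame fill the tangent space, and both sides
    are antilinear in the vector that is tested, so the real Koszul formula
    holds without taking real parts. *)
Lemma nabla_vec u (X Y : 'rV[R]_m -> 'rV[R]_m) D : U u -> differentiable Y u ->
  mder u (X u) (fun x => hat (Y x) x) D ->
  LCV (phi u) (hat (X u) u) (hat (Y u) u) D (hat (nabla X Y u) u).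
Proof.
move=> Uu dY DD; have Mu := lp_M lp Uu.
pose F := lc_defect bstar (half R) (of_Rx (phi u).2) (phi u).1
  (hat (X u) u) (hat (Y u) u) D (hat (nabla X Y u) u).
have F0 l : bc_re (F (hat (ee l) u)) = 0.
  have e := levi_civita_lower lp l Uu dY DD.
  exact (etrans (raddfB (@bc_re R) _ _) (etrans (congr1 (fun t => t - _) e) (subrr _))).
have FZ (x : B) c : F (x *: c) = bc_star x * F c by exact: lc_defectZ.
have FD c c' : F (c + c') = F c + F c' by exact: lc_defectD.
have Fre c : tang (phi u).1 c -> bc_re (F c) = 0.
  move=> tc; have [y ey] := dparam_onto lp Uu (tspace_lift tc).
  have ec : c = \sum_l of_Rx (y 0 l)%:C *: hat (ee l) u.
    by rewrite -(dparam1 lp y Uu) ey.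
  rewrite ec; elim: (index_enum _) => [|l s IH].
    rewrite big_nil; have Fz : F 0 = 0.
      apply: (@addrI B (F 0)).
      exact (etrans (esym (etrans (congr1 F (esym (addr0 0))) (FD 0 0))) (esym (addr0 _))).
    exact (etrans (congr1 (@bc_re R) Fz) (raddf0 (@bc_re R))).
  rewrite big_cons; apply: etrans (congr1 (@bc_re R) (FD _ _)) _.
  apply: etrans (bc_reD _ _) _; apply: etrans (congr2 +%R _ IH) (addr0 _).
  apply: etrans (congr1 (@bc_re R) (FZ _ _)) _; rewrite star_of_Rx bc_reZ F0 mulr0.
  by [].
move=> c tc; apply/eqP; rewrite -subr_eq0; apply/eqP.
exact (re_nondegenerate FZ Fre tc).
Qed.

Lemma tang_derivative u v (b : 'rV[R]_m -> 'M[B]_n) d : U u -> mder u v b d ->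
  (forall x, U x -> tang (phi x).1 (b x)) ->
  hat v u *m b u + (phi u).1 *m d + d *m (phi u).1 + b u *m hat v u = d.
Proof.
move=> Uu Db tb; have Dq := mder_param v (lp_diff lp Uu).
have h := mder_near oU Uu tb (mderD (mderM Dq Db) (mderM Db Dq)).
exact (etrans (esym (addrA _ _ _)) (mder_uniq h Db)).
Qed.

Lemma mder_I u v b d : U u -> mder u v b d ->
  exists dI, mder u v (fun x => I_end (phi x) (b x)) dI.
Proof.
move=> Uu Db; have dd := lp_diff lp Uu.
have Dq := mder_param v dd; have Dz := bder_param v dd.
have Dz3 := bderM Dz (bderM Dz Dz).
have Db' := mder_dagger Db; have Dq' := mder_dagger Dq.
eexists; exact (mderD (mderZ Dz (mderB (mderM Db' Dq) (mderM Dq Db')))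
  (mderZ (bderM (bderM Dz3 (bder_cst u v (half R))) (mder_tr (mderM Db' Dq)))
         (mderB (mderM Dq Dq') (mderM Dq' Dq)))).
Qed.

(** The test vector c is extended to the tangent field [tang_proj], in order to
    differentiate h(c, I b) = Tr(q [b, c]). *)
Lemma nabla_I u v (b : 'rV[R]_m -> 'M[B]_n) d dI e : U u ->
  mder u v b d -> mder u v (fun x => I_end (phi x) (b x)) dI ->
  (forall x, U x -> tang (phi x).1 (b x)) -> tang (phi u).1 e ->
  LCV (phi u) (hat v u) (b u) d e ->
  LCV (phi u) (hat v u) (JE (phi u) (b u)) dI (JE (phi u) e).
Proof.
move=> Uu Db DI tb te LC c tc; have Mu := lp_M lp Uu.
have [qq _ _] := M_idem Mu.
have Dq := mder_param v (lp_diff lp Uu).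
pose pc x := tang_proj (phi x).1 c.
have Dqc := mderM Dq (mder_cst u v c); have Dcq := mderM (mder_cst u v c) Dq.
have Dqcq := mderM Dqc Dq.
have [c' Dc] : exists c', mder u v pc c'.
  by eexists; exact (mderB (mderD Dqc Dcq) (mderD Dqcq Dqcq)).
have tpc x : U x -> tang (phi x).1 (pc x).
  move=> Ux; have [qx _ _] := M_idem (lp_M lp Ux); exact: tang_proj_tang.
have ec := tang_derivative Uu Dc tpc; have eb := tang_derivative Uu Db tb.
have D1 := h_form_derivative lp Uu Dc DI.
have D2 := mder_tr (mderM Dq (mderB (mderM Db Dc) (mderM Dc Db))).
have eU x : U x -> h_form (phi x) (pc x) (I_end (phi x) (b x)) =
    \tr ((phi x).1 *m comm (b x) (pc x)).
  move=> Ux; have Mx := lp_M lp Ux.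
  exact (h_J (@bc_starK R) (half2 R) (star_half R) (star_of_Rx _) (M_idem Mx) (M_zt Mx)
    (tb x Ux) (tpc x Ux)).
have E1 := bder_uniq (bder_near oU Uu eU D1) D2.
have {}E1 := etrans E1 (congr1 (fun t => \tr (hat v u *m comm (b u) (pc u) + (phi u).1 *m t))
   (comm_product_rule (b u) (pc u) d c')).
have pcu : pc u = c by exact: tang_proj_id.
have := levi_civita_J (@bc_starK R) (half2 R) (star_half R) (star_of_Rx _) (M_idem Mu) (M_zt Mu)
  (hat_tang v Uu) (tb u Uu) (tpc u Uu) te eb ec E1 LC.
exact (fun H => eq_ind _ (fun t => HF (phi u) (JE (phi u) e) t =
  HF (phi u) dI t + KP (phi u) (hat v u) (JE (phi u) (b u)) t) H _ pcu).
Qed.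

End Parallel.

(** * The complex hyperkahler structure *)

(** For a, b, c, d the covariant derivatives of Y along J X, of X along J Y, of X
    along Y and of Y along X, this is the Nijenhuis tensor of a parallel J with
    matrix K. *)
Lemma nijenhuis_zero (R : comNzRingType) k (K : 'M[R]_k) (a b c d : 'rV[R]_k) :
  (forall y : 'rV[R]_k, y *m K *m K = - y) ->
  a *m K - b *m K - (a - c *m K) *m K - (d *m K - b) *m K - (d - c) = 0.
Proof.
move=> KK; rewrite !mulmxBl !KK; move: (a *m K) (b *m K) => aK bK; apply/rowP => j.
by rewrite !(add_mxE, opp_mxE) mxE; ring.
Qed.

Lemma dparamN1 (R : realType) n k (phi : 'rV[R]_k -> ambient R n) u (y : 'rV[R]_k) :
  differentiable (@coords R (ambient R n) \o phi) u ->
  (dparam phi u (- y)).1 = - (dparam phi u y).1.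
Proof.
move=> d; have L := dparam_linear d.
have d0 : dparam phi u 0 = 0.
  have := L (-1) 0 0; rewrite scaler0 addr0 => ->; rewrite scaleN1r; exact: addNr.
by have := L (-1) y 0; rewrite d0 !addr0 !scaleN1r => ->.
Qed.

Section Hyperkahler.
Variables (R : realType) (n : nat) (i0 : 'I_n).
Local Notation B := (bicomplex R).
Local Notation E := (ambient R n).
Local Notation M := (M_space R n).
Local Notation m := (M_dim R i0).
Local Notation bstar := (@bc_star R : {rmorphism B -> B}).
Local Notation LCV p := (levi_civita_vec bstar (half R) (of_Rx p.2) p.1).

Section Param.
Variables (U : set 'rV[R]_m) (phi : 'rV[R]_m -> E).
Hypothesis lp : local_param M U phi.

Let oU : open U := lp_open lp.
Local Notation nabla X Y u := (levi_civita (M_metric R n) phi X Y u).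
Local Notation hat v u := (dparam phi u v).1.

Lemma hat_endo s u y : U u ->
  hat (y *m endo_mx (M_action R n s) phi u) u = bq_act_model s (phi u) (hat y u).
Proof.
move=> Uu; apply: etrans (congr1 (fun v : E => v.1) (dparam_endo s lp y Uu)) _.
by have [_ e] := actionP i0 s (lp_M lp Uu) (dparam_tspace lp y Uu).
Qed.

Lemma endo_app_smooth s Y : smooth_on U Y ->
  smooth_on U (endo_app (M_action R n s) phi Y).
Proof.
move=> sY; have aP := smooth_fun_alg oU; apply/(smooth_on_mxP _ oU) => i j.
have sy k : smooth_on U (fun u => Y u i k : R^o).
  exact: ((smooth_on_mxP _ oU).1 sY i k).
have sj k : smooth_on U (fun u => endo_mx (M_action R n s) phi u k j : R^o).
  exact: ((smooth_on_mxP _ oU).1 (endo_smooth s lp) k j).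
apply: smooth_on_ext (fa_sum aP (index_enum _) (fun k => fa_M aP (sy k) (sj k))) => // u _.
by rewrite /endo_app [RHS]mxE.
Qed.

(** Multiplication by elements of B is parallel since the Koszul formula is
    B-linear in Y, and I is parallel by [nabla_I]; the covariant derivative is
    determined by the Koszul formula. *)
Lemma nabla_endo s X Y u : smooth_on U Y -> U u ->
  nabla X (endo_app (M_action R n s) phi Y) u =
  endo_app (M_action R n s) phi (fun u => nabla X Y u) u.
Proof.
move=> sY Uu; apply: (dparam_inj lp Uu); have Mu := lp_M lp Uu.
have dY := smooth_on_diff sY Uu.
have dY' := smooth_on_diff (endo_app_smooth s sY) Uu.
have DD := mder_field lp (X u) Uu dY.
move: (_ + _) DD => D DD.
have [dI DI] := mder_I lp Uu DD.
have D0 := mderD (mderZ (bder_cst u (X u) (bq_scalar s)) DD) (mderZ (bder_cst u (X u) (bq_antilin s)) DI).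
have D1 := mder_ext D0 (fun=> erefl) (act_product_rule _ _ _ _ _ _).
have eY x : U x -> bq_scalar s *: hat (Y x) x + bq_antilin s *: I_end (phi x) (hat (Y x) x) =
    hat (endo_app (M_action R n s) phi Y x) x.
  move=> Ux; exact (esym (etrans (hat_endo s (Y x) Ux) (bq_actE s (phi x) _))).
have D2 := mder_near oU Uu eY D1.
have L1 := nabla_vec lp Uu dY DD.
have tY x : U x -> tang (phi x).1 (hat (Y x) x) by exact: hat_tang.
have tN := hat_tang lp (nabla X Y u) Uu.
have LI := nabla_I lp Uu DD DI tY tN L1.
have LA c (tc : tang (phi u).1 c) := levi_civita_act (bq_scalar s) (bq_antilin s) (L1 c tc) (LI c tc).
have L2 := nabla_vec lp Uu dY' D2.
pose e' := hat (nabla X (endo_app (M_action R n s) phi Y) u) u.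
have L3 := eq_ind _ (fun t => LCV (phi u) (hat (X u) u) t (bq_scalar s *: D + bq_antilin s *: dI) e')
  L2 _ (esym (eY u Uu)).
have tA := act_tang bstar (half R) (of_Rx (phi u).2) (M_idem Mu) (bq_scalar s) (bq_antilin s) tN.
apply: etrans (levi_civita_uniq (@bc_starK R) (half2 R) (star_half R) (star_of_Rx _)
   (M_idem Mu) (M_zt Mu) (hat_tang lp _ Uu) tA L3 LA) _.
exact (esym (etrans (hat_endo s _ Uu) (bq_actE s (phi u) _))).
Qed.

Lemma gram_derivativeC u l i j : U u ->
  'D_(delta_mx 0 l) (gram (M_metric R n) phi) u i j
  = 'D_(delta_mx 0 l) (gram (M_metric R n) phi) u j i.
Proof.
move=> Uu; have e a b := gram_derivative lp l a b Uu.
exact (etrans (e i j) (etrans (addrC _ _) (esym (e j i)))).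
Qed.

Lemma christoffelC u i j k : U u ->
  christoffel (M_metric R n) phi u i j k = christoffel (M_metric R n) phi u j i k.
Proof.
move=> Uu; congr (_ * _); apply: eq_bigr => l _.
exact (congr1 (fun t => t * _)
  (congr2 +%R (addrC _ _) (congr1 -%R (gram_derivativeC l i j Uu)))).
Qed.

Lemma nabla_torsion_free X Y u : U u -> nabla X Y u - nabla Y X u = lie_bracket X Y u.
Proof.
move=> Uu; rewrite /levi_civita /lie_bracket.
suff -> : (\row_k \sum_(i < m) \sum_(j < m)
     Y u 0 i * X u 0 j * christoffel (M_metric R n) phi u i j k) =
   (\row_k \sum_(i < m) \sum_(j < m)
     X u 0 i * Y u 0 j * christoffel (M_metric R n) phi u i j k).
  by rewrite opprD addrACA subrr addr0.
apply/rowP => k; rewrite !mxE exchange_big; apply: eq_bigr => i _; apply: eq_bigr => j _.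
by rewrite (christoffelC j i k Uu) [Y u 0 j * _]mulrC.
Qed.

End Param.

Lemma M_parallel s : parallel m M (M_metric R n) (M_action R n s).
Proof. by move=> U phi lp X Y sX sY u Uu; exact (nabla_endo lp s X sY Uu). Qed.

Lemma unit_sqr (u v w : R[i]) : u ^+ 2 + v ^+ 2 + w ^+ 2 = 1 ->
  bq_mul (0, u, v, w) (0, u, v, w) = (-1, 0, 0, 0).
Proof.
move=> e; have e0 : 0 * 0 - u * u - v * v - w * w = -1 by rewrite -e; ring.
have e1 : 0 * u + u * 0 + v * w - w * v = 0 by ring.
have e2 : 0 * v - u * w + v * 0 + w * u = 0 by ring.
have e3 : 0 * w + u * v - v * u + w * 0 = 0 by ring.
by rewrite /bq_mul e0 e1 e2 e3.
Qed.

Lemma act_minus1 (p : E) a : bq_act_model (-1, 0, 0, 0) p a = - a.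
Proof.
rewrite /bq_act_model of_Rx0 !scale0r !addr0.
have -> : of_Rx (-1) = -1 :> B by exact (etrans (rmorphN (@of_Rx R) 1) (congr1 -%R (@of_Rx1 R))).
by rewrite scaleN1r.
Qed.

Section Unit.
Variables (u v w : R[i]).
Hypothesis uvw : u ^+ 2 + v ^+ 2 + w ^+ 2 = 1.
Local Notation s := ((0, u, v, w) : biquaternion R).
Local Notation J := (M_action R n s).

Lemma unit_model_sqr p a : M p -> tang p.1 a ->
  bq_act_model s p (bq_act_model s p a) = - a.
Proof.
move=> Mp ta; apply: etrans (esym (bq_act_mul Mp s s ta)) _.
by rewrite (unit_sqr uvw); exact: act_minus1.
Qed.

Lemma unit_almost_complex : almost_complex M J.
Proof.
move=> p Mp a /(tangent_tspace i0 Mp) ta.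
have [t1 e1] := actionP i0 s Mp ta; have [t2 e2] := actionP i0 s Mp t1.
have tN : tspace p (- a).
  have := tspace_lin (-1) ta (tspace0 p); rewrite addr0 scaleN1r; exact.
apply: (tspace_inj t2 tN); rewrite e2 e1.
exact: (unit_model_sqr Mp ta.1).
Qed.

(** J is skew and J^2 = -1. *)
Lemma unit_compatible : compatible M (M_metric R n) J.
Proof.
move=> p Mp a b /(tangent_tspace i0 Mp) ta /(tangent_tspace i0 Mp) tb.
have [t1 e1] := actionP i0 s Mp ta; have [t2 e2] := actionP i0 s Mp tb.
have hN : - bc_re (h_form p a.1 (- b.1)) = bc_re (h_form p a.1 b.1).
  apply: etrans (congr1 (fun t => - bc_re t) (hNr bstar (half R) (of_Rx p.2) p.1 a.1 b.1)) _.
  exact (etrans (congr1 -%R (raddfN (@bc_re R) _)) (opprK _)).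
have e3 := congr1 (fun t => - bc_re (h_form p a.1 t)) (unit_model_sqr Mp tb.1).
have e4 := unit_skew Mp u v w ta.1 (bq_act_tang Mp s tb.1).
exact (etrans (congr2 (fun x y => bc_re (h_form p x y)) e1 e2) (etrans e4 (etrans e3 hN))).
Qed.

Lemma unit_integrable : Defs.integrable m M J.
Proof.
move=> U phi lp X Y sX sY x Ux /=.
have sJX := endo_app_smooth lp s sX; have sJY := endo_app_smooth lp s sY.
have KK (y : 'rV[R]_m) : y *m endo_mx J phi x *m endo_mx J phi x = - y.
  apply: (dparam_inj lp Ux).
  apply: etrans (hat_endo lp s _ Ux) _.
  apply: etrans (congr1 (bq_act_model s (phi x)) (hat_endo lp s y Ux)) _.
  apply: etrans (unit_model_sqr (lp_M lp Ux) (hat_tang lp y Ux)) _.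
  exact (esym (dparamN1 y (lp_diff lp Ux))).
rewrite /endo_app -[lie_bracket X Y x](nabla_torsion_free lp X Y Ux).
rewrite -[lie_bracket _ Y x](nabla_torsion_free lp _ Y Ux).
rewrite -[lie_bracket X _ x](nabla_torsion_free lp X _ Ux).
rewrite -[lie_bracket _ _ x](nabla_torsion_free lp _ _ Ux).
rewrite -/(endo_app J phi X) -/(endo_app J phi Y).
rewrite (nabla_endo lp s (endo_app J phi X) sY Ux) (nabla_endo lp s (endo_app J phi Y) sX Ux).
rewrite (nabla_endo lp s Y sX Ux) (nabla_endo lp s X sY Ux).
exact: nijenhuis_zero.
Qed.

End Unit.

Lemma M_complex_hyperkahler : complex_hyperkahler m M (M_metric R n) (M_action R n).
Proof.
split.
- exact: M_submanifold.
- exact: M_pseudo_riemannian.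
- exact: M_bundle_endo.
- move=> p Mp a /(tangent_tspace i0 Mp) ta r s t.
  have [t1 e1] := actionP i0 (bq_add (bq_scale r%:C s) t) Mp ta.
  have [t2 e2] := actionP i0 s Mp ta; have [t3 e3] := actionP i0 t Mp ta.
  apply: (tspace_inj t1 (tspace_lin r t2 t3)); apply: etrans e1 _.
  apply: etrans (bq_act_scale r s t p a.1) _.
  exact (esym (congr2 (fun x y => of_Rx r%:C *: x + y) e2 e3)).
- move=> p Mp a /(tangent_tspace i0 Mp) ta.
  have [t1 e1] := actionP i0 (bq_one R) Mp ta.
  exact (tspace_inj t1 ta (etrans e1 (bq_act_one p a.1))).
- move=> p Mp a /(tangent_tspace i0 Mp) ta s t.
  have [t1 e1] := actionP i0 (bq_mul s t) Mp ta.
  have [t2 e2] := actionP i0 t Mp ta; have [t3 e3] := actionP i0 s Mp t2.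
  apply: (tspace_inj t1 t3); apply: etrans e1 (etrans (bq_act_mul Mp s t ta.1) _).
  exact (esym (etrans e3 (congr1 (bq_act_model s p) e2))).
- exact: M_parallel.
- move=> c p Mp a b /(tangent_tspace i0 Mp) ta /(tangent_tspace i0 Mp) tb.
  have [t1 e1] := actionP i0 (c, 0, 0, 0) Mp ta.
  have [t2 e2] := actionP i0 (c, 0, 0, 0) Mp tb.
  have e3 := congr1 (@bc_re R) (scalars_adj p c a.1 b.1).
  have e4 := congr1 (fun x => bc_re (h_form p x b.1)) e1.
  exact (etrans e4 (etrans e3 (esym (congr1 (fun x => bc_re (h_form p a.1 x)) e2)))).
- move=> u v w uvw; split.
  + exact: unit_almost_complex.
  + exact: unit_integrable.
  + exact: unit_compatible.
Qed.

End Hyperkahler.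

Theorem mainTheorem2 (R : realType) (n : nat) (n_gt1 : (1 < n)%N) :
  (forall p : ambient R n, M_space R n p ->
     set_bij (tangent (M_space R n) p) (tangent_model p.1)
       (fun v : ambient R n => v.1))
  /\ exists m : nat,
       complex_hyperkahler m (M_space R n) (M_metric R n) (M_action R n).
Proof.
have i0 : 'I_n := Ordinal (ltnW n_gt1).
split=> [p Mp|]; first exact: (tangent_bij i0 Mp).
by exists (M_dim R i0); exact: M_complex_hyperkahler.
Qed.
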